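(* Suppose that the loss $\ell:\mathcal Y\times\mathcal Y\to\mathbb R$ satisfies, for all $\mathbf y,\mathbf y',\mathbf v,\mathbf v'\in\mathcal Y$, $|\ell(\mathbf y,\mathbf v)-\ell(\mathbf y',\mathbf v')|\le L_\ell(\|\mathbf y-\mathbf y'\|_2+\|\mathbf v-\mathbf v'\|_2)$, and that every $f\in\mathcal F$ satisfies $\|f(\rho,\mathbf x)-f(\rho',\mathbf x')\|_2\le L_f(W_1(\rho,\rho')+\|\mathbf x-\mathbf x'\|_2)$ for all $\rho,\rho'\in\mathcal P(\mathcal Z)$ and $\mathbf x,\mathbf x'\in\mathcal X$ (with the same constant $L_f$ for all $f\in\mathcal F$). Let $f^*\in\arg\min_{f\in\mathcal F}R_{\mathbb P}^{\ell}(f)$. Assume further that the meta-distribution $\mathbb P$ satisfies $d_{1,q}^*(\mathbb P)\le s$ for some $q>1$ and $s>2$, so that $\mathbb E[\mathbb W_1(\hat{\mathbb P}_T,\mathbb P)]\lesssim T^{-1/s}$. Then both the masked ICL estimator $\hat f\in\arg\min_{f\in\mathcal F}\widehat R_{T,N}^{\ell}(f)$ and the autoregressive ICL estimator $\bar f\in\arg\min_{f\in\mathcal F}\overline R_{T,N}^{\ell}(f)$ satisfy $$\mathbb E[R_{\mathbb P}^{\ell}(f_{T,N})]-R_{\mathbb P}^{\ell}(f^* )\lesssim T^{-1/s}+N^{-1/(d_x+d_y)}+N^{-1},$$ where $f_{T,N}$ denotes either $\hat f$ or $\bar f$. The implicit constant depends only on $L_\ell$, $L_f$, $M_\ell$,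 the diameters of $\mathcal X$ and $\mathcal Y$, and the constants in the Wasserstein convergence bounds (the bound of order $T^{-1/s}$ for $\mathbb E[\mathbb W_1(\hat{\mathbb P}_T,\mathbb P)]$ and the bound of order $n^{-1/(d_x+d_y)}$ for the expected $W_1$ distance between a measure on $\mathcal Z$ and its $n$-sample empirical measure).
   Context: Setting. $\mathcal X\subseteq\mathbb R^{d_x}$ and $\mathcal Y\subseteq\mathbb R^{d_y}$ are compact, $\mathcal Z:=\mathcal X\times\mathcal Y\subseteq\mathbb R^{d_x+d_y}$, all with the Euclidean norm. $\mathcal P(\mathcal Z)$ is the space of Borel probability measures on $\mathcal Z$ with the weak topology; a task is an element $\rho\in\mathcal P(\mathcal Z)$, and $\mathbb P\in\mathcal P(\mathcal P(\mathcal Z))$ is a meta-distribution (a Borel probability measure on $\mathcal P(\mathcal Z)$). $a\lesssim b$ means $a\le Cb$ with a constant $C>0$ independent of the sample-size parameters (here $T,N$). $M_\ell:=\sup_{\mathbf y,\mathbf y'\in\mathcal Y}|\ell(\mathbf y,\mathbf y')|<\infty$. Distances. $W_1(\rho,\rho'):=\inf_{\gamma\in\Gamma(\rho,\rho')}\int\|\mathbf z-\mathbf z'\|_2\,d\gamma(\mathbf z,\mathbf z')$ for $\rho,\rho'\in\mathcal P(\mathcal Z)$; for meta-distributions, $\mathbb W_1(\mathbb P,\mathbb Q):=\inf_{\pi\in\Gamma(\mathbb P,\mathbb Q)}\int W_1(\rho,\rho')\,d\pi(\rho,\rho')$. $\Gamma(\cdot,\cdot)$ denotes the set of couplings. Dimension.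 For a metric space $(\Omega,d)$ and $S\subseteq\Omega$, $\mathcal N_\varepsilon(S)$ is the smallest number of closed balls of diameter $\varepsilon$ needed to cover $S$; for a probability measure $\mu$ on $\Omega$, $\mathcal N_\varepsilon(\mu,\tau):=\inf\{\mathcal N_\varepsilon(S):\mu(S)\ge1-\tau\}$. For $0<p<q<\infty$, $$d_{p,q}^*(\mu):=\inf\Big\{r>2p:\limsup_{\varepsilon\to0}\frac{\log\mathcal N_\varepsilon\big(\mu,\varepsilon^{\frac{rpq}{(q-p)(r-2p)}}\big)}{\log(1/\varepsilon)}\le r\Big\}.$$ For $\mathbb P$ this is taken with $\Omega=\mathcal P(\mathcal Z)$ and metric $W_1$. Predictors and risk. $\mathcal F$ is a class of measurable maps $f:\mathcal P(\mathcal Z)\times\mathcal X\to\mathcal Y$, and $R_{\mathbb P}^{\ell}(f):=\int_{\mathcal P(\mathcal Z)}\int_{\mathcal Z}\ell(\mathbf y,f(\rho,\mathbf x))\,d\rho(\mathbf x,\mathbf y)\,d\mathbb P(\rho)$. Training data. $T\ge1$, $N\ge2$; $(\rho_t)_{t=1}^T$ are i.i.d. from $\mathbb P$ and, for each $t$, given $\rho_t$, $\mathbf z_{t,j}=(\mathbf x_{t,j},\mathbf y_{t,j})$, $j=1,\dots,N$, are i.i.d. from $\rho_t$. $\hat{\mathbb P}_T:=\frac1T\sum_{t=1}^T\delta_{\rho_t}$; $\hat\rho_t^{\,(-j)}:=\frac1{N-1}\sum_{j'\ne j}\delta_{\mathbf z_{t,j'}}$; $\hat\rho_t^{(<j)}:=\frac1{j-1}\sum_{j'=1}^{j-1}\delta_{\mathbf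 z_{t,j'}}$ for $j\ge2$. Objectives. Masked: $\widehat R_{T,N}^{\ell}(f):=\frac1{TN}\sum_{t=1}^T\sum_{j=1}^N\ell(\mathbf y_{t,j},f(\hat\rho_t^{\,(-j)},\mathbf x_{t,j}))$. Autoregressive: $\overline R_{T,N}^{\ell}(f):=\frac1{T(N-1)}\sum_{t=1}^T\sum_{j=2}^N\ell(\mathbf y_{t,j},f(\hat\rho_t^{(<j)},\mathbf x_{t,j}))$. Expectations are over the training data.
   Formalization: When d*_{1,q}(P) = s, the T^{-1/s} bound for E[W_1(P_T,P)] is assumed (proved only for d* < s); when d_x = d_y = 1, the n^{-1/2} empirical W_1 bound, uniform over all measures on Z, is assumed (proved for d_x+d_y >= 3); both can fail in these cases. *)

(* Defs.v *)
From HB Require Import structures.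
From mathcomp Require Import all_boot all_order all_algebra.
From mathcomp Require Import all_classical all_reals all_analysis.

Set Implicit Arguments.
Unset Strict Implicit.
Unset Printing Implicit Defensive.

Import Order.TTheory GRing.Theory Num.Theory.
Import numFieldNormedType.Exports.

Local Open Scope classical_set_scope.
Local Open Scope ring_scope.

(* The library norm on row vectors is the sup norm, with the same topology. *)
Definition enorm (R : realType) (n : nat) (v : 'rV[R]_n) : R :=
  Num.sqrt (\sum_i v ord0 i ^+ 2).

Definition diam (R : realType) (n : nat) (A : set 'rV[R]_n) : R :=
  sup [set enorm (x - y) | x in A & y in A].

(* Nonemptiness is implicit as soon as a probability measure on the set is
   given; the library needs it because its measurable types are pointed. *)
Record compact_dom (R : realType) (n : nat) := CompactDom {
  dom_set : set 'rV[R]_n ;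
  dom_compact : compact dom_set ;
  dom_nonempty : dom_set !=set0 }.

Definition pts (R : realType) (n : nat) (K : compact_dom R n) : Type :=
  set_type (dom_set K).

Definition pval (R : realType) (n : nat) (K : compact_dom R n) (x : pts K) :
  'rV[R]_n := set_val x.

Section pts_instances.
Variables (R : realType) (n : nat) (K : compact_dom R n).

HB.instance Definition _ :=
  Topological.copy (pts K) (set_type (dom_set K)).

Let pts_point : pts K :=
  exist _ (projT1 (cid (dom_nonempty K)))
    (mem_set (projT2 (cid (dom_nonempty K)))).

HB.instance Definition _ := isPointed.Build (pts K) pts_point.
End pts_instances.

(* Missing join of the pointed and topological structures on products. *)
HB.instance Definition _ (T U : ptopologicalType) :=
  Topological.on (T * U)%type.

(* T with its Borel sigma-algebra. *)
Notation borel T := (g_sigma_algebraType (@open T)).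

(* Borel probability measures on T, with the topology of weak convergence. *)
Section weak_topology_on_probabilities.
Variables (R : realType) (T : ptopologicalType).

Definition Prob : Type := probability (borel T) R.

HB.instance Definition _ := Pointed.copy Prob (probability (borel T) R).

Definition bounded_continuous (g : T -> R) : Prop :=
  continuous g /\ exists M : R, forall x, `|g x| <= M.

HB.instance Definition _ := @isSubBaseTopological.Build Prob
  ((T -> R) * set R)%type
  [set gU | bounded_continuous gU.1 /\ open gU.2]
  (fun gU => [set mu : Prob |
     gU.2 (Rintegral (mu : probability (borel T) R) setT gU.1)]).

End weak_topology_on_probabilities.

Section wasserstein.
Context (R : realType) (d : measure_display) (T : measurableType d).

Definition coupling (mu nu : probability T R) (g : probability (T * T)%type R)
    : Prop :=
  (forall A, measurable A -> g (A `*` setT) = mu A) /\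
  (forall B, measurable B -> g (setT `*` B) = nu B).

Definition wass1 (dist : T -> T -> \bar R) (mu nu : probability T R) : \bar R :=
  ereal_inf [set (\int[g]_p dist p.1 p.2)%E | g in coupling mu nu].

End wasserstein.

(* The uniform distribution on the entries of s, counted with multiplicity
   (see empirical_measureE); the second argument of mnormalize is the value
   used for the empty sequence only. *)
Definition empirical_measure (R : realType) (d : measure_display)
    (T : measurableType d) (s : seq T) : probability T R :=
  mnormalize
    (msum (fun i => dirac (nth point s i) : {measure set T -> \bar R}) (size s))
    (dirac point : probability T R).

Lemma empirical_measureE (R : realType) (d : measure_display)
    (T : measurableType d) (s : seq T) (A : set T) : (0 < size s)%N ->
  empirical_measure R s A =
    (((size s)%:R^-1)%:E * \sum_(x <- s) \d_x A)%E :> \bar R.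
Proof.
move=> s0; rewrite /empirical_measure /= /mnormalize.
set m := (X in (X setT == _) || _).
have mE B : m B = (\sum_(x <- s) \d_x B)%E.
  by rewrite /m /= /msum (big_nth point) big_mkord.
have mT : m setT = ((size s)%:R)%:E.
  rewrite mE; under eq_bigr do rewrite diracT.
  rewrite big_const_seq count_predT.
  by elim: (size s) => //= k ->; rewrite -EFinD -[k.+1]addn1 natrD addrC.
rewrite ifF; last first.
  change ((m setT == 0%E) || (m setT == +oo%E) = false).
  by rewrite mT eqe pnatr_eq0 eqn0Ngt s0.
change ((m A * ((fine (m setT))^-1)%:E)%E =
  (((size s)%:R^-1)%:E * \sum_(x <- s) \d_x A)%E).
by rewrite mT mE muleC.
Qed.

Section iid.
Context (R : realType) (d' : measure_display) (Om : measurableType d')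
  (Pr : probability Om R).

Definition iid_sample (d : measure_display) (T : measurableType d)
    (mu : probability T R) (n : nat) (X : 'I_n -> Om -> T) : Prop :=
  (forall i, measurable_fun setT (X i)) /\
  forall A : 'I_n -> set T, (forall i, measurable (A i)) ->
    Pr [set w | forall i, A i (X i w)] = (\prod_i fine (mu (A i)))%:E.

End iid.

(* E[W_1(mu_n, mu)] <= b, where mu_n is the empirical measure of n i.i.d. draws
   from mu; the law of mu_n does not depend on the sample space. *)
Definition empirical_bound (R : realType) (d : measure_display)
    (T : measurableType d) (dist : T -> T -> \bar R) (mu : probability T R)
    (n : nat) (b : R) : Prop :=
  forall (d' : measure_display) (Om : measurableType d')
    (Pr : probability Om R) (X : 'I_n -> Om -> T),
    iid_sample Pr mu X ->
    (\int[Pr]_w wass1 dist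
        (empirical_measure R [seq X i w | i <- enum 'I_n]) mu <= b%:E)%E.

Section dimension.
Context (R : realType) (d : measure_display) (T : measurableType d)
  (dist : T -> T -> \bar R).

(* A closed ball of diameter e is a closed ball of radius e / 2. *)
Definition covering_number (e : R) (S : set T) : \bar R :=
  ereal_inf [set (n%:R)%:E | n in
    [set n : nat | exists c : 'I_n -> T,
       S `<=` [set x | exists i, (dist (c i) x <= (e / 2)%:E)%E]]].

Definition covering_number_mass (mu : probability T R) (e tau : R) : \bar R :=
  ereal_inf [set covering_number e S | S in
    [set S | measurable S /\ ((1 - tau)%:E <= mu S)%E]].

Definition dstar (p q : R) (mu : probability T R) : \bar R :=
  ereal_inf [set r%:E | r in [set r : R | 2 * p < r /\
    (limf_esup (fun e : R =>
        lne (covering_number_mass mu e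
               (e `^ (r * p * q / ((q - p) * (r - 2 * p)))))
        * ((ln e^-1)^-1)%:E) 0^'+ <= r%:E)%E]].

End dimension.

Definition is_argmin (R : realType) (A : Type) (F : set A) (J : A -> R) (f : A)
    : Prop := F f /\ forall g, F g -> J f <= J g.

Section icl.
Context (R : realType) (dx dy : nat) (X : compact_dom R dx)
  (Y : compact_dom R dy).

Local Notation Zs := (pts X * pts Y)%type.

Definition zdist (z z' : Zs) : \bar R :=
  (enorm (row_mx (pval z.1) (pval z.2) - row_mx (pval z'.1) (pval z'.2)))%:E.

Definition W1 (rho rho' : Prob R Zs) : \bar R :=
  wass1 (zdist : borel Zs -> borel Zs -> \bar R) rho rho'.

Definition meta_distribution : Type := probability (borel (Prob R Zs)) R.

Definition meta_dstar (p q : R) (P : meta_distribution) : \bar R :=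
  dstar (W1 : borel (Prob R Zs) -> borel (Prob R Zs) -> \bar R) p q P.

Definition predictor : Type := Prob R Zs -> pts X -> pts Y.

Definition measurable_predictor (f : predictor) : Prop :=
  measurable_fun setT
    (fun p : borel (Prob R Zs) * borel (pts X) => f p.1 p.2 : borel (pts Y)).

Definition lipschitz_loss (L : R) (l : pts Y -> pts Y -> R) : Prop :=
  forall y y' v v', `|l y v - l y' v'| <=
    L * (enorm (pval y - pval y') + enorm (pval v - pval v')).

Definition loss_bound (l : pts Y -> pts Y -> R) : R :=
  sup [set m | exists y y', m = `|l y y'|].

Definition lipschitz_predictor (L : R) (f : predictor) : Prop :=
  forall rho rho' x x', ((enorm (pval (f rho x) - pval (f rho' x')))%:E <=
    L%:E * (W1 rho rho' + (enorm (pval x - pval x'))%:E))%E.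

Definition risk (P : meta_distribution) (l : pts Y -> pts Y -> R)
    (f : predictor) : R :=
  Rintegral (P : probability (borel (Prob R Zs)) R) setT
    (fun rho : Prob R Zs =>
      Rintegral (rho : probability (borel Zs) R) setT
        (fun z : Zs => l z.2 (f rho z.1))).

(* Joint law of the training data, as a product formula on rectangles: the
   tasks rho_t are i.i.d. from P and,
   conditionally on them, the z_{t,j} are independent with law rho_t. *)
Definition icl_sample (d : measure_display) (Om : measurableType d)
    (Pr : probability Om R) (P : meta_distribution) (T N : nat)
    (rho : 'I_T -> Om -> Prob R Zs) (z : 'I_T -> 'I_N -> Om -> Zs) : Prop :=
  [/\ forall t, measurable_fun setT (rho t : Om -> borel (Prob R Zs)),
      forall t j, measurable_fun setT (z t j : Om -> borel Zs) &
      forall (A : 'I_T -> set (borel (Prob R Zs)))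
        (B : 'I_T -> 'I_N -> set (borel Zs)),
        (forall t, measurable (A t)) -> (forall t j, measurable (B t j)) ->
        Pr [set w | (forall t, A t (rho t w)) /\
                    (forall t j, B t j (z t j w))] =
        (\prod_t Rintegral (P : probability (borel (Prob R Zs)) R) (A t)
           (fun r : Prob R Zs =>
              \prod_j fine ((r : probability (borel Zs) R) (B t j))))%:E].

Definition empirical_on (N : nat) (z : 'I_N -> Zs) (J : pred 'I_N) : Prob R Zs :=
  empirical_measure R [seq (z k : borel Zs) | k <- enum J].

Definition masked_risk (T N : nat) (l : pts Y -> pts Y -> R)
    (z : 'I_T -> 'I_N -> Zs) (f : predictor) : R :=
  (T * N)%:R^-1 * \sum_(t < T) \sum_(j < N)
    l (z t j).2 (f (empirical_on (z t) [pred k | k != j]) (z t j).1).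

(* Indices are zero-based: the 1-based index j is the ordinal j - 1, and
   the sum over j >= 2 is the sum over the nonzero ordinals. *)
Definition autoregressive_risk (T N : nat) (l : pts Y -> pts Y -> R)
    (z : 'I_T -> 'I_N -> Zs) (f : predictor) : R :=
  (T * N.-1)%:R^-1 * \sum_(t < T) \sum_(j < N | (0 < j)%N)
    l (z t j).2
      (f (empirical_on (z t) [pred k : 'I_N | (k < j)%N]) (z t j).1).

Definition task_rate (P : meta_distribution) (s c : R) : Prop :=
  forall T : nat, (0 < T)%N ->
    empirical_bound (W1 : borel (Prob R Zs) -> borel (Prob R Zs) -> \bar R)
      P T (c * T%:R `^ (- s^-1)).

Definition sample_rate (c : R) : Prop :=
  forall (rho : Prob R Zs) (n : nat), (0 < n)%N ->
    empirical_bound (zdist : borel Zs -> borel Zs -> \bar R)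
      rho n (c * n%:R `^ (- ((dx + dy)%:R)^-1)).

End icl.

(* Main.v *)
Require Import Defs.
From HB Require Import structures.
From mathcomp Require Import all_boot all_order all_algebra.
From mathcomp Require Import ring lra finmap.
From mathcomp Require Import all_classical all_reals all_analysis.
From mathcomp Require Import measurable_realfun.
Set Implicit Arguments.
Unset Strict Implicit.
Unset Printing Implicit Defensive.
Import Order.TTheory GRing.Theory Num.Theory.
Import numFieldNormedType.Exports.
Local Open Scope classical_set_scope.
Local Open Scope ring_scope.

(* The distance W_1 is compared with the cost of transport between the weights
   of the cells of a finite measurable partition into small cells. This gives
   its metric properties and its measurability without duality or gluing of
   measures, on the space of examples and then on the space of tasks.

   Excess risk: it is at most twice the largest gap, over the class, between the
   risk and the empirical objective. The conditional risk of a predictor is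
   W_1-Lipschitz in the task, so the gap is bounded, uniformly in the predictor,
   by a multiple of the distance of the empirical meta-distribution to P plus
   averages of the distances of the contexts to their tasks. The latter
   have mean at most cN n^(- 1 / (dx + dy)) for contexts of size n, because the
   tasks and examples may be replaced by finitely many labels, for which
   conditioning on the task is a finite sum. For the autoregressive objective
   the average of j^(- 1 / (dx + dy)) over j < N is of order N^(- 1 / (dx + dy))
   with an absolute constant, since dx + dy >= 2.

   Rates: partition the space at the dyadic scales 2^j n^(- 1 / r). Moving the
   mass of each cell to its parent cell bounds W_1 by the sum over the scales of
   the scale times the l^1 distance between the cell frequencies and
   probabilities, of mean at most sqrt(number of cells / n); for r > 2 the sum is
   dominated by the finest scale. *)

(** * Transport between weights on finite sets *)

(** The distance of a random empirical measure to its limit is not shown to be a measurable function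
    on the sample space. Its integral is a supremum over simple functions, which is monotone but
    cannot be split into sums. Hence upper bounds go through explicit integrable majorants, and a
    given rate is used through an explicit integrable minorant of the distance.

    A second obstacle is that tasks carry the Borel sets of the weak topology, whereas distances
    between them are measured by W_1. The two topologies are not compared: the masses of finitely
    many cells are measurable functions of the task and determine it up to a small W_1 error. So the
    tasks, like the examples, split into finitely many small measurable cells, and the theory of a
    distance with this property is applied at both levels. *)

Definition transport (R : realType) (V W : finType) (c : V -> W -> R)
    (p : V -> R) (q : W -> R) (k : R) : Prop :=
  exists g : V -> W -> R,
    [/\ forall v w, 0 <= g v w, forall v, \sum_w g v w = p v,
        forall w, \sum_v g v w = q w & \sum_v \sum_w g v w * c v w <= k].

Section transport_theory.
Variable R : realType.

Lemma transport_le (V W : finType) (c c' : V -> W -> R) p q (k k' : R) :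
  (forall v w, c' v w <= c v w) -> k <= k' ->
  transport c p q k -> transport c' p q k'.
Proof.
move=> cc kk [g [g0 gp gq gk]]; exists g; split=> //.
apply: le_trans kk; apply: le_trans gk.
by apply: ler_sum => v _; apply: ler_sum => w _; apply: ler_wpM2l.
Qed.

Lemma transport_eq (V W : finType) (c : V -> W -> R) p p' q q' (k : R) :
  p =1 p' -> q =1 q' -> transport c p q k -> transport c p' q' k.
Proof.
move=> pp qq [g [g0 gp gq gk]]; exists g; split=> // v.
  by rewrite gp pp.
by rewrite gq qq.
Qed.

Lemma transport_refl (V : finType) (c : V -> V -> R) (p : V -> R) :
  (forall v, c v v = 0) -> (forall v, 0 <= p v) -> transport c p p 0.
Proof.
move=> c0 p0; exists (fun v w => p v * (v == w)%:R); split=> [v w|v|w|].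
- by rewrite mulr_ge0.
- rewrite (bigD1 v)//= eqxx mulr1 big1 ?addr0// => w /negbTE wv.
  by rewrite eq_sym wv mulr0.
- rewrite (bigD1 w)//= eqxx mulr1 big1 ?addr0// => v /negbTE wv.
  by rewrite wv mulr0.
- rewrite big1// => v _; rewrite big1// => w _.
  by have [->|] := eqVneq v w; rewrite ?c0 ?(mulr0, mul0r).
Qed.

Lemma transport_sym (V W : finType) (c : V -> W -> R) p q (k : R) :
  transport c p q k -> transport (fun w v => c v w) q p k.
Proof.
move=> [g [g0 gp gq gk]]; exists (fun w v => g v w); split=> //.
by rewrite exchange_big.
Qed.

(** The marginals need not have mass 1, so plans can be added and rescaled; the cancellation of a
    common mass below rests on this. *)
Lemma transportD (V W : finType) (c : V -> W -> R) p p' q q' (k k' : R) :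
  transport c p q k -> transport c p' q' k' ->
  transport c (fun v => p v + p' v) (fun w => q w + q' w) (k + k').
Proof.
move=> [g [g0 gp gq gk]] [h [h0 hp hq hk]].
exists (fun v w => g v w + h v w); split=> [v w|v|w|].
- exact: addr_ge0.
- by rewrite big_split/= gp hp.
- by rewrite big_split/= gq hq.
- apply: le_trans (lerD gk hk); rewrite -big_split/=; apply: ler_sum => v _.
  by rewrite -big_split/=; apply: ler_sum => w _; rewrite mulrDl.
Qed.

Lemma transportZ (V W : finType) (c : V -> W -> R) p q (k a : R) : 0 <= a ->
  transport c p q k ->
  transport c (fun v => a * p v) (fun w => a * q w) (a * k).
Proof.
move=> a0 [g [g0 gp gq gk]].
exists (fun v w => a * g v w); split=> [v w|v|w|].
- exact: mulr_ge0.
- by rewrite -mulr_sumr gp.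
- by rewrite -mulr_sumr gq.
- under eq_bigr do under eq_bigr do rewrite -mulrA.
  under eq_bigr do rewrite -mulr_sumr.
  by rewrite -mulr_sumr ler_wpM2l.
Qed.

Lemma transport_map (V W : finType) (c : V -> W -> R) (f : V -> W)
    (p : V -> R) : (forall v, 0 <= p v) ->
  transport c p (fun w => \sum_(v | f v == w) p v) (\sum_v p v * c v (f v)).
Proof.
move=> p0; exists (fun v w => p v * (f v == w)%:R); split=> [v w|v|w|].
- by rewrite mulr_ge0.
- rewrite (bigD1 (f v))//= eqxx mulr1 big1 ?addr0// => w /negbTE wv.
  by rewrite eq_sym wv mulr0.
- rewrite [RHS]big_mkcond/=; apply: eq_bigr => v _.
  by case: eqP; rewrite ?mulr1 ?mulr0.
- apply: ler_sum => v _; rewrite (bigD1 (f v))//= eqxx mulr1 big1 ?addr0//.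
  by move=> w /negbTE wv; rewrite eq_sym wv mulr0 mul0r.
Qed.

(* Gluing of two couplings along their common marginal [q]; where [q] vanishes
   both couplings do, which is why the junk value of the quotient is harmless. *)
Lemma transport_trans (V W U : finType) (c1 : V -> W -> R) (c2 : W -> U -> R)
    (c3 : V -> U -> R) p q r (k1 k2 : R) :
  (forall v w u, c3 v u <= c1 v w + c2 w u) ->
  transport c1 p q k1 -> transport c2 q r k2 -> transport c3 p r (k1 + k2).
Proof.
move=> tri [g [g0 gp gq gk]] [h [h0 hq hr hk]].
have q0 w : 0 <= q w by rewrite -gq sumr_ge0.
have gz v w : q w = 0 -> g v w = 0.
  move=> qw; apply/eqP; rewrite eq_le g0 andbT -qw -gq (bigD1 v)//= lerDl.
  by rewrite sumr_ge0.
have hz w u : q w = 0 -> h w u = 0.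
  move=> qw; apply/eqP; rewrite eq_le h0 andbT -qw -hq (bigD1 u)//= lerDl.
  by rewrite sumr_ge0.
have ghu v w : \sum_u g v w * h w u / q w = g v w.
  rewrite -mulr_suml -mulr_sumr hq.
  have [qw|qw] := eqVneq (q w) 0; last by rewrite mulfK.
  by rewrite gz// !mul0r.
have ghv w u : \sum_v g v w * h w u / q w = h w u.
  rewrite -!mulr_suml gq.
  have [qw|qw] := eqVneq (q w) 0; last by rewrite mulrC mulKf.
  by rewrite hz// !mulr0 mul0r.
exists (fun v u => \sum_w g v w * h w u / q w); split=> [v u|v|u|].
- by apply: sumr_ge0 => w _; rewrite divr_ge0// mulr_ge0.
- by rewrite exchange_big/= -gp; apply: eq_bigr => w _; rewrite ghu.
- by rewrite exchange_big/= -hr; apply: eq_bigr => w _; rewrite ghv.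
  apply: le_trans (lerD gk hk).
  apply: (@le_trans _ _ (\sum_v \sum_u \sum_w
      (g v w * h w u / q w * c1 v w + g v w * h w u / q w * c2 w u))).
    apply: ler_sum => v _; apply: ler_sum => u _; rewrite mulr_suml.
    apply: ler_sum => w _; rewrite -mulrDr ler_wpM2l//.
    by rewrite divr_ge0// mulr_ge0.
  under eq_bigr do under eq_bigr do rewrite big_split/=.
  under eq_bigr do rewrite big_split/=.
  rewrite big_split/= lerD//.
    apply: ler_sum => v _; rewrite exchange_big/=; apply: ler_sum => w _.
    by rewrite -mulr_suml ghu.
  rewrite exchange_big/= [leRHS]exchange_big/=; apply: ler_sum => u _.
  rewrite exchange_big/=; apply: ler_sum => w _.
  by rewrite -mulr_suml ghv.
Qed.

(* The mass left over by a partial coupling is transported at the maximal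
   cost [D]. *)
Lemma transport_fill (V W : finType) (c : V -> W -> R) p q (D : R)
    (g : V -> W -> R) :
  (forall v w, c v w <= D) -> (forall v w, 0 <= g v w) ->
  (forall v, \sum_w g v w <= p v) -> (forall w, \sum_v g v w <= q w) ->
  \sum_v p v = \sum_w q w ->
  transport c p q (\sum_v \sum_w g v w * c v w +
                   D * (\sum_v p v - \sum_v \sum_w g v w)).
Proof.
move=> cD g0 gp gq pq.
set G := \sum_v \sum_w g v w; set S := \sum_v p v - G.
pose p' v := p v - \sum_w g v w; pose q' w := q w - \sum_v g v w.
have p'0 v : 0 <= p' v by rewrite subr_ge0.
have q'0 w : 0 <= q' w by rewrite subr_ge0.
have Sp : \sum_v p' v = S by rewrite /S/G -sumrB.
have Sq : \sum_w q' w = S by rewrite /S/G pq exchange_big/= -sumrB.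
have S0 : 0 <= S by rewrite -Sp sumr_ge0.
have pz v : S = 0 -> p' v = 0.
  move=> S_0; apply/eqP; rewrite eq_le p'0 andbT -S_0 -Sp (bigD1 v)//= lerDl.
  by rewrite sumr_ge0.
have qz v : S = 0 -> q' v = 0.
  move=> S_0; apply/eqP; rewrite eq_le q'0 andbT -S_0 -Sq (bigD1 v)//= lerDl.
  by rewrite sumr_ge0.
have hp v : \sum_w p' v * q' w / S = p' v.
  rewrite -mulr_suml -mulr_sumr Sq.
  have [Sz|Sz] := eqVneq S 0; last by rewrite mulfK.
  by rewrite pz// !mul0r.
have hq w : \sum_v p' v * q' w / S = q' w.
  rewrite -!mulr_suml Sp.
  have [Sz|Sz] := eqVneq S 0; last by rewrite mulrC mulKf.
  by rewrite qz// !mulr0 mul0r.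
exists (fun v w => g v w + p' v * q' w / S); split=> [v w|v|w|].
- by rewrite addr_ge0// divr_ge0// mulr_ge0.
- by rewrite big_split/= hp /p' addrC subrK.
- by rewrite big_split/= hq /q' addrC subrK.
- under eq_bigr do under eq_bigr do rewrite mulrDl.
  under eq_bigr do rewrite big_split/=.
  rewrite big_split/= lerD2l -[X in _ <= D * X]Sp mulr_sumr.
  apply: ler_sum => v _.
  rewrite -[X in _ <= D * X]hp mulr_sumr; apply: ler_sum => w _.
  by rewrite mulrC ler_wpM2r// divr_ge0// mulr_ge0.
Qed.

(* Adding [n] copies of the transport of [p + r] to [q + r] end to end moves
   [n p + r] to [n q + r]; after division by [n] the common part [r / n] is
   negligible. *)
Lemma transport_cancel (V : finType) (c : V -> V -> R) (D : R)
    (p q r : V -> R) (k e : R) :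
  (forall v, c v v = 0) -> (forall u v w, c u w <= c u v + c v w) ->
  (forall v w, 0 <= c v w) -> (forall v w, c v w <= D) ->
  (forall v, 0 <= p v) -> (forall v, 0 <= q v) -> (forall v, 0 <= r v) ->
  transport c (fun v => p v + r v) (fun v => q v + r v) k -> 0 < e ->
  transport c p q (k + e).
Proof.
move=> c0 tri cge cD p0 q0 r0 T e0.
have chain n : transport c (fun v => n%:R * p v + r v)
                           (fun v => n%:R * q v + r v) (n%:R * k).
  elim: n => [|n IH].
    rewrite mul0r; apply: transport_eq (transport_refl c0 r0) => v;
    by rewrite mul0r add0r.
  have nq0 v : 0 <= n%:R * q v by rewrite mulr_ge0.
  have T1 := transportD IH (transport_refl c0 p0).
  have T2 := transportD T (transport_refl c0 nq0).
  have T2' : transport c (fun v => n%:R * q v + r v + p v)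
      (fun v => q v + r v + n%:R * q v) (k + 0).
    by apply: transport_eq T2 => v; ring.
  have := transport_trans tri T1 T2'.
  rewrite !addr0 -natr1 mulrDl mul1r; apply: transport_eq => v; ring.
(* [n] exceeds [D * (\sum_v r v) / e], so that moving the remainder [r / n] at the maximal cost [D]
   adds at most [e]. *)
pose n := (Num.bound (D * (\sum_v r v) / e)).+1.
have n0 : 0 < n%:R :> R by rewrite ltr0n.
have := transportZ (ltW (divr_gt0 ltr01 n0)) (chain n).
pose r' v := r v / n%:R.
have r'0 v : 0 <= r' v by rewrite divr_ge0// ltW.
rewrite mulrA mul1r mulVf ?gt_eqF// mul1r => T'.
have {}T' : transport c (fun v => p v + r' v) (fun v => q v + r' v) k.
  by apply: transport_eq T' => v; rewrite mulrDr mulKf ?gt_eqF// mulrC.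
have [g [g0 gp gq gk]] := T'.
(* Of the mass leaving [v], the fraction [th v] belongs to [p]; of the mass reaching [w], the
   fraction [et w] belongs to [q]. Keeping the product of the fractions gives a partial plan with
   marginals below [p] and [q], which [transport_fill] completes. *)
pose th v := p v / (p v + r' v); pose et v := q v / (q v + r' v).
have th01 v : 0 <= th v <= 1.
  rewrite /th divr_ge0 ?addr_ge0//=; have [->|pr] := eqVneq (p v + r' v) 0.
    by rewrite invr0 mulr0.
  by rewrite ler_pdivrMr ?mul1r ?lerDl// lt_neqAle eq_sym pr addr_ge0.
have et01 v : 0 <= et v <= 1.
  rewrite /et divr_ge0 ?addr_ge0//=; have [->|pr] := eqVneq (q v + r' v) 0.
    by rewrite invr0 mulr0.
  by rewrite ler_pdivrMr ?mul1r ?lerDl// lt_neqAle eq_sym pr addr_ge0.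
have thp v : th v * (p v + r' v) = p v.
  have [pr|pr] := eqVneq (p v + r' v) 0; last by rewrite divfK.
  by rewrite pr mulr0; apply/eqP; rewrite eq_le p0 -pr lerDl/=.
have etq v : et v * (q v + r' v) = q v.
  have [pr|pr] := eqVneq (q v + r' v) 0; last by rewrite divfK.
  by rewrite pr mulr0; apply/eqP; rewrite eq_le q0 -pr lerDl/=.
pose g' v w := g v w * (th v * et w).
have g'g v w : g' v w <= g v w.
  rewrite /g'; have /andP[a b] := th01 v; have /andP[a' b'] := et01 w.
  by rewrite -[leRHS]mulr1 ler_wpM2l// mulr_ile1.
have g'0 v w : 0 <= g' v w.
  have /andP[a _] := th01 v; have /andP[a' _] := et01 w.
  by rewrite /g' mulr_ge0// mulr_ge0.
have Sg : \sum_v p v = \sum_v q v.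
  have : \sum_v (p v + r' v) = \sum_v (q v + r' v).
    under eq_bigr do rewrite -gp; under [RHS]eq_bigr do rewrite -gq.
    exact: exchange_big.
  by rewrite !big_split/= => /addIr.
have := @transport_fill _ _ c p q D g' cD g'0 _ _ Sg.
have H1 v : \sum_w g' v w <= p v.
  rewrite -(thp v) -gp mulr_sumr; apply: ler_sum => w _.
  rewrite /g' mulrCA ler_wpM2l//; first by have /andP[] := th01 v.
  by rewrite -[leRHS]mulr1 ler_wpM2l//; have /andP[] := et01 w.
have H2 w : \sum_v g' v w <= q w.
  rewrite -(etq w) -gq mulr_sumr; apply: ler_sum => v _.
  rewrite /g' mulrA mulrC ler_wpM2l//; first by have /andP[] := et01 w.
  by rewrite -[leRHS]mulr1 ler_wpM2l//; have /andP[] := th01 v.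
move=> /(_ H1 H2); apply: transport_le => //; apply: lerD.
  apply: le_trans gk; apply: ler_sum => v _; apply: ler_sum => w _.
  by rewrite ler_wpM2r.
have [D0|D0] := ltP D 0.
  apply: le_trans (ltW e0); rewrite nmulr_rle0// subr_ge0.
  by apply: ler_sum.
apply: (@le_trans _ _ (D * \sum_v r' v)).
  rewrite ler_wpM2l// lerBlDr -lerBlDl.
  (* Since [(1 - th v) * (1 - et w)] is nonnegative, the partial plan is at least
     [g * (th + et - 1)], whose total mass is that of [p] minus that of [r']. So at most the mass of
     [r'] remains to be filled in. *)
  apply: (@le_trans _ _ (\sum_v \sum_w (g v w * th v + g v w * et w - g v w))).
    have E v : \sum_w (g v w * th v + g v w * et w - g v w) =
        p v + \sum_w g v w * et w - (p v + r' v).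
      by rewrite sumrB big_split/= gp -{1}mulr_suml gp mulrC thp.
    under [leRHS]eq_bigr do rewrite E.
    rewrite sumrB big_split/= exchange_big/=.
    have -> : \sum_w \sum_v g v w * et w = \sum_v p v.
      by rewrite Sg; apply: eq_bigr => w _; rewrite -mulr_suml gq mulrC etq.
    by rewrite big_split/= opprD addrA addrK.

  apply: ler_sum => v _; apply: ler_sum => w _.
  rewrite /g'; have /andP[a b] := th01 v; have /andP[a' b'] := et01 w.
  have : 0 <= g v w * ((1 - th v) * (1 - et w)).
    by rewrite !mulr_ge0 ?subr_ge0.
  lra.
rewrite -mulr_suml mulrA ler_pdivrMr// [leRHS]mulrC -ler_pdivrMr//.
apply: (@le_trans _ _ ((Num.bound (D * (\sum_v r v) / e))%:R)).
  by apply/ltW/archi_boundP; rewrite divr_ge0 ?mulr_ge0 ?sumr_ge0// ltW.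
by rewrite ler_nat.
Qed.

(** The common part of [p] and [q] stays in place. Only the excesses travel to the coarse points,
    are transported there, and travel back, hence the factor [|p v - q v|]. The coarse plan is given
    for the full weights; [transport_cancel] removes the common part from it at the price of [e]. *)
Lemma transport_push (V W : finType) (Z : Type) (d : Z -> Z -> R) (D : R)
    (x : V -> Z) (y : W -> Z) (f : V -> W) (p q : V -> R) (k e : R) :
  (forall a, d a a = 0) -> (forall a b, d a b = d b a) ->
  (forall a b c, d a c <= d a b + d b c) ->
  (forall a b, 0 <= d a b) -> (forall a b, d a b <= D) ->
  (forall v, 0 <= p v) -> (forall v, 0 <= q v) ->
  transport (fun a b => d (y a) (y b)) (fun w => \sum_(v | f v == w) p v)
    (fun w => \sum_(v | f v == w) q v) k -> 0 < e ->
  transport (fun a b => d (x a) (x b)) p q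
    (k + \sum_v `|p v - q v| * d (x v) (y (f v)) + e).
Proof.
move=> d0 ds tri dge dD p0 q0 T e0.
pose m v := Num.min (p v) (q v).
have m0 v : 0 <= m v by rewrite le_min p0 q0.
pose p' v := p v - m v; pose q' v := q v - m v.
have p'0 v : 0 <= p' v by rewrite subr_ge0 ge_min lexx.
have q'0 v : 0 <= q' v by rewrite subr_ge0 ge_min lexx orbT.
have T1 : transport (fun a b => d (y a) (y b))
    (fun w => \sum_(v | f v == w) p' v) (fun w => \sum_(v | f v == w) q' v)
    (k + e).
  apply: (@transport_cancel _ _ D _ _
    (fun w => \sum_(v | f v == w) m v)) e0 => //;
    try by move=> v; apply: sumr_ge0.
  by apply: transport_eq T => w; rewrite -big_split/=; apply: eq_bigr => v _;
    rewrite subrK.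
have Tp := transport_map (fun v w => d (x v) (y w)) f p'0.
have Tq := transport_sym (transport_map (fun v w => d (x v) (y w)) f q'0).
have tri1 v w u : d (x v) (y u) <= d (x v) (y w) + d (y w) (y u) by [].
have T2 := transport_trans tri1 Tp T1.
have tri2 v w u : d (x v) (x u) <= d (x v) (y w) + d (x u) (y w).
  by rewrite (ds (x u)).
have T3 := transport_trans tri2 T2 Tq.
have T4 : transport (fun v w => d (x v) (x w)) m m 0 by exact: transport_refl.
have := transportD T3 T4; rewrite addr0 => T5.
have {}T5 : transport (fun v u => d (x v) (x u)) p q
  (\sum_v p' v * d (x v) (y (f v)) + (k + e) +
     \sum_v q' v * d (x v) (y (f v))).
  by apply: transport_eq T5 => v; rewrite subrK.
apply: transport_le T5 => //.
have -> : \sum_v `|p v - q v| * d (x v) (y (f v)) =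
    \sum_v p' v * d (x v) (y (f v)) + \sum_v q' v * d (x v) (y (f v)).
  rewrite -big_split/=; apply: eq_bigr => v _; rewrite -mulrDl; congr (_ * _).
  rewrite /p' /q' /m; case: (leP (p v) (q v)) => pq.
    by rewrite ler0_norm ?subr_le0//; ring.
  by rewrite gtr0_norm ?subr_gt0//; ring.
by rewrite le_eqVlt; apply/orP; left; apply/eqP; ring.
Qed.

End transport_theory.

(** * Finite measurable labellings *)

Section measurability.
Context (R : realType) (d : measure_display) (T : measurableType d).
Implicit Types (mu : probability T R).

Definition labelling (V : finType) (lab : T -> V) : Prop :=
  forall v, measurable (lab @^-1` [set v]).

Lemma measurable_labelling (V : finType) (lab : T -> V) (A : set V) :
  labelling lab -> measurable (lab @^-1` A).
Proof.
move=> mlab.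
rewrite [X in measurable X](_ : _ = \bigcup_(v in A) (lab @^-1` [set v])).
  by apply: fin_bigcup_measurable => //; exact: finite_finset.
by apply/seteqP; split=> [x Ax|x [v Av] /= ->]; first exists (lab x).
Qed.

Lemma labelling_comp (V W : finType) (lab : T -> V) (f : V -> W) :
  labelling lab -> labelling (f \o lab).
Proof. by move=> mlab w; rewrite comp_preimage; exact: measurable_labelling. Qed.

Lemma labelling_pair (V W : finType) (lab : T -> V) (lab' : T -> W) :
  labelling lab -> labelling lab' -> labelling (fun x => (lab x, lab' x)).
Proof.
move=> m m' [v w].
rewrite [X in measurable X](_ : _ = lab @^-1` [set v] `&` lab' @^-1` [set w]).
  exact: measurableI.
by apply/seteqP; split=> [x [<- <-]|x [/= <- <-]].
Qed.

Lemma labelling_ffun (I V : finType) (lab : I -> T -> V) :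
  (forall i, labelling (lab i)) ->
  labelling (fun x => [ffun i => lab i x]).
Proof.
move=> m f.
rewrite [X in measurable X](_ : _ = \bigcap_(i in [set: I]) (lab i @^-1` [set f i])).
  by apply: fin_bigcap_measurable => [|i _]; [exact: finite_finset|exact: m].
apply/seteqP; split=> [x /= <- i _|x H]; first by rewrite /= ffunE.
by apply/ffunP => i; rewrite ffunE; exact: (H i).
Qed.

Lemma measurable_fun_labelling (V : finType) (lab : T -> V) (f : V -> R) :
  labelling lab -> measurable_fun setT (f \o lab).
Proof.
move=> mlab _ B mB; rewrite setTI comp_preimage; exact: measurable_labelling.
Qed.

(** The set where [h] exceeds [c] is a countable union of cells: a point where it does so by more
    than the oscillation lies in a cell where it does so throughout. *)
Lemma measurable_fun_osc (h : T -> R) :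
  (forall e, 0 < e -> exists (V : finType) (lab : T -> V), labelling lab /\
     forall x y, lab x = lab y -> `|h x - h y| <= e) ->
  measurable_fun setT h.
Proof.
move=> H.
have {}H n : exists Vl : {V : finType & T -> V}, labelling (projT2 Vl) /\
     forall x y, projT2 Vl x = projT2 Vl y -> `|h x - h y| <= n.+1%:R^-1 :> R.
  have [|V [lab Hlab]] := H n.+1%:R^-1; first by rewrite invr_gt0.
  by exists (existT _ V lab).
have [Vl {}H] := choice H.
apply: (measurability _ (RGenOInfty.measurableE R)) => //.
move=> /= _ [_ [c ->] <-]; rewrite setTI.
pose B n := \bigcup_(v in [set v | projT2 (Vl n) @^-1` [set v] `<=` [set x | c < h x]])
  (projT2 (Vl n) @^-1` [set v]).
rewrite [X in measurable X](_ : _ = \bigcup_n B n).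
  apply: bigcupT_measurable => n; apply: fin_bigcup_measurable => //.
  by move=> v _; exact: (H n).1.
apply/seteqP; split=> [x|x [n _ [v Hv /= vx]]].
  rewrite /= in_itv/= andbT => cx.
  have hc : 0 < h x - c by rewrite subr_gt0.
  pose n := Num.bound (h x - c)^-1.
  have nn : n.+1%:R^-1 < h x - c.
    rewrite -ltf_pV2 ?posrE ?invr_gt0 ?invrK//.
    rewrite (lt_le_trans (archi_boundP _)) ?invr_ge0 ?(ltW hc)//.
    by rewrite ler_nat.
  exists n => //; exists (projT2 (Vl n) x) => //= y /= yx.
  have := (H n).2 _ _ (esym yx).
  move: nn; rewrite ler_norml => nn /andP[_] {}yx; move: (le_lt_trans yx nn); lra.
by rewrite /= in_itv/= andbT; exact: Hv vx.
Qed.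

Lemma bounded_integrable mu (f : T -> R) (M : R) :
  measurable_fun setT f -> (forall x, `|f x| <= M) ->
  mu.-integrable setT (EFin \o f).
Proof.
move=> mf fM; apply: measurable_bounded_integrable => //.
  rewrite (_ : _ setT = 1%E) ?ltry//; exact: probability_setT.
exists M; split; first exact: num_real.
by move=> N MN x _ /=; rewrite (le_trans (fM x))// ltW.
Qed.

(* No measurability is needed: the integral of a nonnegative function is the
   supremum of the integrals of the simple functions below it. *)
Lemma ge0_le_integralT (m : {measure set T -> \bar R}) (f g : T -> \bar R) :
  (forall x, 0 <= f x)%E -> (forall x, f x <= g x)%E ->
  (\int[m]_x f x <= \int[m]_x g x)%E.
Proof.
move=> f0 fg.
have g0 x : (0 <= g x)%E by apply: le_trans (fg x).
rewrite !ge0_integralTE//; apply: ereal_sup_le => _ [h hf <-].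
by exists h => // x; apply: le_trans (fg x).
Qed.

Lemma integral_le_Rintegral mu (f : T -> \bar R) (g : T -> R) :
  (forall x, 0 <= f x)%E -> (forall x, f x <= (g x)%:E)%E ->
  mu.-integrable setT (EFin \o g) ->
  (\int[mu]_x f x <= (\int[mu]_x g x)%:E)%E.
Proof.
move=> f0 fg ig; rewrite /Rintegral fineK; last exact: integrable_fin_num.
exact: ge0_le_integralT.
Qed.

(** Counterpart of the previous bound for minorants. As [g] may be negative, it is compared with [f]
    through its positive part. *)
Lemma Rintegral_le_integral mu (f : T -> \bar R) (g : T -> R) :
  (forall x, 0 <= f x)%E -> (forall x, (g x)%:E <= f x)%E ->
  mu.-integrable setT (EFin \o g) ->
  ((\int[mu]_x g x)%:E <= \int[mu]_x f x)%E.
Proof.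
move=> f0 fg ig; rewrite /Rintegral fineK; last exact: integrable_fin_num.
apply: (@le_trans _ _ (\int[mu]_x ((EFin \o g)^\+ x)%E)%E).
  rewrite integralE; rewrite -[leRHS]sube0; apply: leeB => //.
  exact: integral_ge0.
apply: ge0_le_integralT => x //.
  by rewrite funeposE ge_max fg f0.
Qed.

Definition pr mu (A : set T) : R := fine (mu A).

Lemma prE mu A : measurable A -> mu A = (pr mu A)%:E.
Proof. by move=> mA; rewrite /pr fineK// fin_num_measure. Qed.

Lemma pr_ge0 mu A : 0 <= pr mu A.
Proof. exact: fine_ge0. Qed.

Lemma pr_le mu A B : measurable A -> measurable B -> A `<=` B ->
  pr mu A <= pr mu B.
Proof.
move=> mA mB AB; rewrite -lee_fin -!prE//; apply: le_measure => //; rewrite ?inE//.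
Qed.

Lemma pr_setT mu : pr mu setT = 1.
Proof. by rewrite /pr probability_setT. Qed.

Lemma pr_le1 mu A : measurable A -> pr mu A <= 1.
Proof. by move=> mA; rewrite -(pr_setT mu); exact: pr_le. Qed.

Lemma pr_setC mu A : measurable A -> pr mu (~` A) = 1 - pr mu A.
Proof.
by move=> mA; rewrite /pr probability_setC// prE// -EFinB.
Qed.

Lemma pr_labelling mu (V : finType) (lab : T -> V) (A : set T) (P : pred V) :
  labelling lab -> measurable A ->
  pr mu (A `&` lab @^-1` [set v | P v]) =
  \sum_(v | P v) pr mu (A `&` lab @^-1` [set v]).
Proof.
move=> mlab mA; apply: EFin_inj; rewrite -prE; last first.
  by apply: measurableI => //; exact: measurable_labelling.
rewrite -sumEFin.
pose r := [seq v <- index_enum V | P v].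
have mr v : v \in r = P v by rewrite mem_filter mem_index_enum andbT.
rewrite [X in mu X](_ : _ = \bigcup_(v in [set` r]) (A `&` lab @^-1` [set v])).
  rewrite measure_fin_bigcup.
  - rewrite -fsbig_seq ?filter_uniq ?index_enum_uniq// big_filter.
    by apply: eq_bigr => v _; rewrite -prE//; exact: measurableI.
  - exact: finite_seq.
  - by move=> v w _ _ [x [[_ /= <-] [_ /= <-]]].
  - by move=> v _; exact: measurableI.
apply/seteqP; split=> [x [Ax /= Px]|x [v /= + [Ax /= lx]]].
  by exists (lab x) => //=; rewrite mr.
by rewrite mr -lx; split.
Qed.

Lemma sum_pr_labelling mu (V : finType) (lab : T -> V) (A : set T) :
  labelling lab -> measurable A ->
  \sum_v pr mu (A `&` lab @^-1` [set v]) = pr mu A.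
Proof.
move=> mlab mA; rewrite -(pr_labelling mu xpredT)//; congr pr.
by apply/seteqP; split=> [x []|x].
Qed.

Lemma sum_pr_labellingT mu (V : finType) (lab : T -> V) :
  labelling lab -> \sum_v pr mu (lab @^-1` [set v]) = 1.
Proof.
move=> mlab; rewrite -(pr_setT mu) -(sum_pr_labelling mu mlab measurableT).
by apply: eq_bigr => v _; rewrite setTI.
Qed.

Lemma pr_labelling_comp mu (V W : finType) (lab : T -> V) (f : V -> W) w :
  labelling lab -> pr mu ((f \o lab) @^-1` [set w]) =
  \sum_(v | f v == w) pr mu (lab @^-1` [set v]).
Proof.
move=> mlab; have := pr_labelling mu (fun v => f v == w) mlab measurableT.
under eq_bigr do rewrite setTI; move=> <-; rewrite setTI; congr pr.
by apply/seteqP; split=> [x /= ->//|x /= /eqP].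
Qed.

Lemma fin_labelling_bounded (V : finType) (lab : T -> V) (f : V -> R) x :
  `|f (lab x)| <= \sum_v `|f v|.
Proof. by rewrite (bigD1 (lab x))//= lerDl sumr_ge0. Qed.

Lemma integrable_labelling mu (V : finType) (lab : T -> V) (f : V -> R) :
  labelling lab -> mu.-integrable setT (EFin \o (f \o lab)).
Proof.
move=> mlab; have mf := measurable_fun_labelling f mlab.
exact: (bounded_integrable mu mf (fin_labelling_bounded lab f)).
Qed.

Lemma Rintegral_indic_pr mu (A : set T) : measurable A ->
  \int[mu]_x (\1_A x) = pr mu A.
Proof. by move=> mA; rewrite /Rintegral integral_indic// setIT. Qed.

Lemma Rintegral_sum mu (I : finType) (P : pred I) (f : I -> T -> R) :
  (forall i, mu.-integrable setT (EFin \o f i)) ->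
  \int[mu]_x (\sum_(i | P i) f i x) = \sum_(i | P i) \int[mu]_x f i x.
Proof.
move=> fi; rewrite /Rintegral.
under eq_integral do rewrite -sumEFin.
rewrite integral_sum//= -sum_fine// => i _.
exact: integrable_fin_num (fi i).
Qed.

Lemma integrable_indicZ mu (A : set T) (k : R) : measurable A ->
  mu.-integrable setT (EFin \o (fun x => k * \1_A x)).
Proof.
move=> mA.
have mf : measurable_fun setT (fun x => k * \1_A x) by exact: measurable_funM.
apply: (bounded_integrable mu mf (_ : forall x, _ <= `|k|)) => x.
rewrite normrM indicE.
by case: (_ \in _); rewrite ?normr1 ?normr0 ?mulr1 ?mulr0.
Qed.

Lemma Rintegral_labelling mu (V : finType) (lab : T -> V) (f : V -> R) :
  labelling lab ->
  \int[mu]_x f (lab x) = \sum_v f v * pr mu (lab @^-1` [set v]).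
Proof.
move=> mlab.
rewrite (eq_Rintegral _ (g := fun x => \sum_v f v * \1_(lab @^-1` [set v]) x)).
  rewrite Rintegral_sum; last by move=> v; exact: integrable_indicZ.
  apply: eq_bigr => v _; rewrite RintegralZl//; first by rewrite Rintegral_indic_pr.
  have := integrable_indicZ mu 1 (mlab v); apply: eq_integrable => //.
  by move=> x _ /=; rewrite mul1r.
move=> x _; rewrite (bigD1 (lab x))//= big1 ?addr0.
  by rewrite indicE mem_set ?mulr1.
by move=> v vx; rewrite indicE memNset ?mulr0//= => xv; rewrite xv eqxx in vx.
Qed.

End measurability.

(** * Wasserstein distance of a totally bounded pseudometric *)

(** Only the total mass is normalised, not the weights: the [m i] can be restrictions of a product
    measure to cells as well as Dirac masses. *)
Lemma probability_mixture (R : realType) (d : measure_display)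
    (T : measurableType d) (I : finType) (a : I -> R)
    (m : I -> {measure set T -> \bar R}) :
  (forall i, 0 <= a i) -> (\sum_i (a i)%:E * m i setT = 1)%E ->
  exists g : probability T R,
    forall A, g A = (\sum_i (a i)%:E * m i A)%E.
Proof.
move=> a0 a1.
pose s (k : nat) : {measure set T -> \bar R} :=
  if (insub k : option 'I_#|I|) is Some i then
    mscale (NngNum (a0 (enum_val i))) (m (enum_val i)) : {measure set T -> \bar R}
  else mzero : {measure set T -> \bar R}.
have sE A : msum s #|I| A = (\sum_i (a i)%:E * m i A)%E.
  rewrite /msum [RHS](reindex (@enum_val I xpredT))/=; last first.
    by apply: onW_bij; exact: enum_val_bij.
  by apply: eq_bigr => k _; rewrite /s valK.
have s1 : msum s #|I| setT = 1%E by rewrite sE.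
pose g : probability T R := HB.pack (msum s #|I|)
  (Measure_isProbability.Build _ _ _ (msum s #|I|) s1).
by exists g => A; exact: sE.
Qed.

(** Total boundedness is stated with measurable cells rather than balls. This makes Lipschitz
    functions, and [dist] itself, measurable without any topology on [T]. *)
Record totally_bounded_pmetric (R : realType) (d : measure_display)
    (T : measurableType d) (dist : T -> T -> R) : Prop := TotallyBoundedPmetric {
  pmetric_refl : forall x, dist x x = 0 ;
  pmetric_sym : forall x y, dist x y = dist y x ;
  pmetric_tri : forall x y z, dist x z <= dist x y + dist y z ;
  pmetric_labelling : forall e, 0 < e -> exists (V : finType) (lab : T -> V),
    labelling lab /\ forall x y, lab x = lab y -> dist x y <= e }.

Section pmetric.
Context (R : realType) (d : measure_display) (T : measurableType d).
Variable dist : T -> T -> R.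
Hypothesis tb : totally_bounded_pmetric dist.

Lemma pmetric_ge0 x y : 0 <= dist x y.
Proof.
have := pmetric_tri tb x y x; rewrite (pmetric_refl tb) (pmetric_sym tb y x).
lra.
Qed.

Lemma pmetric_section e : 0 < e ->
  exists (V : finType) (lab : T -> V) (c : V -> T),
    [/\ labelling lab, forall x, dist x (c (lab x)) <= e &
        forall x, lab (c (lab x)) = lab x].
Proof.
move=> /(pmetric_labelling tb)[V [lab [mlab H]]].
(* An unattained label is represented by the default [point], so [lab \o c] is the identity on
   attained labels only. *)
pose c v := xget point [set x | lab x = v].
have cK x : lab (c (lab x)) = lab x.
  by rewrite /c; case: xgetP => [y _ //|/(_ x)]; rewrite /= => /(_ erefl).
by exists V, lab, c; split=> // x; apply: H; rewrite cK.
Qed.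

Lemma pmetric_rep e : 0 < e -> exists (V : finType) (lab : T -> V) (c : V -> T),
  labelling lab /\ forall x, dist x (c (lab x)) <= e.
Proof.
by move=> /pmetric_section[V [lab [c [mlab H _]]]]; exists V, lab, c.
Qed.

Lemma pmetric_bounded : exists2 D, 0 < D & forall x y, dist x y <= D.
Proof.
have [V [lab [c [_ H]]]] := pmetric_rep ltr01.
exists (2 + \sum_v \sum_w dist (c v) (c w)).
  apply: ltr_wpDr => //; apply: sumr_ge0 => v _; apply: sumr_ge0 => w _.
  exact: pmetric_ge0.
move=> x y.
have S : dist (c (lab x)) (c (lab y)) <= \sum_v \sum_w dist (c v) (c w).
  rewrite (bigD1 (lab x))//= (bigD1 (lab y))//= -addrA lerDl addr_ge0//.
    by apply: sumr_ge0 => w _; exact: pmetric_ge0.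
  apply: sumr_ge0 => v _; apply: sumr_ge0 => w _; exact: pmetric_ge0.
have := pmetric_tri tb x (c (lab x)) y.
have := pmetric_tri tb (c (lab x)) (c (lab y)) y.
have := H x; have := H y; rewrite (pmetric_sym tb y); lra.
Qed.

Lemma pmetric_quad x y x' y' :
  `|dist x y - dist x' y'| <= dist x x' + dist y y'.
Proof.
rewrite ler_norml.
have := pmetric_tri tb x x' y; have := pmetric_tri tb x' y' y.
have := pmetric_tri tb x' x y'; have := pmetric_tri tb x y y'.
rewrite (pmetric_sym tb x' x) (pmetric_sym tb y' y); lra.
Qed.

Lemma lipschitz_measurable (h : T -> R) L :
  (forall x y, `|h x - h y| <= L * dist x y) -> measurable_fun setT h.
Proof.
move=> hL; apply: measurable_fun_osc => e e0.
have L1 : 0 < `|L| + 1 by rewrite ltr_pwDr.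
have [V [lab [mlab H]]] := pmetric_labelling tb (divr_gt0 e0 L1).
exists V, lab; split=> // x y /H; rewrite ler_pdivlMr// => He.
apply: le_trans He; apply: le_trans (hL x y) _; rewrite mulrC ler_wpM2l//.
  exact: pmetric_ge0.
by rewrite (le_trans (ler_norm _))// lerDl.
Qed.

Lemma lipschitz_bounded (h : T -> R) L :
  (forall x y, `|h x - h y| <= L * dist x y) -> exists M, forall x, `|h x| <= M.
Proof.
move=> hL; have [D D0 HD] := pmetric_bounded.
exists (`|h point| + `|L| * D) => x.
have -> : h x = h point + (h x - h point) by rewrite addrC subrK.
apply: (le_trans (ler_normD _ _)); rewrite lerD2l (le_trans (hL _ _))//.
apply: (@le_trans _ _ (`|L| * dist x point)).
  by rewrite ler_wpM2r ?pmetric_ge0 ?ler_norm.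
by rewrite ler_wpM2l.
Qed.

Lemma lipschitz_integrable (mu : probability T R) (h : T -> R) L :
  (forall x y, `|h x - h y| <= L * dist x y) ->
  mu.-integrable setT (EFin \o h).
Proof.
move=> hL; have [M hM] := lipschitz_bounded hL.
by apply: bounded_integrable hM; exact: lipschitz_measurable hL.
Qed.

Lemma labelling_fst (V : finType) (lab : T -> V) : labelling lab ->
  labelling (fun p : T * T => lab p.1).
Proof.
move=> m v; have := @measurable_fst _ _ T T measurableT _ (m v).
by rewrite setTI.
Qed.

Lemma labelling_snd (V : finType) (lab : T -> V) : labelling lab ->
  labelling (fun p : T * T => lab p.2).
Proof.
move=> m v; have := @measurable_snd _ _ T T measurableT _ (m v).
by rewrite setTI.
Qed.

Lemma measurable_pmetric : measurable_fun setT (fun p : T * T => dist p.1 p.2).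
Proof.
apply: measurable_fun_osc => e e0.
have e20 : 0 < e / 2 by rewrite divr_gt0.
have [V [lab [mlab H]]] := pmetric_labelling tb e20.
exists (V * V)%type, (fun p => (lab p.1, lab p.2)); split.
  by apply: labelling_pair; [exact: labelling_fst|exact: labelling_snd].
move=> x y [/H h1 /H h2]; apply: le_trans (pmetric_quad _ _ _ _) _; lra.
Qed.

Lemma integrable_pmetric (g : probability (T * T)%type R) :
  g.-integrable setT (EFin \o (fun p : T * T => dist p.1 p.2)).
Proof.
have [D D0 HD] := pmetric_bounded.
apply: (bounded_integrable g measurable_pmetric) => p.
by rewrite ger0_norm ?pmetric_ge0//; exact: HD.
Qed.

End pmetric.

Section wass.
Context (R : realType) (d : measure_display) (T : measurableType d).
Variable dist : T -> T -> R.
Hypothesis tb : totally_bounded_pmetric dist.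
Local Notation W := (wass1 (fun x y => (dist x y)%:E)).
Implicit Types mu nu : probability T R.

Variables (V : finType) (lab : T -> V) (c : V -> T) (del : V -> R).
Hypothesis mlab : labelling lab.
Hypothesis cdel : forall x, dist x (c (lab x)) <= del (lab x).

Definition weight mu (v : V) : R := pr mu (lab @^-1` [set v]).

Lemma weight_ge0 mu v : 0 <= weight mu v.
Proof. exact: pr_ge0. Qed.

(** The mass [g v w] is spread over the product of the two cells in proportion to the product
    measure. Where a cell weight vanishes so does [g], which makes the division by zero harmless. *)
Lemma transport_coupling mu nu (g : V -> V -> R) :
  (forall v w, 0 <= g v w) -> (forall v, \sum_w g v w = weight mu v) ->
  (forall w, \sum_v g v w = weight nu w) ->
  exists2 gam : probability (T * T)%type R, coupling mu nu gam &
    forall v w, pr gam ((fun p => (lab p.1, lab p.2)) @^-1` [set (v, w)]) = g v w.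
Proof.
move=> g0 gmu gnu.
pose a (i : V * V) := g i.1 i.2 / (weight mu i.1 * weight nu i.2).
have a0 i : 0 <= a i by rewrite divr_ge0 ?mulr_ge0 ?weight_ge0.
have aE v w : a (v, w) * (weight mu v * weight nu w) = g v w.
  rewrite /a/=.
  have [pz|pz] := eqVneq (weight mu v * weight nu w) 0; last by rewrite divfK.
  rewrite pz mulr0; apply/esym/eqP; move/eqP: pz.
  rewrite mulf_eq0 => /orP[/eqP z|/eqP z].
    by rewrite eq_le g0 andbT -z -gmu (bigD1 w)//= lerDl sumr_ge0.
  by rewrite eq_le g0 andbT -z -gnu (bigD1 v)//= lerDl sumr_ge0.
pose L i := (lab @^-1` [set i.1]) `*` (lab @^-1` [set i.2]) : set (T * T).
have mL i : measurable (L i) by apply: measurableX.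
pose m i : {measure set (T * T)%type -> \bar R} := mrestr (mu \x nu)%E (mL i).
have mE i A B : measurable A -> measurable B -> m i (A `*` B) =
  (pr mu (A `&` lab @^-1` [set i.1]) * pr nu (B `&` lab @^-1` [set i.2]))%:E.
  move=> mA mB; rewrite /m/= /mrestr /L -setXI product_measure1E ?EFinM//;
    try exact: measurableI.
  by rewrite -!prE//; exact: measurableI.
have mT : (\sum_i (a i)%:E * m i setT = 1)%E.
  under eq_bigr do rewrite -setXTT mE// !setTI -EFinM.
  rewrite sumEFin; congr EFin.
  rewrite -(sum_pr_labellingT mu mlab).
  rewrite (eq_bigr (fun i => g i.1 i.2)); last by move=> [v w] _; rewrite -aE.
  rewrite -(pair_bigA _ (fun v w => g v w))/=.
  by apply: eq_bigr => v _; rewrite gmu.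
have [gam gamE] := probability_mixture a0 mT.
have wz mu' (A : set T) v : measurable A -> weight mu' v = 0 ->
    pr mu' (A `&` lab @^-1` [set v]) = 0.
  move=> mA z; apply/eqP; rewrite eq_le pr_ge0 andbT -z.
  by apply: pr_le => //; exact: measurableI.
exists gam.
- split=> A mA; rewrite gamE.
    under eq_bigr do rewrite mE// setTI -EFinM.
    rewrite sumEFin prE//; congr EFin.
    rewrite -(pair_bigA _ (fun v w => a (v, w) * (pr mu (A `&` lab @^-1` [set v]) *
      weight nu w)))/= -(sum_pr_labelling mu mlab mA).
    apply: eq_bigr => v _.
    have [z|z] := eqVneq (weight mu v) 0.
      by rewrite wz// big1// => w _; rewrite mul0r mulr0.
    rewrite -[RHS]mulr1 -(divff z) -[X in _ = _ * (X / _)]gmu.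
    rewrite mulr_suml mulr_sumr; apply: eq_bigr => w _.
    by rewrite -aE; field.
  under eq_bigr do rewrite mE// setTI -EFinM.
  rewrite sumEFin prE//; congr EFin.
  rewrite -(pair_bigA _ (fun v w => a (v, w) * (weight mu v *
    pr nu (A `&` lab @^-1` [set w]))))/= exchange_big/=.
  rewrite -(sum_pr_labelling nu mlab mA).
  apply: eq_bigr => w _.
  have [z|z] := eqVneq (weight nu w) 0.
    by rewrite wz// big1// => v _; rewrite !mulr0.
  rewrite -[RHS]mulr1 -(divff z) -[X in _ = _ * (X / _)]gnu.
  rewrite mulr_suml mulr_sumr; apply: eq_bigr => v _.
  by rewrite -aE; field.
move=> v w; rewrite [X in pr gam X](_ : _ = L (v, w)); last first.
  by apply/seteqP; split=> [[x y] /= [<- <-]//|[x y] [/= -> ->]].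
rewrite /pr gamE (bigD1 (v, w))//= big1 ?adde0.
  by rewrite /L mE//= !setIid aE.
move=> [v' w'] vw; rewrite /L mE//= -EFinM.
have := vw; rewrite xpair_eqE negb_and => /orP[/eqP n|/eqP n].
  rewrite [X in pr mu X](_ : _ = set0) /pr ?measure0 ?mul0r ?mulr0//.
  by apply/seteqP; split=> [x [/= -> /esym]|].
rewrite [X in pr nu X](_ : _ = set0) /pr ?measure0 ?mulr0 ?mulr0//.
by apply/seteqP; split=> [x [/= -> /esym]|].
Qed.


Let lab2 (p : T * T) := (lab p.1, lab p.2).

Let mlab2 : labelling lab2.
Proof. by apply: labelling_pair; [exact: labelling_fst|exact: labelling_snd]. Qed.

(** Points are moved to the representatives of their cells and back. The radius [del] depends on the
    cell, so that an exceptional cell of small mass may have a large diameter. *)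
Lemma wass1_le_transport mu nu k :
  transport (fun v w => dist (c v) (c w)) (weight mu) (weight nu) k ->
  (W mu nu <= (k + \sum_v (weight mu v + weight nu v) * del v)%:E)%E.
Proof.
move=> [g [g0 gmu gnu gk]].
have [gam gc gE] := transport_coupling g0 gmu gnu.
apply: (@le_trans _ _ (\int[gam]_p (dist p.1 p.2)%:E)%E).
  by apply: ereal_inf_lbound; exists gam.
pose phi (i : V * V) := dist (c i.1) (c i.2) + (del i.1 + del i.2).
apply: le_trans (integral_le_Rintegral (g := phi \o lab2) _ _ _) _.
- by move=> p; rewrite lee_fin pmetric_ge0.
- move=> p; rewrite lee_fin /phi/=.
  have := pmetric_tri tb p.1 (c (lab p.1)) p.2.
  have := pmetric_tri tb (c (lab p.1)) (c (lab p.2)) p.2.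
  have := cdel p.1; have := cdel p.2; rewrite (pmetric_sym tb p.2); lra.
- exact: integrable_labelling.
rewrite lee_fin Rintegral_labelling//.
rewrite (eq_bigr (fun i => phi (i.1, i.2) * g i.1 i.2)); last first.
  by move=> [v w] _; rewrite gE.
rewrite -(pair_bigA _ (fun v w => phi (v, w) * g v w))/= /phi/=.
under eq_bigr do under eq_bigr do rewrite mulrDl mulrC mulrDl.
under eq_bigr do rewrite !big_split/=.
rewrite !big_split/= lerD//.
rewrite [X in _ + X <= _]exchange_big/= -big_split/=.
apply: ler_sum => v _.
by rewrite -!mulr_sumr gmu gnu mulrDl ![del v * _]mulrC.
Qed.

(** The strict inequality provides a coupling of cost below [k]; its masses on the pairs of cells
    form the plan. *)
Lemma transport_wass1 mu nu k : (W mu nu < k%:E)%E ->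
  transport (fun v w => dist (c v) (c w)) (weight mu) (weight nu)
    (k + \sum_v (weight mu v + weight nu v) * del v).
Proof.
move=> /ereal_inf_lt[_ [gam [gmu gnu] <-]] Ik.
pose g v w := pr gam (lab2 @^-1` [set (v, w)]).
have wmu v : \sum_w g v w = weight mu v.
  transitivity (\sum_(i | i.1 == v) g i.1 i.2).
    rewrite (eq_bigl (fun i : V * V => (i.1 == v) && true)); last first.
      by move=> i; rewrite andbT.
    by rewrite -(pair_big (fun i => i == v) xpredT)/= big_pred1_eq.
  rewrite (eq_bigr (fun i => pr gam (lab2 @^-1` [set i]))); last by case.
  rewrite -(pr_labelling_comp gam (fun i => i.1))// /weight /pr -gmu//.
  by congr (fine (gam _)); apply/seteqP; split=> [x|x []].
have wnu w : \sum_v g v w = weight nu w.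
  transitivity (\sum_(i | i.2 == w) g i.1 i.2).
    rewrite -(pair_big xpredT (fun i => i == w))/=.
    by apply: eq_bigr => v _; rewrite big_pred1_eq.
  rewrite (eq_bigr (fun i => pr gam (lab2 @^-1` [set i]))); last by case.
  rewrite -(pr_labelling_comp gam (fun i => i.2))// /weight /pr -gnu//.
  by congr (fine (gam _)); apply/seteqP; split=> [x|x []].
exists g; split=> //; first by move=> v w; exact: pr_ge0.
pose phi (i : V * V) := dist (c i.1) (c i.2).
pose psi (i : V * V) := del i.1 + del i.2.
have -> : \sum_v \sum_w g v w * dist (c v) (c w) = \int[gam]_p phi (lab2 p).
  rewrite Rintegral_labelling//.
  rewrite (pair_bigA _ (fun v w => g v w * dist (c v) (c w)))/=.
  by apply: eq_bigr => -[v w] _; rewrite mulrC.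
have -> : \sum_v (weight mu v + weight nu v) * del v = \int[gam]_p psi (lab2 p).
  rewrite Rintegral_labelling// (eq_bigr (fun i => psi (i.1, i.2) * g i.1 i.2)); last by case.
  rewrite -(pair_bigA _ (fun v w => psi (v, w) * g v w))/= /psi/=.
  under [RHS]eq_bigr do under eq_bigr do rewrite mulrDl.
  under [RHS]eq_bigr do rewrite !big_split/=.
  rewrite big_split/= [X in _ = _ + X]exchange_big/= -big_split/=.
  apply: eq_bigr => v _.
  by rewrite -!mulr_sumr wmu wnu mulrDl ![del v * _]mulrC.
apply: (@le_trans _ _ (\int[gam]_p (dist p.1 p.2 + psi (lab2 p)))).
  apply: le_Rintegral => //.
  - exact: integrable_labelling.
  - apply: (integrableD measurableT (integrable_pmetric tb gam)
      (integrable_labelling gam psi mlab2)).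
  - move=> p _; rewrite /phi /psi/=.
    have := pmetric_tri tb (c (lab p.1)) p.1 (c (lab p.2)).
    have := pmetric_tri tb p.1 p.2 (c (lab p.2)).
    have := cdel p.1; have := cdel p.2.
    rewrite (pmetric_sym tb _ p.1); lra.
rewrite RintegralD//; last 2 first.
- exact: integrable_pmetric.
- exact: integrable_labelling.
rewrite lerD2r -lee_fin; apply/ltW; apply: le_lt_trans Ik.
by apply: Rintegral_le_integral => [p|p|];
  rewrite ?lee_fin ?pmetric_ge0//; exact: integrable_pmetric.
Qed.

End wass.

(** * Metric properties of the Wasserstein distance and Lipschitz test functions *)

Section wass_metric.
Context (R : realType) (d : measure_display) (T : measurableType d).
Variable dist : T -> T -> R.
Hypothesis tb : totally_bounded_pmetric dist.
Local Notation W := (wass1 (fun x y => (dist x y)%:E)).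
Implicit Types mu nu : probability T R.

Lemma sum_weight2 (V : finType) (lab : T -> V) mu nu e : labelling lab ->
  \sum_v (weight lab mu v + weight lab nu v) * e = 2 * e.
Proof.
by move=> mlab; rewrite -mulr_suml big_split/= !sum_pr_labellingT.
Qed.

Lemma wass1_bounded : exists2 D, 0 < D & forall mu nu, (W mu nu <= D%:E)%E.
Proof.
have [D D0 HD] := pmetric_bounded tb.
exists (2 * D); first by rewrite mulr_gt0.
move=> mu nu.
have ml : labelling (fun _ : T => tt).
  move=> v; rewrite [X in measurable X](_ : _ = setT)//.
  by apply/seteqP; split=> //= x _; case: v.
have := @wass1_le_transport _ _ _ _ tb _ _ (fun=> point) (fun=> D) ml
  (fun x => HD x _) mu nu 0.
rewrite sum_weight2// add0r; apply.
have w1 mu' : (fun=> 1) =1 weight (fun _ : T => tt) mu'.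
  move=> []; rewrite /weight -(pr_setT mu'); congr pr.
  by apply/seteqP; split.
apply: (transport_eq (w1 mu) (w1 nu)); apply: transport_refl => // v.
by rewrite (pmetric_refl tb).
Qed.

Definition w1 mu nu : R := fine (W mu nu).

Lemma wass1_ge0 mu nu : (0 <= W mu nu)%E.
Proof.
apply: le_ereal_inf_tmp => _ [gam _ <-]; apply: integral_ge0 => p _.
by rewrite lee_fin pmetric_ge0.
Qed.

Lemma wass1E mu nu : W mu nu = (w1 mu nu)%:E.
Proof.
have [D D0 HD] := wass1_bounded; rewrite /w1 fineK// ge0_fin_numE ?wass1_ge0//.
exact: le_lt_trans (HD _ _) (ltry _).
Qed.

Lemma w1_ge0 mu nu : 0 <= w1 mu nu.
Proof. by rewrite -lee_fin -wass1E wass1_ge0. Qed.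

Lemma w1_le_transport (V : finType) (lab : T -> V) (c : V -> T) e mu nu k :
  labelling lab -> (forall x, dist x (c (lab x)) <= e) ->
  transport (fun v w => dist (c v) (c w)) (weight lab mu) (weight lab nu) k ->
  w1 mu nu <= k + 2 * e.
Proof.
move=> mlab ce tr; rewrite -lee_fin -wass1E -(sum_weight2 mu nu e mlab).
exact: wass1_le_transport.
Qed.

Lemma transport_w1 (V : finType) (lab : T -> V) (c : V -> T) e mu nu k :
  labelling lab -> (forall x, dist x (c (lab x)) <= e) -> w1 mu nu < k ->
  transport (fun v w => dist (c v) (c w)) (weight lab mu) (weight lab nu)
    (k + 2 * e).
Proof.
move=> mlab ce; rewrite -lte_fin -wass1E -(sum_weight2 mu nu e mlab) => tr.
exact: (transport_wass1 tb mlab (del := fun=> e)).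
Qed.

Lemma w1_refl mu : w1 mu mu = 0.
Proof.
apply/eqP; rewrite eq_le w1_ge0 andbT; apply/ler_addgt0Pl => e e0.
have e20 : 0 < e / 2 by rewrite divr_gt0.
have [V [lab [c [mlab ce]]]] := pmetric_rep tb e20.
have -> : e + 0 = 0 + 2 * (e / 2) by lra.
apply: (w1_le_transport mlab ce); apply: transport_refl => v.
  by rewrite (pmetric_refl tb).
exact: weight_ge0.
Qed.

Lemma w1_sym_le mu nu : w1 nu mu <= w1 mu nu.
Proof.
apply/ler_addgt0Pl => e e0.
have e80 : 0 < e / 8 by rewrite divr_gt0.
have [V [lab [c [mlab ce]]]] := pmetric_rep tb e80.
have lt : w1 mu nu < w1 mu nu + e / 2 by rewrite ltrDl divr_gt0.
have T1 := transport_sym (transport_w1 mlab ce lt).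
have T2 : transport (fun v w => dist (c v) (c w)) (weight lab nu) (weight lab mu)
    (w1 mu nu + e / 2 + 2 * (e / 8)).
  by apply: transport_le T1 => // v w; rewrite (pmetric_sym tb).
have := w1_le_transport mlab ce T2.
move=> /le_trans; apply; lra.
Qed.

Lemma w1_sym mu nu : w1 mu nu = w1 nu mu.
Proof. by apply/eqP; rewrite eq_le !w1_sym_le. Qed.

Lemma w1_tri mu nu rho : w1 mu rho <= w1 mu nu + w1 nu rho.
Proof.
apply/ler_addgt0Pl => e e0.
have e80 : 0 < e / 16 by rewrite divr_gt0.
have [V [lab [c [mlab ce]]]] := pmetric_rep tb e80.
have lt mu' nu' : w1 mu' nu' < w1 mu' nu' + e / 4 by rewrite ltrDl divr_gt0.
have T1 := transport_w1 mlab ce (lt mu nu).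
have T2 := transport_w1 mlab ce (lt nu rho).
have tri v w u : dist (c v) (c u) <= dist (c v) (c w) + dist (c w) (c u).
  exact: pmetric_tri.
have := w1_le_transport mlab ce (transport_trans tri T1 T2).
move=> /le_trans; apply; lra.
Qed.

(** [transport_push] with a single coarse point: the mass that the two weights do not share is
    routed through [point], at cost at most [D]. Thus finitely many cell masses control the
    distance. *)
Lemma w1_le_weight D (V : finType) (lab : T -> V) (c : V -> T) e mu nu :
  (forall x y, dist x y <= D) ->
  labelling lab -> (forall x, dist x (c (lab x)) <= e) ->
  w1 mu nu <= D * \sum_v `|weight lab mu v - weight lab nu v| + 2 * e.
Proof.
move=> HD mlab ce; apply/ler_addgt0Pl => e' e'0.
have T1 : transport (fun a b : unit => dist point point)
    (fun w => \sum_(v | tt == w) weight lab mu v)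
    (fun w => \sum_(v | tt == w) weight lab nu v) 0.
  have R1 : transport (fun a b : unit => dist point point) (fun=> 1) (fun=> 1) 0.
    by apply: transport_refl => // v; rewrite (pmetric_refl tb).
  by apply: transport_eq R1 => -[]; rewrite eqxx/= sum_pr_labellingT.
have := @transport_push _ _ _ _ dist D c (fun=> point) (fun=> tt)
  (weight lab mu) (weight lab nu) _ _ (pmetric_refl tb) (pmetric_sym tb)
  (pmetric_tri tb) (pmetric_ge0 tb) HD (weight_ge0 _ _) (weight_ge0 _ _) T1 e'0.
move=> /(w1_le_transport mlab ce) /le_trans; apply.
rewrite add0r addrA lerD2r [leRHS]addrC lerD2r mulr_sumr.
by apply: ler_sum => v _; rewrite mulrC ler_wpM2r.
Qed.

Lemma coupling_Rintegral_fst mu nu gam (h : T -> R) L : coupling mu nu gam ->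
  (forall x y, `|h x - h y| <= L * dist x y) ->
  \int[mu]_x h x = \int[gam]_p h p.1.
Proof.
move=> [gmu _] hL; have [M hM] := lipschitz_bounded tb hL.
have mh := lipschitz_measurable tb hL.
rewrite /Rintegral; congr fine.
rewrite (eq_measure_integral (pushforward gam (@fst T T))).
  rewrite integral_pushforward//.
  - exact/measurable_EFinP.
  - rewrite preimage_setT; apply: (bounded_integrable gam (f := h \o fst)) => [|p].
      exact: measurableT_comp.
    exact: hM.
move=> A mA _; apply/esym; apply: etrans (gmu _ mA); rewrite /pushforward.
by congr (gam _); apply/seteqP; split=> [[x y]|[x y] []].
Qed.

Lemma coupling_Rintegral_snd mu nu gam (h : T -> R) L : coupling mu nu gam ->
  (forall x y, `|h x - h y| <= L * dist x y) ->
  \int[nu]_x h x = \int[gam]_p h p.2.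
Proof.
move=> [_ gnu] hL; have [M hM] := lipschitz_bounded tb hL.
have mh := lipschitz_measurable tb hL.
rewrite /Rintegral; congr fine.
rewrite (eq_measure_integral (pushforward gam (@snd T T))).
  rewrite integral_pushforward//.
  - exact/measurable_EFinP.
  - rewrite preimage_setT; apply: (bounded_integrable gam (f := h \o snd)) => [|p].
      exact: measurableT_comp.
    exact: hM.
move=> A mA _; apply/esym; apply: etrans (gnu _ mA); rewrite /pushforward.
by congr (gam _); apply/seteqP; split=> [[x y]|[x y] []].
Qed.

(** The elementary half of Kantorovich-Rubinstein duality: [h p.1 - h p.2] is integrated against a
    nearly optimal coupling. *)
Lemma Rintegral_lipschitz_le mu nu (h : T -> R) L : 0 <= L ->
  (forall x y, `|h x - h y| <= L * dist x y) ->
  \int[mu]_x h x - \int[nu]_x h x <= L * w1 mu nu.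
Proof.
move=> L0 hL; have [M hM] := lipschitz_bounded tb hL.
have mh := lipschitz_measurable tb hL.
have H k : w1 mu nu < k -> \int[mu]_x h x - \int[nu]_x h x <= L * k.
  rewrite -lte_fin -wass1E => /ereal_inf_lt[_ [gam gc <-]] Ik.
  have i1 : gam.-integrable setT (EFin \o (fun p => h p.1)).
    apply: (bounded_integrable gam (f := h \o fst)) => [|p].
      exact: measurableT_comp.
    exact: hM.
  have i2 : gam.-integrable setT (EFin \o (fun p => h p.2)).
    apply: (bounded_integrable gam (f := h \o snd)) => [|p].
      exact: measurableT_comp.
    exact: hM.
  have id := integrable_pmetric tb gam.
  rewrite (coupling_Rintegral_fst gc hL) (coupling_Rintegral_snd gc hL).
  rewrite -RintegralB//.
  apply: (@le_trans _ _ (\int[gam]_p (L * dist p.1 p.2))).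
    apply: le_Rintegral => //.
    - exact: (integrableB measurableT i1 i2).
    - exact: (integrableZl measurableT L id).
    - by move=> p _; rewrite (le_trans (ler_norm _)).
  rewrite RintegralZl//; apply: ler_wpM2l => //.
  rewrite -lee_fin; apply/ltW; apply: le_lt_trans Ik.
  by apply: Rintegral_le_integral => // p; rewrite lee_fin pmetric_ge0.
apply/ler_addgt0Pl => e e0.
have L1 : 0 < L + 1 by rewrite ltr_wpDl.
apply: (le_trans (H (w1 mu nu + e / (L + 1)) _)); first by rewrite ltrDl divr_gt0.
rewrite mulrDr addrC lerD2r mulrCA -[leRHS]mulr1 ler_wpM2l ?(ltW e0)//.
by rewrite ler_pdivrMr// mul1r lerDl.
Qed.

Lemma Rintegral_lipschitz mu nu (h : T -> R) L : 0 <= L ->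
  (forall x y, `|h x - h y| <= L * dist x y) ->
  `|\int[mu]_x h x - \int[nu]_x h x| <= L * w1 mu nu.
Proof.
move=> L0 hL; rewrite ler_norml Rintegral_lipschitz_le// andbT.
by rewrite lerNl opprB w1_sym Rintegral_lipschitz_le.
Qed.

End wass_metric.

Lemma grid_labelling (R : realType) (d : measure_display) (S : measurableType d)
    (h : S -> R) (a b e : R) :
  measurable_fun setT h -> (forall x, a <= h x <= b) -> 0 < e ->
  exists (m : nat) (lab : S -> 'I_m), [/\ labelling lab,
    forall x y, lab x = lab y -> `|h x - h y| <= e &
    m%:R <= (b - a) / e + 1].
Proof.
move=> mh hab e0.
pose k x := Num.truncn ((h x - a) / e).
have t0 x : 0 <= (h x - a) / e.
  by rewrite divr_ge0 ?(ltW e0)// subr_ge0; have /andP[] := hab x.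
have kP x : (k x)%:R * e <= h x - a < (k x).+1%:R * e.
  by have := truncn_itv (t0 x); rewrite ler_pdivlMr// ltr_pdivrMr.
pose m := Num.truncn ((b - a) / e).
have km x : (k x < m.+1)%N.
  rewrite ltnS; apply: le_truncn; rewrite ler_pM2r ?invr_gt0// lerD2r.
  by have /andP[] := hab x.
exists m.+1, (fun x => Ordinal (km x)); split.
- move=> i; rewrite [X in measurable X](_ : _ =
     h @^-1` `[a + i%:R * e, a + i.+1%:R * e[%classic).
    by rewrite -[X in measurable X]setTI; apply: mh => //; exact: measurable_itv.
  apply/seteqP; split=> x /=.
    move=> <-/=; rewrite in_itv/=; have /andP[? ?] := kP x.
    by apply/andP; split; lra.
  rewrite in_itv/= => /andP[? ?]; apply/val_inj => /=.
  by apply: truncn_def; rewrite ler_pdivlMr// ltr_pdivrMr//; apply/andP; split; lra.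
- move=> x y [kxy]; have := kP x; have := kP y; rewrite kxy -natr1 mulrDl mul1r.
  rewrite ler_norml => /andP[? ?] /andP[? ?]; lra.
- rewrite -natr1 lerD2r.
  rewrite truncn_le divr_ge0 ?(ltW e0)// subr_ge0.
  by have /andP[] := hab point; exact: le_trans.
Qed.

(** * Evaluation maps are measurable for the weak topology *)

Section weak_topology.
Context (R : realType) (T : ptopologicalType).

Lemma open_weak (g : T -> R) (U : set R) : bounded_continuous g -> open U ->
  open [set mu : Prob R T | U (Rintegral (mu : probability (borel T) R) setT g)].
Proof.
move=> gb oU.
set S := [set mu : Prob R T | _].
exists [set S]; last by rewrite bigcup_set1.
move=> _ ->; exists [fset (g, U)]%fset.
  by move=> i; rewrite !inE => /eqP ->; split.
rewrite predeqE => mu; split=> [H|Smu i /=]; last by rewrite inE => /eqP ->.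
by apply: (H (g, U)); rewrite /= inE.
Qed.

Variable dist : T -> T -> R.
Hypothesis tb : totally_bounded_pmetric (dist : borel T -> borel T -> R).
Hypothesis nbhsE : forall x (A : set T),
  nbhs x A <-> exists2 e, 0 < e & forall y, dist x y < e -> A y.

Lemma lipschitz_continuous (h : T -> R) L :
  (forall x y, `|h x - h y| <= L * dist x y) -> continuous h.
Proof.
move=> hL x; apply/cvgrPdist_lt => e e0; apply/nbhsE.
have L1 : 0 < `|L| + 1 by rewrite ltr_pwDr.
exists (e / (`|L| + 1)); first by rewrite divr_gt0.
move=> y; rewrite ltr_pdivlMr// => H; apply: le_lt_trans H.
apply: (le_trans (hL x y)); rewrite mulrC ler_wpM2l//.
  exact: (pmetric_ge0 tb).
by rewrite (le_trans (ler_norm _))// lerDl.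
Qed.

(* Portmanteau for open sets: the mass of the points of [U] at distance more
   than [1 / n] from the complement is detected by the Lipschitz function
   [min 1 (n phi)], [phi] being the distance to the complement. *)
Lemma open_pr_gt (U : set T) (a : R) : open U ->
  open [set mu : Prob R T | a < pr (mu : probability (borel T) R) U].
Proof.
move=> oU.
(* With an empty complement there is no distance function; the mass of [U] is then constantly 1. *)
have [UT|UT] := pselect (~` U !=set0); last first.
  have UE : U = setT.
    by apply/seteqP; split=> // x _; apply: contrapT => nU; apply: UT; exists x.
  have [a1|a1] := ltP a 1.
    rewrite [X in open X](_ : _ = setT); first exact: openT.
    by apply/seteqP; split=> // mu _ /=; rewrite UE pr_setT.
  rewrite [X in open X](_ : _ = set0); first exact: open0.
  by apply/seteqP; split=> // mu /=; rewrite UE pr_setT ltNge a1.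
pose D x := [set dist x y | y in ~` U].
have D0 x : lbound (D x) 0 by move=> _ [y _ <-]; exact: (pmetric_ge0 tb).
have Dinf x : has_inf (D x).
  split; last by exists 0; exact: D0.
  by have [y Uy] := UT; exists (dist x y), y.
pose phi x := inf (D x).
have phi0 x : 0 <= phi x by apply: lb_le_inf => //; exact: (Dinf x).1.
have phi_le x y : phi x <= phi y + dist x y.
  rewrite -lerBlDr; apply: lb_le_inf; first exact: (Dinf y).1.
  move=> _ [z Uz <-]; rewrite lerBlDr.
  apply: (@le_trans _ _ (dist x z)).
    by apply: ge_inf; [exact: (Dinf x).2|exists z].
  by rewrite addrC; exact: (pmetric_tri tb).
have phiL x y : `|phi x - phi y| <= dist x y.
  rewrite ler_norml lerBlDl lerNl opprB lerBlDl phi_le andbT.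
  by rewrite (pmetric_sym tb) phi_le.
have phiU x : ~ U x -> phi x = 0.
  move=> Ux; apply/eqP; rewrite eq_le phi0 andbT.
  by apply: ge_inf; [exact: (Dinf x).2|exists x; rewrite ?(pmetric_refl tb)].
have phiU0 x : U x -> 0 < phi x.
  move=> Ux; have /nbhsE[e e0 He] : nbhs x U by exact: open_nbhs_nbhs.
  apply: (lt_le_trans e0); apply: lb_le_inf; first exact: (Dinf x).1.
  by move=> _ [y Uy <-]; rewrite leNgt; apply/negP => /He.
pose g n x := Num.min 1 (n%:R * phi x).
have g01 n x : 0 <= g n x <= 1.
  by rewrite /g ge_min lexx/= le_min ler01 mulr_ge0.
have gL n x y : `|g n x - g n y| <= n%:R * dist x y.
  have H x' y' : g n x' <= g n y' + n%:R * dist x' y'.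
    rewrite /g; have := phi_le x' y'; have := pmetric_ge0 tb x' y'.
    move=> h1 h2.
    have h3 : n%:R * phi x' <= n%:R * phi y' + n%:R * dist x' y'.
      by rewrite -mulrDr ler_wpM2l.
    have h4 : 0 <= n%:R * dist x' y' by rewrite mulr_ge0.
    case: (leP 1 (n%:R * phi y')) => h5.
      by rewrite ge_min lerDl h4.
    by rewrite ge_min h3 orbT.
  rewrite ler_norml lerBlDl lerNl opprB lerBlDl addrC H andbT.
  by rewrite (pmetric_sym tb) addrC H.
have bg n : bounded_continuous (g n).
  split; first exact: lipschitz_continuous (gL n).
  by exists 1 => x; have /andP[? ?] := g01 n x; rewrite ger0_norm.
pose I n (mu : Prob R T) := Rintegral (mu : probability (borel T) R) setT (g n).
have mphi : measurable_fun setT (phi : borel T -> R).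
  by apply: (lipschitz_measurable tb (L := 1)) => x y; rewrite mul1r.
have mU : measurable (U : set (borel T)) by exact: sub_sigma_algebra.
have ig n (mu : Prob R T) :
    (mu : probability (borel T) R).-integrable setT (EFin \o (g n : borel T -> R)).
  exact: (lipschitz_integrable tb _ (gL n)).
pose A n := [set x : borel T | n.+1%:R^-1 < phi x].
have mA n : measurable (A n).
  rewrite [X in measurable X](_ : _ = phi @^-1` `]n.+1%:R^-1, +oo[%classic).
    by rewrite -[X in measurable X]setTI; apply: mphi.
  by apply/seteqP; split=> x; rewrite /= in_itv/= andbT.
have IU n mu : I n mu <= pr (mu : probability (borel T) R) U.
  rewrite -Rintegral_indic_pr//; apply: le_Rintegral => //.
  - exact: ig.
  - exact: (integrable_indic (mu : probability (borel T) R) mU).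
  move=> x _; rewrite indicE; have [xU|xU] := boolP (x \in U).
    by have /andP[] := g01 n x.
  by rewrite /g phiU ?mulr0 ?ge_min ?lexx ?orbT//; move: xU; rewrite notin_setE.
have IA n (mu : Prob R T) : pr (mu : probability (borel T) R) (A n) <= I n.+1 mu.
  rewrite -Rintegral_indic_pr//; apply: le_Rintegral => //.
  - exact: (integrable_indic (mu : probability (borel T) R) (mA n)).
  - exact: ig.
  move=> x _; rewrite indicE; have [xA|xA] := boolP (x \in A n); last first.
    by have /andP[] := g01 n.+1 x.
  rewrite /g le_min lexx/= -ler_pdivrMl// mulr1 ltW//.
  by move: xA; rewrite inE.
have UA : U = \bigcup_n A n.
  apply/seteqP; split=> [x /phiU0 px|x [n _ An]]; last first.
    by apply: contrapT => /phiU px; move: An; rewrite /A/= px ltNge invr_ge0 ler0n.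
  exists (Num.bound (phi x)^-1) => //; rewrite /A/=.
  rewrite -ltf_pV2 ?posrE ?invr_gt0 ?invrK//.
  rewrite (lt_le_trans (archi_boundP _)) ?invr_ge0 ?(ltW px)//.
  by rewrite ler_nat.
(* The mass of [U] exceeds [a] exactly when some [g n] has integral above [a]: these functions lie
   below the indicator of [U], and [g n.+1] lies above that of [A n], where the sets [A n] increase
   to [U]. *)
rewrite [X in open X](_ : _ = \bigcup_n [set mu : Prob R T | `]a, +oo[%classic (I n mu)]).
  apply: bigcup_open => n _; apply: (open_weak (bg n)); exact: interval_open.
apply/seteqP; split=> mu /=; last first.
  by move=> [n _]; rewrite /= in_itv/= andbT => /lt_le_trans; apply; exact: IU.
move=> aU.
have /cvgrPdist_lt : (fun n => pr (mu : probability (borel T) R) (A n)) @ \oo --> pr (mu : probability (borel T) R) U.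
  apply: fine_cvg; rewrite -prE//.
  have : (mu : probability (borel T) R) \o A @ \oo --> (mu : probability (borel T) R) (\bigcup_n A n).
    apply: nondecreasing_cvg_mu => //; first exact: bigcupT_measurable.
    move=> m n mn; apply/subsetPset => x /=; apply: le_lt_trans.
    by rewrite lef_pV2 ?posrE ?ler_nat.
  by rewrite -UA.
move=> /(_ (pr (mu : probability (borel T) R) U - a)); rewrite subr_gt0 => /(_ aU).
move=> [n _ /(_ n (leqnn n))] /= H; exists n.+1 => //=.
rewrite in_itv/= andbT; apply: lt_le_trans (IA n mu).
move: H; rewrite ltr_norml => /andP[_]; lra.
Qed.

(** Open sets are stable under intersection and generate the Borel sets. On them the evaluation is
    lower semicontinuous by [open_pr_gt], and the sets with measurable evaluation form a Dynkin
    system. *)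
Lemma measurable_eval (A : set (borel T)) : measurable A ->
  measurable_fun setT
    (fun mu : borel (Prob R T) => pr (mu : probability (borel T) R) A).
Proof.
pose H := [set A : set (borel T) | measurable A /\ measurable_fun setT
    (fun mu : borel (Prob R T) => pr (mu : probability (borel T) R) A)].
suff : measurable `<=` H by move=> /[apply] -[].
have GI : setI_closed (@open T) by move=> B C; exact: openI.
apply: (lambda_system_subset GI (D := setT)) => //.
- apply/dynkin_lambda_system; split.
  + split=> //; rewrite (_ : (fun _ => _) = cst 1)//.
    by apply/funext => mu; rewrite pr_setT.
  + move=> B [mB mfB]; split; first exact: measurableC.
    rewrite (_ : (fun _ => _) = (fun mu : borel (Prob R T) =>
        1 - pr (mu : probability (borel T) R) B)).
      exact: measurable_funB.
    by apply/funext => mu; rewrite pr_setC.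
  + move=> F0 tF0 HF0; pose F : (set (borel T))^nat := F0.
    have tF : trivIset setT F by [].
    have HF n : H (F n) by exact: HF0.
    change (H (\bigcup_n F n)).
    have mF n : measurable (F n) by exact: (HF n).1.
    have mUF : measurable (\bigcup_n F n) by exact: bigcupT_measurable.
    split=> //; apply/measurable_EFinP.
    apply: (emeasurable_fun_cvg (fun n (mu : borel (Prob R T)) =>
        (\sum_(0 <= i < n) (mu : probability (borel T) R) (F i))%E)).
      move=> n; apply: emeasurable_sum => i.
      rewrite (_ : (fun _ => _) = EFin \o (fun mu : borel (Prob R T) =>
        pr (mu : probability (borel T) R) (F i))).
        by apply/measurable_EFinP; exact: (HF i).2.
      by apply/funext => mu; rewrite /= -prE.
    by move=> mu _ /=; rewrite -prE//; exact: measure_sigma_additive.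
- move=> B oB; split; first exact: sub_sigma_algebra.
  apply: (measurability _ (RGenOInfty.measurableE R)) => //.
  move=> /= _ [_ [c ->] <-]; rewrite setTI.
  apply: sub_sigma_algebra.
  rewrite [X in open X](_ : _ =
      [set mu : Prob R T | c < pr (mu : probability (borel T) R) B]).
    exact: open_pr_gt.
  by apply/seteqP; split=> mu; rewrite /= in_itv/= andbT.
Qed.

End weak_topology.

(** * The metric spaces of examples and of tasks *)

(** The number of cells, a product over the coordinates, is what brings the dimension into the
    rate. *)
Lemma multi_grid_labelling (R : realType) (d : measure_display)
    (S : measurableType d) (I : eqType) (s : seq I) (h : I -> S -> R)
    (a b e : R) :
  (forall i, measurable_fun setT (h i)) -> (forall i x, a <= h i x <= b) ->
  0 < e ->
  exists (V : finType) (lab : S -> V), [/\ labelling lab,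
    forall x y, lab x = lab y -> forall i, i \in s -> `|h i x - h i y| <= e &
    #|V|%:R <= ((b - a) / e + 1) ^+ size s].
Proof.
move=> mh hab e0; elim: s => [|i s [V [lab [mlab H cV]]]].
  exists unit, (fun=> tt); split=> //; last by rewrite card_unit expr0.
  move=> v; rewrite [X in measurable X](_ : _ = setT)//.
  by apply/seteqP; split=> //= x _; case: v.
have [m [lab' [mlab' H' cm]]] := grid_labelling (mh i) (hab i) e0.
exists ('I_m * V)%type, (fun x => (lab' x, lab x)); split.
- exact: labelling_pair.
- move=> x y [/H' h1 /H h2] j; rewrite in_cons => /orP[/eqP ->//|]; exact: h2.
- rewrite card_prod card_ord natrM exprS; apply: ler_pM => //.
Qed.

(** The cells gather the measures that give nearly the same masses to the cells of a fine partition
    of [T]; by [w1_le_weight] these are close. They are measurable as soon as the evaluations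
    are. *)
Lemma totally_bounded_w1 (R : realType) (d d' : measure_display)
    (T : measurableType d) (S : measurableType d') (dist : T -> T -> R)
    (ev : S -> probability T R) :
  totally_bounded_pmetric dist ->
  (forall A, measurable A -> measurable_fun setT (fun s => pr (ev s) A)) ->
  totally_bounded_pmetric (fun s s' => w1 dist (ev s) (ev s')).
Proof.
move=> tb mev; split=> [s|s s'|s s' s''|e e0].
- exact: w1_refl.
- exact: w1_sym.
- exact: w1_tri.
have [D D0 HD] := pmetric_bounded tb.
have e40 : 0 < e / 4 by rewrite divr_gt0.
have [V [lab [c [mlab ce]]]] := pmetric_rep tb e40.
pose e' := e / (2 * D * (#|V|%:R + 1)).
have V1 : 0 < #|V|%:R + 1 :> R by rewrite ltr_wpDl.
have e'0 : 0 < e' by rewrite divr_gt0// !mulr_gt0.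
have mw v : measurable_fun setT (fun s => weight lab (ev s) v) by exact: mev.
have w01 v s : 0 <= weight lab (ev s) v <= 1.
  by rewrite weight_ge0 pr_le1.
have [U [lab' [mlab' H' _]]] := multi_grid_labelling (enum V) mw w01 e'0.
exists U, lab'; split=> // s s' /H' ss'.
apply: le_trans (w1_le_weight tb _ _ HD mlab ce) _.
apply: (@le_trans _ _ (D * (\sum_(v : V) e') + 2 * (e / 4))).
  rewrite lerD2r ler_wpM2l ?(ltW D0)//; apply: ler_sum => v _.
  by apply: ss'; rewrite mem_enum.
have -> : \sum_(v : V) e' = #|V|%:R * e' by rewrite sumr_const mulr_natl.
have -> : D * (#|V|%:R * e') = (e / 2) * (#|V|%:R / (#|V|%:R + 1)).
  by rewrite /e'; field; rewrite !gt_eqF.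
have : #|V|%:R / (#|V|%:R + 1) <= 1 :> R by rewrite ler_pdivrMr// mul1r lerDl.
move=> /(ler_wpM2l (_ : 0 <= e / 2)) H; have {}H := H (ltW (divr_gt0 e0 (ltr0Sn _ _))).
lra.
Qed.

(** * The Euclidean norm *)

Section enorm.
Context (R : realType) (n : nat).
Implicit Types v w : 'rV[R]_n.

Lemma enorm_ge0 v : 0 <= enorm v.
Proof. exact: sqrtr_ge0. Qed.

Lemma sqr_enorm v : enorm v ^+ 2 = \sum_i v ord0 i ^+ 2.
Proof. by rewrite sqr_sqrtr// sumr_ge0// => i _; exact: sqr_ge0. Qed.

Lemma enorm0 : enorm (0 : 'rV[R]_n) = 0.
Proof.
by rewrite /enorm big1 ?sqrtr0// => i _; rewrite mxE expr0n.
Qed.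

Lemma enormN v : enorm (- v) = enorm v.
Proof.
by rewrite /enorm; congr Num.sqrt; apply: eq_bigr => i _; rewrite mxE sqrrN.
Qed.

(** Lagrange's identity: twice the difference of the two sides is a double sum of squares. *)
Lemma Cauchy_Schwarz_sum (I : finType) (a b : I -> R) :
  (\sum_i a i * b i) ^+ 2 <= (\sum_i a i ^+ 2) * (\sum_i b i ^+ 2).
Proof.
have S0 : 0 <= \sum_i \sum_j (a i * b j - a j * b i) ^+ 2.
  by apply: sumr_ge0 => i _; apply: sumr_ge0 => j _; exact: sqr_ge0.
have E1 : (\sum_i a i ^+ 2) * (\sum_i b i ^+ 2) =
    \sum_i \sum_j a i ^+ 2 * b j ^+ 2 by rewrite big_distrlr.
have E2 : (\sum_i a i ^+ 2) * (\sum_i b i ^+ 2) =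
    \sum_i \sum_j a j ^+ 2 * b i ^+ 2.
  by rewrite big_distrlr exchange_big.
have E3 : (\sum_i a i * b i) ^+ 2 = \sum_i \sum_j (a i * b i) * (a j * b j).
  by rewrite expr2 big_distrlr.
have E : \sum_i \sum_j (a i * b j - a j * b i) ^+ 2 =
    \sum_i \sum_j a i ^+ 2 * b j ^+ 2 + \sum_i \sum_j a j ^+ 2 * b i ^+ 2
    - 2 * \sum_i \sum_j (a i * b i) * (a j * b j).
  rewrite mulr_sumr -big_split -sumrB; apply: eq_bigr => i _ /=.
  rewrite mulr_sumr -big_split -sumrB; apply: eq_bigr => j _ /=.
  by ring.
move: S0; rewrite E -E1 -E2 -E3; lra.
Qed.

Lemma enormD v w : enorm (v + w) <= enorm v + enorm w.
Proof.
rewrite -(@ler_pXn2r _ 2) ?nnegrE ?addr_ge0 ?enorm_ge0//.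
rewrite sqrrD !sqr_enorm.
have -> : \sum_i (v + w) ord0 i ^+ 2 = \sum_i v ord0 i ^+ 2 +
    (\sum_i v ord0 i * w ord0 i) *+ 2 + \sum_i w ord0 i ^+ 2.
  rewrite -sumrMnl -!big_split/=; apply: eq_bigr => i _.
  by rewrite mxE sqrrD.
rewrite lerD2r lerD2l lerMn2r/=.
apply: (le_trans (ler_norm _)).
rewrite -(@ler_pXn2r _ 2) ?nnegrE ?mulr_ge0 ?enorm_ge0//.
rewrite real_normK ?num_real// exprMn !sqr_enorm.
exact: Cauchy_Schwarz_sum.
Qed.

Lemma coord_le_enorm v i : `|v ord0 i| <= enorm v.
Proof.
rewrite -(@ler_pXn2r _ 2) ?nnegrE ?enorm_ge0// real_normK ?num_real//.
rewrite sqr_enorm (bigD1 i)//= lerDl.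
by apply: sumr_ge0 => j _; exact: sqr_ge0.
Qed.

Lemma enorm_le_sum v : enorm v <= \sum_i `|v ord0 i|.
Proof.
have S0 : 0 <= \sum_i `|v ord0 i| by exact: sumr_ge0.
rewrite -(@ler_pXn2r _ 2) ?nnegrE ?enorm_ge0// sqr_enorm expr2 mulr_suml.
apply: ler_sum => i _; rewrite -real_normK ?num_real// expr2 ler_wpM2l//.
by rewrite (bigD1 i)//= lerDl sumr_ge0.
Qed.

Lemma mx_norm_le_enorm v : `|v| <= enorm v.
Proof.
rewrite [leLHS]/Num.Def.normr/= mx_normrE; apply: bigmax_le; first exact: enorm_ge0.
by move=> [i j] _ /=; rewrite (ord1 i); exact: coord_le_enorm.
Qed.

Lemma coord_le_mx_norm v i : `|v ord0 i| <= `|v|.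
Proof.
rewrite [leRHS]/Num.Def.normr/= mx_normrE.
by apply/bigmax_geP; right; exists (ord0, i).
Qed.

Lemma enorm_le_mx_norm v : enorm v <= n%:R * `|v|.
Proof.
apply: (le_trans (enorm_le_sum v)).
rewrite -[X in X%:R]card_ord -sum1_card natr_sum mulr_suml.
by apply: ler_sum => i _; rewrite mul1r coord_le_mx_norm.
Qed.

End enorm.

Lemma sqr_enorm_row_mx (R : realType) (m n : nat) (v : 'rV[R]_m) (w : 'rV[R]_n) :
  enorm (row_mx v w) ^+ 2 = enorm v ^+ 2 + enorm w ^+ 2.
Proof.
rewrite !sqr_enorm big_split_ord/=; congr (_ + _); apply: eq_bigr => i _.
  by rewrite row_mxEl.
by rewrite row_mxEr.
Qed.

(** The topology is that of the sup norm, which the Euclidean norm dominates and exceeds at most by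
    the factor [n]. *)
Lemma nbhs_pts (R : realType) (n : nat) (K : compact_dom R n) (x : pts K)
    (A : set (pts K)) :
  nbhs x A <-> exists2 e : R, 0 < e &
    forall y, enorm (pval x - pval y) < e -> A y.
Proof.
have nE : nbhs x A <-> exists2 e : R, 0 < e &
    forall y : pts K, `|pval x - pval y| < e -> A y.
  pose x' : set_type (dom_set K) := x; pose A' : set (set_type (dom_set K)) := A.
  have := @nbhs_ballP R (set_type (dom_set K)) x' A'.
  move=> H; apply: iff_trans H _; split=> -[e e0 H]; exists e => // y Hy.
    apply: H; rewrite -initial_ballE /= mx_norm_ball; exact: Hy.
  apply: H; move: Hy; rewrite -initial_ballE /= mx_norm_ball; exact.
apply: iff_trans nE _; split=> -[e e0 H].
  by exists e => // y Hy; apply: H; apply: le_lt_trans Hy; exact: mx_norm_le_enorm.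
have n1 : 0 < n%:R + 1 :> R by rewrite ltr_wpDl.
exists (e / (n%:R + 1)); first by rewrite divr_gt0.
move=> y; rewrite ltr_pdivlMr// => Hy; apply: H; apply: le_lt_trans Hy.
apply: (le_trans (enorm_le_mx_norm _)).
by rewrite mulrC ler_wpM2l// lerDl.
Qed.

Lemma pval_bounded (R : realType) (n : nat) (K : compact_dom R n) :
  exists2 B : R, 0 < B & forall (x : pts K) i, `|pval x ord0 i| <= B.
Proof.
have [M [_ HM]] := compact_bounded (@dom_compact _ _ K).
exists (`|M| + 1); first by rewrite ltr_wpDl.
move=> x i; apply: le_trans (_ : `|pval x| <= _).
  exact: coord_le_mx_norm.
by apply: HM; [rewrite ltr_pwDr// ler_norm|exact: set_valP].
Qed.

(** Unlike [lipschitz_measurable], this relies on the topology and not on measurable cells; the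
    cells for [zd] are built from the coordinates, whose measurability it provides. *)
Lemma borel_measurable_lipschitz (R : realType) (T : ptopologicalType)
    (dist : T -> T -> R) (h : T -> R) :
  (forall x (A : set T),
    nbhs x A <-> exists2 e, 0 < e & forall y, dist x y < e -> A y) ->
  (forall x y, `|h x - h y| <= dist x y) ->
  measurable_fun setT (h : borel T -> R).
Proof.
move=> nE hL; apply: (measurability _ (RGenOInfty.measurableE R)) => //.
move=> /= _ [_ [c ->] <-]; rewrite setTI; apply: sub_sigma_algebra.
rewrite openE => x /=; rewrite in_itv/= andbT => cx; apply/nE.
exists (h x - c); first by rewrite subr_gt0.
move=> y H; rewrite /= in_itv/= andbT.
have := le_lt_trans (le_trans (ler_norm _) (hL x y)) H; lra.
Qed.

Section task_space.
Context (R : realType) (dx dy : nat) (X : compact_dom R dx)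
  (Y : compact_dom R dy).
Local Notation Zs := (pts X * pts Y)%type.

Definition zd (z z' : borel Zs) : R :=
  enorm (row_mx (pval z.1) (pval z.2) - row_mx (pval z'.1) (pval z'.2)).

Lemma sqr_zd z z' : zd z z' ^+ 2 =
  enorm (pval z.1 - pval z'.1) ^+ 2 + enorm (pval z.2 - pval z'.2) ^+ 2.
Proof. by rewrite /zd opp_row_mx add_row_mx sqr_enorm_row_mx. Qed.

Lemma zd_refl z : zd z z = 0.
Proof. by rewrite /zd subrr enorm0. Qed.

Lemma zd_sym z z' : zd z z' = zd z' z.
Proof. by rewrite /zd -enormN opprB. Qed.

Lemma zd_tri z z' z'' : zd z z'' <= zd z z' + zd z' z''.
Proof. by rewrite /zd; apply: le_trans (enormD _ _); rewrite addrA subrK. Qed.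

Lemma zd_ge1 z z' : enorm (pval z.1 - pval z'.1) <= zd z z'.
Proof.
rewrite -(@ler_pXn2r _ 2) ?nnegrE ?enorm_ge0// sqr_zd lerDl.
exact: sqr_ge0.
Qed.

Lemma zd_ge2 z z' : enorm (pval z.2 - pval z'.2) <= zd z z'.
Proof.
rewrite -(@ler_pXn2r _ 2) ?nnegrE ?enorm_ge0// sqr_zd lerDr.
exact: sqr_ge0.
Qed.

Lemma zd_le z z' :
  zd z z' <= enorm (pval z.1 - pval z'.1) + enorm (pval z.2 - pval z'.2).
Proof.
rewrite -(@ler_pXn2r _ 2) ?nnegrE ?addr_ge0 ?enorm_ge0// sqr_zd sqrrD.
by rewrite lerD2r lerDl mulrn_wge0// mulr_ge0// enorm_ge0.
Qed.

Lemma nbhs_zd (z : Zs) (A : set Zs) :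
  nbhs z A <-> exists2 e, 0 < e & forall z', zd z z' < e -> A z'.
Proof.
split=> [[[P Q] /= [/nbhs_pts[e e0 He] /nbhs_pts[e' e'0 He']] PQ]|[e e0 He]].
  exists (Num.min e e'); first by rewrite lt_min e0.
  move=> z'; rewrite lt_min => /andP[ze ze']; apply: PQ; split=> /=.
    by apply: He; apply: le_lt_trans ze; exact: zd_ge1.
  by apply: He'; apply: le_lt_trans ze'; exact: zd_ge2.
exists ([set x | enorm (pval z.1 - pval x) < e / 2],
        [set y | enorm (pval z.2 - pval y) < e / 2]) => /=.
  split; apply/nbhs_pts; exists (e / 2) => //; rewrite divr_gt0//.
move=> z' [/= h1 h2]; apply: He; apply: (le_lt_trans (zd_le _ _)); lra.
Qed.

Definition coord (i : 'I_dx + 'I_dy) (z : borel Zs) : R :=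
  match i with
  | inl i => pval z.1 ord0 i
  | inr i => pval z.2 ord0 i
  end.

Lemma coord_lipschitz i z z' : `|coord i z - coord i z'| <= zd z z'.
Proof.
case: i => i /=.
  apply: le_trans (zd_ge1 z z'); apply: le_trans (coord_le_enorm _ i).
  by rewrite !mxE.
apply: le_trans (zd_ge2 z z'); apply: le_trans (coord_le_enorm _ i).
by rewrite !mxE.
Qed.

Lemma zd_le_coord z z' : zd z z' <= \sum_i `|coord i z - coord i z'|.
Proof.
apply: (le_trans (zd_le _ _)); rewrite big_sumType/= lerD//;
by apply: (le_trans (enorm_le_sum _)); apply: ler_sum => i _; rewrite !mxE.
Qed.

(** A grid of mesh [e / (n + 1)] in each of the [n = dx + dy] coordinates. The bound [e <= 1]
    absorbs the additional interval per coordinate into the constant. *)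
Lemma zd_cells : exists2 K : R, 0 < K & forall e, 0 < e -> e <= 1 ->
  exists (V : finType) (lab : borel Zs -> V), [/\ labelling lab,
    forall z z', lab z = lab z' -> zd z z' <= e &
    #|V|%:R <= K * (e^-1) ^+ (dx + dy)].
Proof.
have [B1 B10 HB1] := pval_bounded X; have [B2 B20 HB2] := pval_bounded Y.
pose B := B1 + B2; pose n := (dx + dy)%N.
have B0 : 0 < B by rewrite addr_gt0.
have HB i z : - B <= coord i z <= B.
  rewrite -ler_norml /B; case: i => i /=.
    by apply: (le_trans (HB1 _ _)); rewrite lerDl ltW.
  by apply: (le_trans (HB2 _ _)); rewrite lerDr ltW.
have n0 : 0 < n%:R + 1 :> R by rewrite ltr_wpDl.
exists ((2 * B * (n%:R + 1) + 1) ^+ n).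
  by rewrite exprn_gt0// ltr_wpDl// !mulr_ge0// ltW.
move=> e e0 e1.
have mc i : measurable_fun setT (coord i).
  exact: (borel_measurable_lipschitz nbhs_zd (coord_lipschitz i)).
have e'0 : 0 < e / (n%:R + 1) by rewrite divr_gt0.
have [V [lab [mlab H cV]]] := multi_grid_labelling (enum {: 'I_dx + 'I_dy}) mc HB e'0.
exists V, lab; split=> //.
  move=> z z' /H zz'; apply: (le_trans (zd_le_coord _ _)).
  apply: (@le_trans _ _ (\sum_(i : 'I_dx + 'I_dy) (e / (n%:R + 1)))).
    by apply: ler_sum => i _; apply: zz'; rewrite mem_enum.
  rewrite sumr_const card_sum !card_ord -/n -[X in X <= _]mulr_natl mulrCA.
  rewrite -[leRHS]mulr1 ler_wpM2l ?(ltW e0)//.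
  by rewrite ler_pdivrMr// mul1r lerDl.
apply: (le_trans cV).
rewrite -cardE card_sum !card_ord -/n.
rewrite -exprMn lerXn2r ?nnegrE//.
- by rewrite addr_ge0// divr_ge0 ?(ltW e'0)// opprK addr_ge0// ltW.
- by rewrite mulr_ge0 ?invr_ge0 ?(ltW e0)// addr_ge0// !mulr_ge0// ltW.
rewrite [leRHS]mulrDl mul1r opprK lerD//; last by rewrite invf_ge1.
rewrite le_eqVlt; apply/orP; left; apply/eqP; field.
by rewrite !gt_eqF.
Qed.

Lemma totally_bounded_zd : totally_bounded_pmetric zd.
Proof.
split; [exact: zd_refl|exact: zd_sym|exact: zd_tri|move=> e e0].
have [K K0 HK] := zd_cells.
have [||V [lab [mlab H _]]] := HK (Num.min e 1); first by rewrite lt_min e0 ltr01.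
  by rewrite ge_min lexx orbT.
exists V, lab; split=> // z z' /H /le_trans; apply.
by rewrite ge_min lexx.
Qed.

Lemma W1E (r r' : Prob R Zs) : W1 r r' = (w1 zd r r')%:E.
Proof. exact: wass1E totally_bounded_zd _ _. Qed.

(** The real-valued form of [W1] (see [W1E]), so that the theory of real distances applies a second
    time, to meta-distributions. *)
Definition taskd (r r' : borel (Prob R Zs)) : R := w1 zd r r'.

Lemma totally_bounded_taskd : totally_bounded_pmetric taskd.
Proof.
apply: (@totally_bounded_w1 _ _ _ _ (borel (Prob R Zs)) zd id).
  exact: totally_bounded_zd.
exact: (measurable_eval totally_bounded_zd nbhs_zd).
Qed.

Lemma wass1_W1E (P Q : meta_distribution X Y) :
  wass1 (@W1 R dx dy X Y : borel (Prob R Zs) -> borel (Prob R Zs) -> \bar R) P Q =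
  (w1 taskd P Q)%:E.
Proof.
rewrite -(wass1E totally_bounded_taskd).
by congr (wass1 _ _ _); apply/funext => r; apply/funext => r'; rewrite W1E.
Qed.

End task_space.

(** * Empirical frequencies *)

Lemma Rintegral_cstT (R : realType) (d : measure_display) (T : measurableType d)
    (mu : probability T R) (r : R) : \int[mu]_x r = r.
Proof. by rewrite Rintegral_cst// -/(pr mu setT) pr_setT mulr1. Qed.

Lemma integrable_cstT (R : realType) (d : measure_display) (T : measurableType d)
    (mu : probability T R) (r : R) : mu.-integrable setT (EFin \o (fun=> r)).
Proof.
by apply: (bounded_integrable mu (M := `|r|)) => //; exact: measurable_cst.
Qed.

Section empirical.
Context (R : realType) (d : measure_display) (T : measurableType d).

Lemma pr_empirical (s : seq T) (A : set T) : (0 < size s)%N ->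
  pr (empirical_measure R s) A = (size s)%:R^-1 * \sum_(x <- s) \1_A x.
Proof.
move=> s0; rewrite /pr empirical_measureE//.
by under eq_bigr do rewrite diracE -indicE; rewrite sumEFin -EFinM.
Qed.

Lemma Rintegral_empirical (s : seq T) (h : T -> R) (M : R) : (0 < size s)%N ->
  measurable_fun setT h -> (forall x, `|h x| <= M) ->
  \int[empirical_measure R s]_x h x = (size s)%:R^-1 * \sum_(x <- s) h x.
Proof.
move=> s0 mh hM.
have M0 : 0 <= M by apply: le_trans (hM point).
pose mu := empirical_measure R s.
have ih : mu.-integrable setT (EFin \o h) by exact: bounded_integrable mh hM.
have iM : mu.-integrable setT (EFin \o (fun=> M)).
  by apply: (bounded_integrable mu (M := M)) => // x; rewrite ger0_norm.
have mhM : measurable_fun setT (fun x => h x + M) by exact: measurable_funD.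
(* The shift by [M] makes the integrand nonnegative, as the integration formulas for sums and
   multiples of measures require. *)
have E : \int[mu]_x (h x + M) = (size s)%:R^-1 * \sum_(x <- s) (h x + M).
  have n0 : 0 <= (size s)%:R^-1 :> R by rewrite invr_ge0.
  pose k : {nonneg R} := NngNum n0.
  pose m2 := mscale k (msum (fun i => dirac (nth point s i) : {measure set T -> \bar R}) (size s)).
  rewrite /Rintegral (eq_measure_integral m2); last first.
    move=> A mA _; apply: etrans (empirical_measureE R A s0) _.
    by rewrite /m2 /= /mscale/= /msum (big_nth point) big_mkord.
  have h0 x : (0 <= (h x + M)%:E)%E.
    by rewrite lee_fin; have := hM x; rewrite ler_norml => /andP[]; lra.
  rewrite ge0_integral_mscale//; last exact/measurable_EFinP.
  rewrite ge0_integral_measure_sum//; last exact/measurable_EFinP.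
  rewrite (big_nth point) big_mkord.
  rewrite (eq_bigr (fun i : 'I_(size s) => (h (nth point s i) + M)%:E)).
    by rewrite sumEFin -EFinM.
  move=> i _; rewrite integral_dirac ?diracT ?mul1e//.
  exact/measurable_EFinP.
move: E; rewrite RintegralD// Rintegral_cstT.
rewrite big_split/= mulrDr => /eqP; rewrite -subr_eq => /eqP <-.
have -> : \sum_(x <- s) M = (size s)%:R * M.
  by rewrite big_const_seq count_predT iter_addr_0 mulr_natl.
by rewrite mulKf ?addrK// pnatr_eq0 -lt0n.
Qed.

End empirical.

Section iid_moments.
Context (R : realType) (d : measure_display) (T : measurableType d)
  (d' : measure_display) (Om : measurableType d') (Pr : probability Om R)
  (mu : probability T R) (n : nat) (X : 'I_n -> Om -> T).
Hypothesis iid : iid_sample Pr mu X.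

Definition iid_seq (w : Om) : seq T := [seq X i w | i <- enum 'I_n].

Lemma size_iid_seq w : size (iid_seq w) = n.
Proof. by rewrite size_map size_enum_ord. Qed.

Lemma measurable_preimage_iid i (A : set T) : measurable A ->
  measurable (X i @^-1` A).
Proof. by move=> mA; rewrite -[X in measurable X]setTI; exact: iid.1. Qed.

Lemma iid_prodE (P : pred 'I_n) (A : set T) : measurable A ->
  pr Pr [set w | forall i, P i -> A (X i w)] = pr mu A ^+ #|P|.
Proof.
move=> mA; pose B i := if P i then A else setT.
have mB i : measurable (B i) by rewrite /B; case: ifP.
have := iid.2 B mB; rewrite /pr.
rewrite (_ : [set w | forall i, B i (X i w)] = [set w | forall i, P i -> A (X i w)]).
  move=> ->/=; rewrite (bigID P)/= [X in _ * X]big1 ?mulr1.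
    rewrite (eq_bigr (fun=> pr mu A)) ?prodr_const//.
    by move=> i Pi; rewrite /B Pi.
  by move=> i /negbTE Pi; rewrite /B Pi probability_setT.
apply/seteqP; split=> w /= H i; have := H i; rewrite /B; case: ifP => //.
by move=> _ /(_ isT).
Qed.

Lemma pr_iid i (A : set T) : measurable A -> pr Pr (X i @^-1` A) = pr mu A.
Proof.
move=> mA; have := iid_prodE (pred1 i) mA; rewrite card1 expr1 => <-; congr pr.
apply/seteqP; split=> w /=; last by move=> /(_ i); apply; exact: eqxx.
by move=> Aw j /eqP ->.
Qed.

Lemma pr_iid2 i j (A : set T) : measurable A -> i != j ->
  pr Pr (X i @^-1` A `&` X j @^-1` A) = pr mu A ^+ 2.
Proof.
move=> mA ij; have := iid_prodE (pred2 i j) mA; rewrite card2 ij => <-; congr pr.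
apply/seteqP; split=> w /=.
  by move=> [Ai Aj] k /= /orP[/eqP ->|/eqP ->].
by move=> H; split; apply: H; rewrite /= eqxx ?orbT.
Qed.

Definition iid_freq (A : set T) (w : Om) : R := pr (empirical_measure R (iid_seq w)) A.

Hypothesis n0 : (0 < n)%N.

Lemma iid_freqE A w : iid_freq A w = n%:R^-1 * \sum_i \1_(X i @^-1` A) w.
Proof.
by rewrite /iid_freq pr_empirical size_iid_seq// big_map big_enum.
Qed.

Lemma iid_freq01 A w : 0 <= iid_freq A w <= 1.
Proof.
rewrite iid_freqE mulr_ge0 ?sumr_ge0 ?invr_ge0//= mulrC ler_pdivrMr ?ltr0n// mul1r.
rewrite -[X in _ <= X%:R]card_ord -sum1_card natr_sum; apply: ler_sum => i _.
by rewrite indicE; case: (_ \in _).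
Qed.

Lemma measurable_iid_freq A : measurable A -> measurable_fun setT (iid_freq A).
Proof.
move=> mA; rewrite (_ : iid_freq A = fun w => n%:R^-1 * \sum_i \1_(X i @^-1` A) w).
  apply: measurable_funM => //; apply: measurable_sum => i.
  by apply: measurable_indic; exact: measurable_preimage_iid.
by apply/funext => w; exact: iid_freqE.
Qed.

Lemma integrable_indicT (B : set Om) : measurable B ->
  Pr.-integrable setT (EFin \o (\1_B : Om -> R)).
Proof. exact: integrable_indic. Qed.

Lemma integrable_iid_freq A : measurable A ->
  Pr.-integrable setT (EFin \o iid_freq A).
Proof.
move=> mA; apply: (bounded_integrable Pr (M := 1)) => [|w].
  exact: measurable_iid_freq.
by have /andP[? ?] := iid_freq01 A w; rewrite ger0_norm.
Qed.

Lemma Rintegral_iid_freq A : measurable A -> \int[Pr]_w iid_freq A w = pr mu A.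
Proof.
move=> mA; under eq_Rintegral do rewrite iid_freqE.
have mX i : measurable (X i @^-1` A) by exact: measurable_preimage_iid.
rewrite RintegralZl//; last first.
  have := integrable_iid_freq mA.
  move=> /(integrableZl measurableT n%:R); apply: eq_integrable => // w _.
  by rewrite /= iid_freqE -EFinM mulVKf// pnatr_eq0 -lt0n.
rewrite Rintegral_sum; last by move=> i; exact: integrable_indicT.
under eq_bigr do rewrite Rintegral_indic_pr// pr_iid//.
by rewrite sumr_const card_ord -[X in _ * X]mulr_natl mulKf// pnatr_eq0 -lt0n.
Qed.

(** The second moment is a double sum over pairs of draws: a diagonal pair contributes [p], an
    off-diagonal one [p ^+ 2]. The variance is [p * (1 - p) / n], and the factor [1 - p] is
    dropped. *)
Lemma iid_freq_var A : measurable A ->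
  \int[Pr]_w (iid_freq A w - pr mu A) ^+ 2 <= pr mu A / n%:R.
Proof.
move=> mA; set p := pr mu A.
have mX i : measurable (X i @^-1` A) by exact: measurable_preimage_iid.
have nn0 : n%:R != 0 :> R by rewrite pnatr_eq0 -lt0n.
pose S w : R := \sum_i \sum_j \1_(X i @^-1` A `&` X j @^-1` A) w.
have iS : Pr.-integrable setT (EFin \o S).
  apply: (bounded_integrable Pr (M := n%:R * n%:R)) => [|w].
    apply: measurable_sum => i; apply: measurable_sum => j.
    by apply: measurable_indic; exact: measurableI.
  rewrite ger0_norm; last by apply: sumr_ge0 => i _; apply: sumr_ge0.
  rewrite -[X in X%:R * _]card_ord -sum1_card natr_sum mulr_suml.
  apply: ler_sum => i _; rewrite mul1r -[X in _ <= X%:R]card_ord -sum1_card natr_sum.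
  by apply: ler_sum => j _; rewrite indicE; case: (_ \in _).
have IS : \int[Pr]_w S w = n%:R * p + n%:R * (n%:R - 1) * p ^+ 2.
  rewrite /S Rintegral_sum; last first.
    move=> i; have := @integrable_sum _ _ _ Pr setT measurableT _ (index_enum 'I_n) xpredT
      (fun j => EFin \o (\1_(X i @^-1` A `&` X j @^-1` A) : Om -> R)).
    move=> H; have {}H := H (fun j _ => integrable_indicT (measurableI _ _ (mX i) (mX j))).
    by apply: eq_integrable H => // w _; rewrite /= sumEFin.
  rewrite (eq_bigr (fun=> p + (n%:R - 1) * p ^+ 2)).
    by rewrite sumr_const card_ord -[LHS]mulr_natl mulrDr mulrA.
  move=> i _; rewrite Rintegral_sum; last first.
    by move=> j; apply: integrable_indicT; exact: measurableI.
  rewrite (bigD1 i)//= setIid Rintegral_indic_pr// pr_iid//; congr (_ + _).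
  rewrite (eq_bigr (fun=> p ^+ 2)); last first.
    move=> j ji; rewrite Rintegral_indic_pr ?pr_iid2//; last exact: measurableI.
    by rewrite eq_sym.
  rewrite sumr_const -[LHS]mulr_natl; congr (_ * _).
  have := cardC1 i; rewrite card_ord => ->.
  by rewrite -subn1 natrB.
have E w : (iid_freq A w - p) ^+ 2 =
    (n%:R^-1 ^+ 2 * S w + (- (2 * p)) * iid_freq A w) + p ^+ 2.
  rewrite sqrrB {1}iid_freqE exprMn /S; congr (_ + _).
  rewrite mulNr; congr (_ * _ - _); last by ring.
  rewrite expr2 big_distrlr/=; apply: eq_bigr => i _; apply: eq_bigr => j _.
  by rewrite indicI.
under eq_Rintegral do rewrite E.
have i1 : Pr.-integrable setT (EFin \o (fun w => n%:R^-1 ^+ 2 * S w)).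
  exact: (integrableZl measurableT (n%:R^-1 ^+ 2) iS).
have i2 : Pr.-integrable setT (EFin \o (fun w => - (2 * p) * iid_freq A w)).
  exact: (integrableZl measurableT (- (2 * p)) (integrable_iid_freq mA)).
rewrite RintegralD//; last 2 first.
- exact: (integrableD measurableT i1 i2).
- exact: integrable_cstT.
rewrite RintegralD// Rintegral_cstT !RintegralZl//; last exact: integrable_iid_freq.
rewrite Rintegral_iid_freq// IS -/p.
have -> : n%:R^-1 ^+ 2 * (n%:R * p + n%:R * (n%:R - 1) * p ^+ 2) +
    - (2 * p) * p + p ^+ 2 = p / n%:R - p ^+ 2 / n%:R by field.
by rewrite gerDl oppr_le0 divr_ge0 ?sqr_ge0.
Qed.

(* The weight [th] optimises |a| <= (a^2 / th + th) / 2. *)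
Lemma iid_freq_dev (V : finType) (lab : T -> V) : labelling lab ->
  let f w := \sum_v `|iid_freq (lab @^-1` [set v]) w - weight lab mu v| in
  Pr.-integrable setT (EFin \o f) /\
  \int[Pr]_w f w <= Num.sqrt (#|V|%:R / n%:R).
Proof.
move=> mlab f.
have nn0 : 0 < n%:R :> R by rewrite ltr0n.
have V0 : 0 < #|V|%:R :> R.
  by rewrite ltr0n; apply/card_gt0P; exists (lab point).
pose g v w := iid_freq (lab @^-1` [set v]) w - weight lab mu v.
have mg v : measurable_fun setT (g v).
  by apply: measurable_funB => //; exact: measurable_iid_freq.
have g1 v w : `|g v w| <= 1.
  rewrite ler_norml /g; have /andP[? ?] := iid_freq01 (lab @^-1` [set v]) w.
  have := weight_ge0 lab mu v; have := pr_le1 mu (mlab v); rewrite -/(weight lab mu v).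
  by move=> *; apply/andP; split; lra.
have ifv v : Pr.-integrable setT (EFin \o (fun w => `|g v w|)).
  apply: (bounded_integrable Pr (M := 1)) => [|w].
    exact: measurableT_comp.
  by rewrite normr_id.
have igv v : Pr.-integrable setT (EFin \o (fun w => g v w ^+ 2)).
  apply: (bounded_integrable Pr (M := 1)) => [|w].
    exact: measurable_funX.
  by rewrite normrX exprn_ile1.
have iif : Pr.-integrable setT (EFin \o f).
  have := @integrable_sum _ _ _ Pr setT measurableT _ (index_enum V) xpredT
      (fun v => EFin \o (fun w => `|g v w|)) (fun v _ => ifv v).
  by apply: eq_integrable => // w _; rewrite /= sumEFin.
split=> //; set q := #|V|%:R / n%:R.
pose th : R := (Num.sqrt (#|V|%:R * n%:R))^-1.
have th0 : 0 < th by rewrite invr_gt0 sqrtr_gt0 mulr_gt0.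
rewrite /f Rintegral_sum//.
apply: (@le_trans _ _ (\sum_v (weight lab mu v / n%:R / th + th) / 2)).
  apply: ler_sum => v _.
  have j1 : Pr.-integrable setT (EFin \o (fun w => th^-1 / 2 * g v w ^+ 2)).
    exact: (integrableZl measurableT (th^-1 / 2) (igv v)).
  have j2 := integrable_cstT Pr (th / 2).
  apply: (@le_trans _ _ (\int[Pr]_w ((th^-1 / 2) * g v w ^+ 2 + th / 2))).
    apply: le_Rintegral => //.
    - exact: ifv.
    - exact: (integrableD measurableT j1 j2).
    - move=> w _; rewrite -/(g v w) -subr_ge0.
      have -> : th^-1 / 2 * g v w ^+ 2 + th / 2 - `|g v w| =
          (th^-1 / 2) * (`|g v w| - th) ^+ 2.
        rewrite -(real_normK (num_real (g v w))).
        by move: `|g v w| => a; field; exact: lt0r_neq0.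
      by rewrite mulr_ge0 ?sqr_ge0// divr_ge0// invr_ge0 ltW.
  rewrite RintegralD// Rintegral_cstT RintegralZl//.
  have t2 : 0 <= th^-1 / 2 by rewrite divr_ge0// invr_ge0 ltW.
  have := ler_wpM2l t2 (iid_freq_var (mlab v)).
  rewrite -/(weight lab mu v) /g => H; apply: (le_trans (lerD H (lexx _))).
  by rewrite le_eqVlt; apply/orP; left; apply/eqP; ring.
rewrite -mulr_suml big_split/= -!mulr_suml sum_pr_labellingT// mul1r.
have -> : \sum_(v : V) th = #|V|%:R * th by rewrite sumr_const mulr_natl.
have sq0 : 0 < Num.sqrt (#|V|%:R / n%:R : R) by rewrite sqrtr_gt0 divr_gt0.
have E1 : n%:R^-1 / th = Num.sqrt q.
  rewrite /th invrK /q !sqrtrM ?ler0n// sqrtrV ?ler0n//.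
  rewrite mulrCA; congr (_ * _).
  rewrite -{1}(@sqr_sqrtr _ n%:R) ?ler0n//; field.
  by rewrite gt_eqF ?sqrtr_gt0.
have E2 : #|V|%:R * th = Num.sqrt q.
  rewrite /th /q !sqrtrM ?ler0n// sqrtrV ?ler0n//.
  rewrite -{1}(@sqr_sqrtr _ #|V|%:R) ?ler0n//; field.
  by rewrite !gt_eqF ?sqrtr_gt0.
rewrite E1 E2 -/q; lra.
Qed.

End iid_moments.

(** * Multiscale bound *)

Section chaining.
Context (R : realType) (d : measure_display) (T : measurableType d).
Variable dist : T -> T -> R.
Hypothesis tb : totally_bounded_pmetric dist.
Implicit Types mu nu : probability T R.
Variables (D : R) (HD : forall x y, dist x y <= D).
Variables (V : nat -> finType) (idx : forall j, T -> V j)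
  (y : forall j, V j -> T).
Arguments y : clear implicits.
Hypothesis midx : forall j, labelling (idx j).

(* The label of scale [j] is read off the representative point of the label of
   scale [j - 1], so that the labels form a tree. *)
Fixpoint tree_label (j : nat) (x : T) : V j :=
  if j is j'.+1 then idx j'.+1 (y j' (tree_label j' x)) else idx 0 x.

Definition parent j (v : V j) : V j.+1 := idx j.+1 (y j v).

Lemma labelling_tree_label j : labelling (@tree_label j).
Proof.
elim: j => [|j IH] /=; first exact: midx.
exact: (labelling_comp (@parent j) IH).
Qed.

Lemma weight_parent mu j w : weight (@tree_label j.+1) mu w =
  \sum_(v | parent v == w) weight (@tree_label j) mu v.
Proof. by rewrite /weight -pr_labelling_comp//; exact: labelling_tree_label. Qed.

Variable eps : nat -> R.
Hypothesis Heps : forall j v,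
  dist (y j v) (y j.+1 (parent v)) <= eps j.+1.

Definition discrepancy mu nu j : R :=
  \sum_v `|weight (@tree_label j) mu v - weight (@tree_label j) nu v|.

(** Each refinement by one scale is a [transport_push] along [parent]: only the discrepancy at scale
    [j] is moved, and only over the distance [eps j.+1] between a cell and its parent. *)
Lemma transport_tree mu nu J k e :
  transport (fun a b => dist (y J a) (y J b))
    (weight (@tree_label J) mu) (weight (@tree_label J) nu) k -> 0 < e ->
  transport (fun a b => dist (y 0 a) (y 0 b))
    (weight (@tree_label 0) mu) (weight (@tree_label 0) nu)
    (k + \sum_(j < J) eps j.+1 * discrepancy mu nu j + e).
Proof.
elim: J k e => [|J IH] k e tr e0.
  by apply: transport_le tr => //; rewrite big_ord0 addr0 lerDl ltW.
have e20 : 0 < e / 2 by rewrite divr_gt0.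
have tr' : transport (fun a b => dist (y J.+1 a) (y J.+1 b))
    (fun w => \sum_(v | parent v == w) weight (@tree_label J) mu v)
    (fun w => \sum_(v | parent v == w) weight (@tree_label J) nu v) k.
  by apply: transport_eq tr => w; rewrite weight_parent.
have := @transport_push _ _ _ _ dist D (y J) (y J.+1) (@parent J)
  (weight (@tree_label J) mu) (weight (@tree_label J) nu) _ _ (pmetric_refl tb) (pmetric_sym tb)
  (pmetric_tri tb) (pmetric_ge0 tb) HD (weight_ge0 _ _) (weight_ge0 _ _) tr' e20.
move=> /IH /(_ e20); apply: transport_le => //.
rewrite big_ord_recr/=.
set S := \sum_(j < J) _.
have : \sum_v `|weight (@tree_label J) mu v - weight (@tree_label J) nu v| *
    dist (y J v) (y J.+1 (parent v)) <= eps J.+1 * discrepancy mu nu J.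
  rewrite /discrepancy mulr_sumr; apply: ler_sum => v _.
  by rewrite mulrC ler_wpM2r.
lra.
Qed.

(** The three terms are the mass exchanged between the coarsest cells at the maximal cost [D], the
    moves between successive scales, and the displacement inside the finest cells. *)
Lemma w1_le_discrepancy mu nu J (del : V 0 -> R) :
  (forall x, dist x (y 0 (idx 0 x)) <= del (idx 0 x)) ->
  w1 dist mu nu <= D * discrepancy mu nu J
    + \sum_(j < J) eps j.+1 * discrepancy mu nu j
    + \sum_v (weight (idx 0) mu v + weight (idx 0) nu v) * del v.
Proof.
move=> Hdel; apply/ler_addgt0Pl => e e0.
have e20 : 0 < e / 2 by rewrite divr_gt0.
have T1 : transport (fun a b : unit => dist point point)
    (fun w => \sum_(v | tt == w) weight (@tree_label J) mu v)
    (fun w => \sum_(v | tt == w) weight (@tree_label J) nu v) 0.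
  have R1 : transport (fun a b : unit => dist point point) (fun=> 1) (fun=> 1) 0.
    by apply: transport_refl => // v; rewrite (pmetric_refl tb).
  by apply: transport_eq R1 => -[]; rewrite eqxx/= sum_pr_labellingT//;
    exact: labelling_tree_label.
have T2 := @transport_push _ _ _ _ dist D (y J) (fun=> point) (fun=> tt)
  (weight (@tree_label J) mu) (weight (@tree_label J) nu) _ _ (pmetric_refl tb) (pmetric_sym tb)
  (pmetric_tri tb) (pmetric_ge0 tb) HD (weight_ge0 _ _) (weight_ge0 _ _) T1 e20.
have T3 : transport (fun a b => dist (y J a) (y J b))
    (weight (@tree_label J) mu) (weight (@tree_label J) nu)
    (D * discrepancy mu nu J + e / 2).
  apply: transport_le T2 => //; rewrite add0r lerD2r /discrepancy mulr_sumr.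
  by apply: ler_sum => v _; rewrite mulrC ler_wpM2r.
have T4 := transport_tree T3 e20.
have := wass1_le_transport tb (@midx 0%N) Hdel T4.
rewrite (wass1E tb) lee_fin => /le_trans; apply.
rewrite /weight; set S := \sum_(j < J) _; set S' := \sum_v _; lra.
Qed.

End chaining.

Section mean_le.
Context (R : realType) (d : measure_display) (T : measurableType d)
  (P : probability T R).

(** Integrability is included because [f] serves as the majorant of a function not known to be
    measurable (see [mean_le_integral]). *)
Definition mean_le (f : T -> R) (b : R) : Prop :=
  P.-integrable setT (EFin \o f) /\ \int[P]_x f x <= b.

Lemma mean_le_cst r : mean_le (fun=> r) r.
Proof. by split; [exact: integrable_cstT|rewrite Rintegral_cstT]. Qed.

Lemma mean_leD f g a b : mean_le f a -> mean_le g b ->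
  mean_le (fun x => f x + g x) (a + b).
Proof.
move=> [i1 f1] [i2 g2]; split; first exact: (integrableD measurableT i1 i2).
by rewrite RintegralD// lerD.
Qed.

Lemma mean_leZ f a k : 0 <= k -> mean_le f a -> mean_le (fun x => k * f x) (k * a).
Proof.
move=> k0 [i1 f1]; split; first exact: (integrableZl measurableT k i1).
by rewrite RintegralZl// ler_wpM2l.
Qed.

Lemma mean_le_sum (I : Type) (s : seq I) (p : pred I) (f : I -> T -> R) (a : I -> R) :
  (forall i, p i -> mean_le (f i) (a i)) ->
  mean_le (fun x => \sum_(i <- s | p i) f i x) (\sum_(i <- s | p i) a i).
Proof.
move=> H; elim: s => [|i s IH].
  rewrite (_ : (fun _ => _) = fun=> 0) ?big_nil; first exact: mean_le_cst.
  by apply/funext => x; rewrite big_nil.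
rewrite big_cons (_ : (fun _ => _) =
  (fun x => if p i then f i x + \sum_(j <- s | p j) f j x else \sum_(j <- s | p j) f j x)).
  by case: ifPn => // /H Hi; exact: mean_leD.
by apply/funext => x; rewrite big_cons.
Qed.

Lemma mean_le_integral (h : T -> \bar R) (f : T -> R) b :
  (forall x, 0 <= h x)%E -> (forall x, h x <= (f x)%:E)%E -> mean_le f b ->
  (\int[P]_x h x <= b%:E)%E.
Proof.
move=> h0 hf [i1 f1]; apply: le_trans (integral_le_Rintegral h0 hf i1) _.
by rewrite lee_fin.
Qed.

End mean_le.

Lemma labelling_bool (d : measure_display) (T : measurableType d) (A : set T) :
  measurable A -> labelling (fun x => `[< A x >]).
Proof.
move=> mA [].
  rewrite [X in measurable X](_ : _ = A)//.
  by apply/seteqP; split=> x /= /asboolP.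
rewrite [X in measurable X](_ : _ = ~` A); first exact: measurableC.
by apply/seteqP; split=> x /=; [move=> /asboolPn|move=> ?; apply/asboolPn].
Qed.

Section multiscale.
Context (R : realType) (d : measure_display) (T : measurableType d).
Variable dist : T -> T -> R.
Hypothesis tb : totally_bounded_pmetric dist.
Variables (D : R) (HD : forall x y, dist x y <= D).
Variables (m : nat -> nat) (C : forall j, 'I_(m j) -> set T) (S : set T)
  (eps : nat -> R).
Hypothesis mC : forall j i, measurable (@C j i).
Hypothesis mS : measurable S.
Hypothesis eps0 : forall j, 0 <= eps j.
Hypothesis HC : forall j i x y, @C j i x -> C i y -> dist x y <= eps j.
Hypothesis SC : forall j x, S x -> exists i, @C j i x.

Let V j : finType := option 'I_(m j).

(** The sets [C j i] may overlap; selecting one that contains the point makes a partition of [S].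
    The additional label [None] collects the complement of [S]. *)
Let idx j (x : T) : V j :=
  if `[< S x >] then [pick i | `[< @C j i x >]] else None.

(* Outside [S] every scale uses the label [None], represented by [point]. *)
Let y j (v : V j) : T :=
  if v is Some _ then xget point [set x | idx j x = v] else point.

Let midx j : labelling (idx j).
Proof.
have m1 := labelling_bool mS.
have m2 : labelling (fun x => [ffun i => `[< @C j i x >]]).
  by apply: labelling_ffun => i; exact: labelling_bool.
have := labelling_comp (fun p : bool * {ffun 'I_(m j) -> bool} =>
  if p.1 then [pick i | p.2 i] else None) (labelling_pair m1 m2).
rewrite (_ : _ \o _ = idx j)//; apply/funext => x; rewrite /idx/=.
by case: ifP => // _; apply: eq_pick => i; rewrite ffunE.
Qed.

Let idx_in j x : S x -> exists2 i, idx j x = Some i & C i x.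
Proof.
move=> Sx; rewrite /idx asboolT//; case: pickP => [i /asboolP Ci|H].
  by exists i.
by have [i Ci] := SC j Sx; have := H i; rewrite asboolT.
Qed.

Let idx_some j x i : idx j x = Some i -> S x /\ C i x.
Proof.
rewrite /idx; case: asboolP => // Sx; case: pickP => // i' /asboolP Ci [<-].
by split.
Qed.

Let near j x : S x -> dist x (y (idx j x)) <= eps j.
Proof.
move=> Sx; have [i ix Ci] := idx_in j Sx.
rewrite ix /y; case: xgetP => [z _ /= /idx_some[_ Cz]|/(_ x)]; first exact: HC Ci Cz.
by rewrite /= ix.
Qed.

Let Heps j (v : V j) : dist (y v) (y (parent idx y v)) <= eps j.+1.
Proof.
(* A representative outside [S] can only be [point], whose label is then [None], again represented
   by [point]: it does not move. *)
rewrite /parent; have [Sy|nSy] := pselect (S (y (v : V j))); first exact: near.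
have -> : idx j.+1 (y v) = None by rewrite /idx asboolF.
have -> : y v = point.
  move: nSy; rewrite /y; case: v => // i; case: xgetP => // z _ /= /idx_some[Sz _].
  by move=> /(_ Sz).
by rewrite (pmetric_refl tb).
Qed.

(** The successor in [(m j).+1] counts the label [None]. The last term gives radius [D] to the
    complement of [S], whose empirical and true masses have the same mean. *)
Lemma multiscale_bound (d' : measure_display) (Om : measurableType d')
    (Pr : probability Om R) (mu : probability T R) (n : nat)
    (X : 'I_n -> Om -> T) (J : nat) :
  (0 < n)%N -> iid_sample Pr mu X ->
  (\int[Pr]_w wass1 (fun x y => (dist x y)%:E)
      (empirical_measure R (iid_seq X w)) mu <=
   (D * Num.sqrt ((m J).+1%:R / n%:R)
    + \sum_(j < J) eps j.+1 * Num.sqrt ((m j).+1%:R / n%:R)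
    + (2 * eps 0 + D * (2 * (1 - pr mu S))))%:E)%E.
Proof.
move=> n0 iid.
have D0 : 0 <= D by apply: le_trans (HD point point); rewrite (pmetric_refl tb).
pose del (v : V 0) := if v is Some _ then eps 0 else D.
have Hdel x : dist x (y (idx 0 x)) <= del (idx 0 x).
  rewrite /del; case E : (idx 0 x) => [i|]; last exact: HD.
  by rewrite -E; apply: near; have [] := idx_some E.
pose emp w := empirical_measure R (iid_seq X w).
have mlab j : labelling (@tree_label _ _ _ idx y j).
  exact: labelling_tree_label.
have disc j : mean_le Pr (fun w => discrepancy idx y (emp w) mu j)
    (Num.sqrt ((m j).+1%:R / n%:R)).
  have [h1 h2] := iid_freq_dev iid n0 (mlab j).
  split; first exact: h1.
  by move: h2; rewrite card_option card_ord.
have noneE : idx 0 @^-1` [set None] = ~` S.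
  apply/seteqP; split=> x /=; last by move=> nS; rewrite /idx asboolF.
  by move=> xN Sx; have [i ix _] := idx_in 0 Sx; move: xN; rewrite ix.
pose f w := D * discrepancy idx y (emp w) mu J
    + \sum_(j < J) eps j.+1 * discrepancy idx y (emp w) mu j
    + (2 * eps 0 + D * (iid_freq R X (~` S) w + pr mu (~` S))).
apply: (@mean_le_integral _ _ _ Pr _ f).
- by move=> w; exact: wass1_ge0.
- move=> w; rewrite (wass1E tb) lee_fin.
  apply: (le_trans (w1_le_discrepancy tb HD midx Heps (emp w) mu J Hdel)).
  rewrite /f lerD2l (bigD1 None)//= addrC lerD//.
    apply: (@le_trans _ _ (\sum_(v : V 0)
        (weight (idx 0) (emp w) v + weight (idx 0) mu v) * eps 0)).
      rewrite [leRHS](bigD1 None)//= ler_wpDl//.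
        by rewrite mulr_ge0// addr_ge0// weight_ge0.
      by apply: ler_sum => -[i|].
    by rewrite sum_weight2.
  by rewrite /weight noneE mulrC.
apply: mean_leD.
  apply: mean_leD; first exact: mean_leZ.
  by apply: mean_le_sum => j _; exact: mean_leZ.
apply: mean_leD; first exact: mean_le_cst.
apply: mean_leZ => //.
have mS' : measurable (~` S) by exact: measurableC.
have -> : 2 * (1 - pr mu S) = pr mu (~` S) + pr mu (~` S).
  by rewrite pr_setC//; lra.
apply: mean_leD; last exact: mean_le_cst.
by split; [exact: (integrable_iid_freq iid n0 mS')|rewrite (Rintegral_iid_freq iid n0 mS')].
Qed.

End multiscale.

(** * Rate of convergence from covering numbers *)

Lemma dyadic_scale (R : realType) (b B : R) : 0 < b -> b <= B ->
  exists J : nat, 2 ^+ J * b <= B < 2 ^+ J.+1 * b.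
Proof.
move=> b0 bB.
have ex0 : exists J, (fun J => 2 ^+ J * b <= B) J.
  by exists 0%N; rewrite expr0 mul1r.
have B0 : 0 <= B / b by rewrite divr_ge0 ?(ltW b0)// (le_trans (ltW b0)).
have ub J : 2 ^+ J * b <= B -> (J <= Num.bound (B / b))%N.
  rewrite -ler_pdivlMr// => JB; rewrite -(ler_nat R) ltW//.
  apply: le_lt_trans (archi_boundP B0); apply: le_trans JB.
  rewrite -natrX ler_nat; exact/ltnW/ltn_expl.
exists (ex_maxn ex0 ub); case: ex_maxnP => J -> maxJ /=.
by rewrite ltNge; apply/negP => /maxJ; rewrite ltnn.
Qed.

Lemma geometric_sum_le (R : realType) (rho : R) J : 0 <= rho -> rho < 1 ->
  \sum_(j < J) rho ^+ j <= (1 - rho)^-1.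
Proof.
move=> r0 r1; have r10 : 0 < 1 - rho by rewrite subr_gt0.
rewrite -(ler_pM2r r10) mulVf ?gt_eqF// mulrC.
have := subrXX 1 rho J; rewrite expr1n.
under [X in _ = _ * X]eq_bigr do rewrite expr1n mul1r.
by move=> <-; rewrite gerBl exprn_ge0.
Qed.

Lemma sum_expr2_le (R : realType) J : \sum_(j < J.+1) 2 ^+ j <= 2 * 2 ^+ J :> R.
Proof.
elim: J => [|J IH]; first by rewrite big_ord1 expr0 mulr1 ler1n.
rewrite big_ord_recr/=; apply: (le_trans (lerD IH (lexx _))).
by rewrite exprS; lra.
Qed.

Lemma sqrtr_exp (R : rcfType) (x : R) j : 0 <= x ->
  Num.sqrt (x ^+ j) = Num.sqrt x ^+ j.
Proof.
move=> x0; elim: j => [|j IH]; first by rewrite !expr0 sqrtr1.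
by rewrite !exprS sqrtrM// IH.
Qed.

Section union_bound.
Context (R : realType) (d : measure_display) (T : measurableType d)
  (mu : probability T R).

Lemma pr_setI_ge (A B : set T) : measurable A -> measurable B ->
  1 - pr mu (A `&` B) <= (1 - pr mu A) + (1 - pr mu B).
Proof.
move=> mA mB.
have mAB : measurable (A `&` ~` B) by apply: measurableI => //; exact: measurableC.
have H : pr mu A = pr mu (A `&` B) + pr mu (A `&` ~` B).
  apply: EFin_inj; rewrite EFinD -!prE//; last exact: measurableI.
  rewrite -measureU//; last 2 first.
  - exact: measurableI.
  - by apply/seteqP; split=> // x [[_ Bx] [_ nBx]]; exact: nBx.
  by rewrite -setIUr setUv setIT.
have : pr mu (A `&` ~` B) <= pr mu (~` B).
  by apply: pr_le => //; exact: measurableC.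
rewrite pr_setC//; lra.
Qed.

Lemma pr_bigcap_ge (U : nat -> set T) k : (forall j, measurable (U j)) ->
  let S := [set x | forall j, (j < k)%N -> U j x] in
  measurable S /\ 1 - pr mu S <= \sum_(j < k) (1 - pr mu (U j)).
Proof.
move=> mU /=; elim: k => [|k [mS IH]].
  rewrite big_ord0 [X in measurable X](_ : _ = setT); last first.
    by apply/seteqP; split=> x.
  rewrite [X in pr mu X](_ : _ = setT); last by apply/seteqP; split=> x.
  by rewrite pr_setT subrr.
have -> : [set x | forall j, (j < k.+1)%N -> U j x] =
    [set x | forall j, (j < k)%N -> U j x] `&` U k.
  apply/seteqP; split=> x.
    by move=> H; split; [move=> j jk; apply: H; exact: ltnW|exact: H].
  by move=> [H Uk] j; rewrite ltnS leq_eqVlt => /orP[/eqP ->//|]; exact: H.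
split; first exact: measurableI.
by rewrite big_ord_recr/=; apply: (le_trans (pr_setI_ge _ _)) => //; rewrite lerD2r.
Qed.

End union_bound.

Section rate.
Context (R : realType) (d : measure_display) (T : measurableType d).
Variable dist : T -> T -> R.
Hypothesis tb : totally_bounded_pmetric dist.

(* The exponent [r / (r - 2)] is the one for which the exceptional sets of the
   dyadic scales from [n^(- 1 / r)] up to [n^(- (r - 2) / r^2)], the scales used
   for samples of size [n], have total mass of order [n^(- 1 / r)]. *)
Definition covered_at (mu : probability T R) (A r e : R) : Prop :=
  exists (m : nat) (C : 'I_m -> set T),
    [/\ forall i, measurable (C i), forall i x y, C i x -> C i y -> dist x y <= e,
      m%:R <= A * e `^ (- r) &
      1 - e `^ (r / (r - 2)) <= pr mu (\bigcup_i C i)].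

Lemma empirical_rate (A r e0 : R) : 2 < r -> 0 < A -> 0 < e0 ->
  exists c : R, forall mu : probability T R,
    (forall e, 0 < e -> e <= e0 -> covered_at mu A r e) ->
    forall n, (0 < n)%N ->
      empirical_bound (fun x y => (dist x y)%:E) mu n (c * n%:R `^ (- r^-1)).
Proof.
move=> r2 A0 e00.
have r0 : 0 < r by apply: lt_trans r2.
have r20 : 0 < r - 2 by rewrite subr_gt0.
have [D D0 HD] := pmetric_bounded tb.
have [D1 D10 HD1] := wass1_bounded tb.
pose e1 := Num.min e0 1.
have e10 : 0 < e1 by rewrite lt_min e00 ltr01.
have e11 : e1 <= 1 by rewrite ge_min lexx orbT.
pose al := r / (r - 2).
have al1 : 1 <= al by rewrite ler_pdivlMr// mul1r; lra.
have al0 : 0 < al by apply: lt_le_trans al1.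
(* Doubling the cell size multiplies the bound on the number of cells by [sig]. Hence [rho] is the
   ratio of successive terms of the multiscale sum, and it is below 1 because [2 < r]. *)
pose sig : R := 2 `^ (- r).
have sig0 : 0 <= sig by exact: powR_ge0.
pose rho := 2 * Num.sqrt sig.
have rho0 : 0 <= rho by rewrite mulr_ge0// sqrtr_ge0.
have rho1 : rho < 1.
  rewrite -(@ltr_pXn2r _ 2) ?nnegrE// expr1n exprMn sqr_sqrtr//.
  have -> : 2 ^+ 2 = 2 `^ 2 :> R by rewrite -powR_mulrn.
  rewrite -powRD; last by apply/implyP.
  rewrite (_ : 2 + - r = - (r - 2)); last by rewrite opprB.
  rewrite powRN invf_lt1 ?powR_gt0//.
  rewrite -[X in X < _](_ : 1 `^ (r - 2) = 1); last by rewrite powR1.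
  by apply: gt0_ltr_powR; rewrite ?nnegrE// ltr1n.
pose K := Num.sqrt (A + 1).
have K0 : 0 <= K by exact: sqrtr_ge0.
(* The summands pay for the coarsest scale, for the intermediate scales, and for the finest cells
   together with the exceptional set. The second part of [c] covers the samples too small for the
   coarsest scale to lie below [e1]. *)
pose c1 := D * (K * Num.sqrt (2 `^ r)) + 2 * K * (1 - rho)^-1 + (2 + D * 4).
pose c := c1 + D1 * e1 `^ (- al).
have c10 : 0 <= c1.
  by rewrite !addr_ge0 ?mulr_ge0 ?sqrtr_ge0 ?invr_ge0 ?subr_ge0 ?(ltW D0) ?(ltW rho1).
have De0 : 0 <= D1 * e1 `^ (- al) by rewrite mulr_ge0 ?powR_ge0// ltW.
exists c => mu Hcov n n0 d' Om Pr X iid.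
pose b : R := n%:R `^ (- r^-1).
have nR0 : 0 < n%:R :> R by rewrite ltr0n.
have b0 : 0 < b by exact: powR_gt0.
have b1 : b <= 1.
  by rewrite /b -[leRHS](powRr0 n%:R) ler_powR ?ler1n// oppr_le0 invr_ge0 ltW.
have br : b `^ r = n%:R^-1.
  by rewrite /b -powRrM mulNr mulVf ?gt_eqF// powR_inv1 // ltW.
(* The upper limit for the scales, chosen so that the exceptional mass allowed at [B] is the target
   rate [b]. *)
pose B : R := b `^ ((r - 2) / r).
have Bal : B `^ al = b.
  rewrite /B -powRrM /al (_ : _ * _ = 1) ?powRr1 ?(ltW b0)//.
  by field; rewrite !gt_eqF.
have B0 : 0 < B by exact: powR_gt0.
have bB : b <= B.
  have r21 : (r - 2) / r <= 1 by rewrite ler_pdivrMr// mul1r gerBl.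
  by apply: ger1_powR => //; apply/andP; split.
rewrite -/b.
(* If [B] exceeds [e1], then [b] exceeds the power [al] of [e1], and the trivial bound [D1] is
   already of order [b]. *)
have [Be|eB] := leP B e1; last first.
  apply: (@le_trans _ _ D1%:E).
    apply: (@mean_le_integral _ _ _ Pr _ (fun=> D1)); last exact: mean_le_cst.
      by move=> w; exact: wass1_ge0.
    by move=> w; exact: HD1.
  rewrite lee_fin /c mulrDl ler_wpDl ?mulr_ge0 ?(ltW b0)//.
  rewrite -mulrA -[leLHS]mulr1 ler_wpM2l ?(ltW D10)//.
  rewrite powRN mulrC ler_pdivlMr ?powR_gt0// mul1r -Bal.
  by apply: ge0_ler_powR; rewrite ?nnegrE ?ltW.
have [J /andP[J1 J2]] := dyadic_scale b0 bB.
(* The cap at [J] repeats the coarsest scale for ever, so that the hypotheses of the multiscale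
   bound hold at every index. *)
pose eps j := 2 ^+ (minn j J) * b.
have eps0 j : 0 < eps j by rewrite mulr_gt0// exprn_gt0.
have epsJ j : eps j <= 2 ^+ J * b.
  by rewrite ler_pM2r// ler_weXn2l ?ler1n// geq_minr.
have epse j : eps j <= e0.
  by apply: (le_trans (epsJ j)); apply: (le_trans J1); apply: (le_trans Be);
    rewrite ge_min lexx.
have eps1 j : eps j <= 1.
  by apply: (le_trans (epsJ j)); apply: (le_trans J1); apply: le_trans e11.
have {Hcov} [m Hm] := choice (fun j => Hcov (eps j) (eps0 j) (epse j)).
pose C j := projT1 (cid (Hm j)).
have HC j : [/\ forall i, measurable (C j i),
      forall i x y, C j i x -> C j i y -> dist x y <= eps j,
      (m j)%:R <= A * eps j `^ (- r) &
      1 - eps j `^ al <= pr mu (\bigcup_i C j i)] by exact: (projT2 (cid (Hm j))).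
have mC j i : measurable (C j i) by have [] := HC j.
pose U j := \bigcup_i C j i.
have mU j : measurable (U j).
  by apply: fin_bigcup_measurable => //; exact: finite_finset.
have [mS HS] := pr_bigcap_ge mu J.+1 mU.
set S := [set x | _] in mS HS.
have SC j x : S x -> exists i, C (minn j J) i x.
  by move=> /(_ (minn j J)); rewrite ltnS geq_minr => /(_ isT) [i _ Ci]; exists i.
have HCd j i x y : C (minn j J) i x -> C (minn j J) i y -> dist x y <= eps j.
  have -> : eps j = eps (minn j J) by rewrite /eps -minnA minnn.
  by have [_ H _ _] := HC (minn j J); exact: H.
have := multiscale_bound tb HD (fun j => mC (minn j J)) mS
  (fun j => ltW (eps0 j)) HCd SC J n0 iid.
move=> /le_trans; apply; rewrite lee_fin.
have epsr j : (j <= J)%N -> eps j `^ (- r) / n%:R = sig ^+ j.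
  move=> jJ; rewrite /eps (minn_idPl jJ) powRM ?exprn_ge0 ?(ltW b0)//.
  rewrite -br -mulrA -powRD ?addNr ?powRr0 ?mulr1; last by apply/implyP => _; exact: lt0r_neq0.
  by rewrite -powR_mulrn// powRAC powR_mulrn// powR_ge0.
have card j : (j <= J)%N ->
    Num.sqrt ((m (minn j J)).+1%:R / n%:R) <= K * Num.sqrt sig ^+ j.
  move=> jJ; rewrite (minn_idPl jJ).
  have -> : K * Num.sqrt sig ^+ j = Num.sqrt ((A + 1) * sig ^+ j).
    by rewrite sqrtrM ?addr_ge0 ?(ltW A0)// /K sqrtr_exp.
  rewrite ler_wsqrtr// -epsr// mulrA ler_pM2r ?invr_gt0//.
  rewrite -natr1 mulrDl mul1r lerD//; first by have [] := HC j.
  rewrite powRN invf_ge1 ?powR_gt0// -[leRHS](_ : 1 `^ r = 1); last by rewrite powR1.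
  by apply: ge0_ler_powR; rewrite ?nnegrE// ltW.
(* Since [1 <= al], the exceptional mass at scale [j] is at most [2 ^+ j / 2 ^+ J] times that
   allowed at [B], which is [b]; the geometric sum is at most twice its last term. *)
have tau : 1 - pr mu S <= 2 * b.
  apply: (le_trans HS); apply: (@le_trans _ _ (\sum_(j < J.+1) 2 ^+ j * (b / 2 ^+ J))).
    apply: ler_sum => j _; have [_ _ _] := HC j.
    rewrite lerBlDr addrC -lerBlDr => /le_trans; apply.
    have jJ : (j <= J)%N by rewrite -ltnS.
    have -> : eps j = 2 ^+ j / 2 ^+ J * (2 ^+ J * b).
      by rewrite /eps (minn_idPl jJ); field; rewrite expf_neq0.
    apply: (@le_trans _ _ (2 ^+ j / 2 ^+ J * (2 ^+ J * b) `^ al)).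
      apply: ge1r_powRZ => //; last by rewrite mulr_ge0 ?exprn_ge0// ltW.
      rewrite divr_gt0 ?exprn_gt0//= ler_pdivrMr ?exprn_gt0// mul1r.
      by rewrite ler_weXn2l ?ler1n.
    have -> : 2 ^+ j * (b / 2 ^+ J) = 2 ^+ j / 2 ^+ J * b by ring.
    rewrite ler_wpM2l//.
    rewrite -[leRHS]Bal; apply: ge0_ler_powR; rewrite ?nnegrE ?(ltW al0) ?(ltW B0)//.
    by apply: mulr_ge0; [exact: exprn_ge0|exact: ltW].
  rewrite -mulr_suml; apply: (@le_trans _ _ (2 * 2 ^+ J * (b / 2 ^+ J))).
    by rewrite ler_wpM2r ?sum_expr2_le// divr_ge0 ?exprn_ge0 ?ltW.
  by rewrite le_eqVlt; apply/orP; left; apply/eqP; field; rewrite expf_neq0.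
(* By maximality of [J], [2 ^+ J] is more than half of [B / b], and the power [r] of [b / B] is
   [b ^+ 2]; the factor 2 lost becomes the constant. *)
have top : Num.sqrt sig ^+ J <= Num.sqrt (2 `^ r) * b.
  have -> : Num.sqrt (2 `^ r) * b = Num.sqrt (2 `^ r * b ^+ 2).
    by rewrite sqrtrM ?powR_ge0// sqrtr_sqr ger0_norm ?ltW.
  rewrite -sqrtr_exp// ler_wsqrtr//.
  have -> : b ^+ 2 = (b / B) `^ r.
    have -> : b / B = b `^ (1 - (r - 2) / r).
      by rewrite powRB ?powRr1 ?(ltW b0)//; apply/implyP => _; exact: lt0r_neq0.
    rewrite -powRrM (_ : _ * r = 2%:R) ?powR_mulrn ?(ltW b0)//.
    by field; rewrite gt_eqF.
  rewrite -powRM ?divr_ge0 ?(ltW b0) ?(ltW B0)//.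
  have -> : sig ^+ J = (2 ^+ J)^-1 `^ r.
    rewrite -powR_mulrn// /sig -powRAC powR_mulrn// powRN.
    by rewrite -[(2 ^+ J)^-1]powR_inv1 ?exprn_ge0// -powRrM mulN1r powRN.
  apply: ge0_ler_powR; rewrite ?nnegrE ?(ltW r0) ?invr_ge0 ?exprn_ge0//.
    by rewrite mulr_ge0// divr_ge0 ?ltW.
  rewrite mulrA ler_pdivlMr// mulrC ler_pdivrMr ?exprn_gt0//.
  by apply: (le_trans (ltW J2)); rewrite exprS mulrAC.
have sum : \sum_(j < J) eps j.+1 * Num.sqrt ((m (minn j J)).+1%:R / n%:R) <=
    2 * K * (1 - rho)^-1 * b.
  apply: (@le_trans _ _ (\sum_(j < J) 2 * K * b * rho ^+ j)).
    apply: ler_sum => j _.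
    apply: (@le_trans _ _ (eps j.+1 * (K * Num.sqrt sig ^+ j))).
      by rewrite ler_pM2l// card// ltnW.
    rewrite /eps (minn_idPl (ltn_ord j)) /rho exprMn exprS.
    by rewrite le_eqVlt; apply/orP; left; apply/eqP; ring.
  rewrite -mulr_sumr -!mulrA ler_wpM2l// ler_wpM2l// mulrC.
  by rewrite ler_wpM2r ?(ltW b0)// geometric_sum_le.
have e0b : eps 0 = b by rewrite /eps min0n expr0 mul1r.
have cardJ := card J (leqnn J).
have T1 : D * Num.sqrt ((m (minn J J)).+1%:R / n%:R) <= D * (K * Num.sqrt (2 `^ r)) * b.
  rewrite -mulrA ler_pM2l//; apply: (le_trans cardJ).
  by rewrite -mulrA ler_wpM2l.
have T2 : D * (2 * (1 - pr mu S)) <= D * 4 * b.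
  have -> : D * 4 * b = D * (2 * (2 * b)) by ring.
  by rewrite !ler_pM2l.
apply: (@le_trans _ _ (c1 * b)); last first.
  by rewrite ler_pM2r// /c lerDl.
have -> : c1 * b = D * (K * Num.sqrt (2 `^ r)) * b + 2 * K * (1 - rho)^-1 * b +
    (2 * b + D * 4 * b) by rewrite /c1; ring.
rewrite e0b; apply: lerD; first exact: (lerD T1 sum).
by rewrite lerD2l.
Qed.
End rate.

(** * From the dimension [dstar] to covers, and the rates for tasks and examples *)

Lemma lt_covering_number (R : realType) (N : \bar R) (e r : R) :
  0 < e -> e < 1 -> (lne N * ((ln e^-1)^-1)%:E < r%:E)%E ->
  (N < (2 * e `^ (- r))%:E)%E.
Proof.
move=> e0 e1.
have l0 : 0 < ln e^-1 by rewrite ln_gt0// invf_gt1.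
have p0 : 0 < e `^ (- r) by exact: powR_gt0.
case: N => [x| |] /=.
- case: ifPn => [x0 _|].
    by rewrite lte_fin; apply: le_lt_trans x0 _; rewrite mulr_gt0.
  rewrite -ltNge => x0; rewrite -EFinM !lte_fin ltr_pdivrMr// lnV// mulrN => H.
  apply: (@le_lt_trans _ _ (e `^ (- r))); last by rewrite ltr_pMl// ltr1n.
  have <- : expR (ln x) = x by rewrite lnK// posrE.
  by rewrite /powR gt_eqF// mulNr ler_expR ltW.
- by rewrite gt0_mulye// lte_fin invr_gt0.
- by move=> _; rewrite ltNyr.
Qed.

Lemma at_right0P (R : realType) (A : set R) : (0^'+ : set_system R) A ->
  exists2 del, 0 < del & forall e, 0 < e -> e < del -> A e.
Proof.
move=> /nbhs_ballP[del /= d0 H]; exists del => // e e0 ed; apply: H => //.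
by rewrite /ball/= sub0r normrN gtr0_norm.
Qed.

(* Compares the exponents of the exceptional mass in [covered_at] and [dstar]. *)
Lemma dstar_exponent_le (R : realType) (q r r' : R) : 1 < q -> 2 < r -> r < r' ->
  r' / (r' - 2) <= r * 1 * q / ((q - 1) * (r - 2 * 1)).
Proof.
move=> q1 r2 rr'; rewrite !mulr1.
have a : 0 < q - 1 by rewrite subr_gt0.
have b : 0 < r - 2 by rewrite subr_gt0.
have c : 0 < r' - 2 by rewrite subr_gt0 (lt_trans r2).
rewrite ler_pdivrMr// mulrAC ler_pdivlMr ?mulr_gt0//.
have : 0 <= 2 * q * (r' - r) + r' * (r - 2).
  by rewrite addr_ge0// !mulr_ge0// ?subr_ge0 ltW//; lra.
lra.
Qed.

Section rates.
Context (R : realType) (d : measure_display) (T : measurableType d).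
Variable dist : T -> T -> R.
Hypothesis tb : totally_bounded_pmetric dist.
Local Notation Dist := (fun x y => (dist x y)%:E).

Lemma measurable_closed_ball x e : measurable [set y | dist x y <= e].
Proof.
have m : measurable_fun setT (dist x).
  apply: (lipschitz_measurable tb (L := 1)) => y z; rewrite mul1r.
  have := pmetric_quad tb x y x z.
  by rewrite (pmetric_refl tb) add0r.
rewrite [X in measurable X](_ : _ = dist x @^-1` `]-oo, e]%classic).
  by rewrite -[X in measurable X]setTI; apply: m.
by apply/seteqP; split=> y; rewrite /= in_itv.
Qed.

(** The strict inequality leaves room for an admissible [r] below [r']. The upper limit at most [r]
    then bounds the logarithmic ratio by [r'] at every small [e], and [lt_covering_number] turns
    this into a cover, its slack factor being the constant 2. *)
Lemma dstar_covered (q r' : R) (mu : probability T R) : 1 < q ->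
  (dstar Dist 1 q mu < r'%:E)%E ->
  2 < r' /\ exists2 e0, 0 < e0 & forall e, 0 < e -> e <= e0 -> covered_at dist mu 2 r' e.
Proof.
move=> q1 /ereal_inf_lt[_ [r [r2 Hr] <-]]; rewrite lte_fin mulr1 in r2 * => rr'.
split; first exact: lt_trans rr'.
have : (limf_esup (fun e : R =>
        lne (covering_number_mass Dist mu e (e `^ (r * 1 * q / ((q - 1) * (r - 2 * 1)))))
        * ((ln e^-1)^-1)%:E) 0^'+ < r'%:E)%E.
  by apply: le_lt_trans Hr _; rewrite lte_fin.
move=> /ereal_inf_lt[_ [A /at_right0P[del d0 HA] <-]] supA.
exists (Num.min (del / 2) (1 / 2)); first by rewrite lt_min !divr_gt0.
move=> e e0; rewrite le_min => /andP[ed e1].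
have e1' : e < 1 by apply: le_lt_trans e1 _; rewrite ltr_pdivrMr// mul1r ltr1n.
have Ae : A e by apply: HA => //; apply: le_lt_trans ed _; rewrite ltr_pdivrMr//; lra.
have : (lne (covering_number_mass Dist mu e (e `^ (r * 1 * q / ((q - 1) * (r - 2 * 1)))))
        * ((ln e^-1)^-1)%:E < r'%:E)%E.
  by apply: le_lt_trans supA; apply: ereal_sup_ubound; exists e.
move=> /(lt_covering_number e0 e1') /ereal_inf_lt[_ [S [mS HS] <-]].
move=> /ereal_inf_lt[_ [m [c Sc] <-]]; rewrite lte_fin => mle.
exists m, (fun i => [set x | dist (c i) x <= e / 2]); split.
- by move=> i; exact: measurable_closed_ball.
- move=> i x y /= h1 h2; have := pmetric_tri tb x (c i) y.
  rewrite (pmetric_sym tb x (c i)); lra.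
- exact: ltW.
- apply: (@le_trans _ _ (pr mu S)).
    move: HS; rewrite prE// lee_fin; apply: le_trans.
    rewrite lerD2l lerN2; apply: ger_powR; first by rewrite e0 ltW.
    exact: dstar_exponent_le.
  apply: pr_le => //.
    apply: fin_bigcup_measurable => [|i _]; first exact: finite_finset.
    exact: measurable_closed_ball.
  by move=> x /Sc[i Hi]; exists i => //; rewrite /= -lee_fin.
Qed.

Lemma dstar_rate (q s : R) (mu : probability T R) : 1 < q ->
  (dstar Dist 1 q mu < s%:E)%E ->
  exists c : R, forall n, (0 < n)%N ->
    empirical_bound Dist mu n (c * n%:R `^ (- s^-1)).
Proof.
move=> q1 H; have [s2 [e0 e00 cov]] := dstar_covered q1 H.
have [c Hc] := empirical_rate tb s2 (ltr0Sn R 1) e00.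
by exists c; exact: Hc.
Qed.

End rates.

Section task_rates.
Context (R : realType) (dx dy : nat) (X : compact_dom R dx)
  (Y : compact_dom R dy).

Lemma dstar_task_rate (P : meta_distribution X Y) (q s : R) : 1 < q ->
  (meta_dstar 1 q P < s%:E)%E -> exists c, task_rate P s c.
Proof.
have E : @W1 R dx dy X Y = (fun r r' => (taskd r r')%:E).
  by apply/funext => r; apply/funext => r'; exact: W1E.
rewrite /meta_dstar /task_rate E.
by move=> q1 H; have := dstar_rate (totally_bounded_taskd X Y) q1 H.
Qed.

(** Grid cells cover the whole space, so there is no exceptional mass and the constant is uniform
    over all tasks. *)
Lemma sample_rate_exists : (3 <= dx + dy)%N -> exists c, sample_rate X Y c.
Proof.
move=> d3; have [K K0 HK] := zd_cells X Y.
have r2 : 2 < (dx + dy)%:R :> R by rewrite ltr_nat.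
have [c Hc] := empirical_rate (totally_bounded_zd X Y) r2 K0 ltr01.
exists c => rho; apply: Hc => e e0 e1.
have [V [lab [mlab H cV]]] := HK e e0 e1.
exists #|V|, (fun i => lab @^-1` [set enum_val i]); split.
- by move=> i; exact: mlab.
- by move=> i x y /= xi yi; apply: H; rewrite xi yi.
- by rewrite powRN powR_mulrn ?(ltW e0)// -exprVn.
- rewrite [X in pr _ X](_ : _ = setT).
    by rewrite pr_setT lerBlDr lerDl powR_ge0.
  apply/seteqP; split=> // x _; exists (enum_rank (lab x)) => //=.
  by rewrite enum_rankK.
Qed.

End task_rates.

(** * Expected distance of the contexts to the tasks *)

Section discrete_sample.
Context (R : realType) (d : measure_display) (T : measurableType d).
Variable dist : T -> T -> R.
Hypothesis tb : totally_bounded_pmetric dist.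

Variables (V : finType) (lab : T -> V) (c : V -> T) (e : R).
Hypothesis mlab : labelling lab.
Hypothesis ce : forall x, dist x (c (lab x)) <= e.
Hypothesis cK : forall x, lab (c (lab x)) = lab x.

Lemma w1_same_weight (mu nu : probability T R) :
  weight lab mu =1 weight lab nu -> w1 dist mu nu <= 2 * e.
Proof.
move=> E; have [D D0 HD] := pmetric_bounded tb.
apply: (le_trans (w1_le_weight tb mu nu HD mlab ce)).
by rewrite big1 ?mulr0 ?add0r// => v _; rewrite E subrr normr0.
Qed.

(** An unattained label is represented by an arbitrary point of another cell; it is harmless because
    its weight is 0. *)
Lemma weight0_or_section (mu : probability T R) v :
  weight lab mu v = 0 \/ lab (c v) = v.
Proof.
have [[x <-]|nx] := pselect (exists x, lab x = v); first by right.
left; rewrite /weight [X in pr _ X](_ : _ = set0) /pr ?measure0//.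
by apply/seteqP; split=> // x xv; apply: nx; exists x.
Qed.

(** [r'] is the image of [r] under the choice of representatives. Being finitely supported, it has
    samples described by finitely many words. *)
Lemma discretization (r : probability T R) : exists r' : probability T R,
  (forall A, pr r' A = \sum_v weight lab r v * \1_A (c v)) /\ w1 dist r' r <= 2 * e.
Proof.
have h1 : (\sum_v (weight lab r v)%:E *
    (dirac (c v) : {measure set T -> \bar R}) setT = 1)%E.
  under eq_bigr do rewrite /= diracT mule1.
  by rewrite sumEFin sum_pr_labellingT.
have [r' Hr'] := probability_mixture (weight_ge0 lab r) h1.
have prr' A : pr r' A = \sum_v weight lab r v * \1_A (c v).
  rewrite /pr Hr'; under eq_bigr do rewrite /= diracE -indicE -EFinM.
  by rewrite sumEFin.
exists r'; split=> //; apply: w1_same_weight => v.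
rewrite {1}/weight prr' (bigD1 v)//= big1 ?addr0; last first.
  move=> v' v'v; have [->|E] := weight0_or_section r v'; first by rewrite mul0r.
  rewrite indicE memNset ?mulr0//= E => vv; by rewrite vv eqxx in v'v.
have [->|E] := weight0_or_section r v; first by rewrite mul0r.
by rewrite indicE mem_set ?mulr1.
Qed.

Variables (n : nat) (K : R).
Hypothesis HK : forall mu : probability T R,
  empirical_bound (fun x y => (dist x y)%:E) mu n K.

Let I : finType := {ffun 'I_n -> V}.

Definition label_sample (v : {ffun 'I_n -> V}) : probability T R :=
  empirical_measure R [seq c (v i) | i <- enum 'I_n].

(** The left-hand side is the mean distance to [nu] of the empirical measure of [n] draws from [r'].
    The rate hypothesis holds on every sample space, hence on one made of the words of labels; two
    triangle inequalities pass from [r'] to [r] and then to [nu]. *)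
Lemma discrete_sample (r nu : probability T R) :
  \sum_(v : {ffun 'I_n -> V}) (\prod_i weight lab r (v i)) *
    w1 dist (label_sample v) nu
  <= K + 2 * e + w1 dist r nu.
Proof.
have [r' [prr' r'r]] := discretization r.
pose a (v : I) := \prod_i weight lab r (v i).
have a0 v : 0 <= a v by apply: prodr_ge0 => i _; exact: weight_ge0.
have a1 : \sum_v a v = 1.
  rewrite /a -(bigA_distr_bigA (fun (_ : 'I_n) v => weight lab r v)).
  by rewrite big1// => i _; rewrite sum_pr_labellingT.
(* The words are coded by integers because every set of integers is measurable; [lam] decodes, with
   [None] off the codes. *)
pose rk (v : I) : nat := enum_rank v.
pose lam (k : nat) : option I := omap enum_val (insub k : option 'I_#|I|).
have lamK v : lam (rk v) = Some v by rewrite /lam/rk valK/= enum_rankK.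
have h1 : (\sum_v (a v)%:E * (dirac (rk v) : {measure set nat -> \bar R}) setT = 1)%E.
  by under eq_bigr do rewrite /= diracT mule1; rewrite sumEFin a1.
have [Q HQ] := probability_mixture a0 h1.
have prQ A : pr Q A = \sum_v a v * \1_A (rk v).
  rewrite /pr HQ; under eq_bigr do rewrite /= diracE -indicE -EFinM.
  by rewrite sumEFin.
pose X (i : 'I_n) (k : nat) : T := if lam k is Some v then c (v i) else point.
have iid : iid_sample Q r' X.
  split=> [i _ A mA|A mA]; first by [].
  rewrite prE//; congr EFin.
  under [RHS]eq_bigr do rewrite -/(pr r' (A _)) prr'.
  rewrite bigA_distr_bigA/= prQ; apply: eq_bigr => v _.
  rewrite big_split/=; congr (_ * _).
  rewrite indicE; have [|] := boolP (rk v \in _).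
    rewrite inE /= => H; rewrite big1// => i _; rewrite indicE mem_set//.
    by have := H i; rewrite /X lamK.
  rewrite notin_setE/= => /existsNP[i nA]; rewrite (bigD1 i)//= indicE memNset ?mul0r//.
  by move: nA; rewrite /X lamK.
have := HK iid.
pose phi (o : option I) := if o is Some v then w1 dist (label_sample v) r' else 0.
have mlam : labelling lam by [].
have philam : Q.-integrable setT (EFin \o (phi \o lam)).
  exact: integrable_labelling.
move=> /(le_trans (Rintegral_le_integral _ _ philam)).
have H1 : (forall k, 0 <= wass1 (fun x y => (dist x y)%:E)
    (empirical_measure R [seq X i k | i <- enum 'I_n]) r')%E.
  by move=> k; exact: wass1_ge0.
have H2 (k : nat) : (((phi \o lam) k)%:E <= wass1 (fun x y => (dist x y)%:E)
    (empirical_measure R [seq X i k | i <- enum 'I_n]) r')%E.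
  rewrite (wass1E tb) lee_fin /= /X; case: (lam k) => [v|]; first by [].
  exact: w1_ge0.
move=> /(_ H1 H2); rewrite lee_fin Rintegral_labelling// => le1.
apply: (@le_trans _ _ (\sum_v a v * (w1 dist (label_sample v) r' +
    (2 * e + w1 dist r nu)))).
  apply: ler_sum => v _; apply: ler_wpM2l; first exact: a0.
  apply: (le_trans (w1_tri tb (label_sample v) r' nu)); rewrite lerD2l.
  by apply: (le_trans (w1_tri tb r' r nu)); rewrite lerD2r.
under eq_bigr do rewrite mulrDr.
rewrite big_split/= -mulr_suml a1 mul1r -addrA lerD2r.
apply: le_trans le1.
rewrite (bigD1 None)//= mul0r add0r (reindex_omap Some id)/=; last by case.
rewrite [leRHS](eq_bigl xpredT) => [|v]; last by rewrite eqxx.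
apply: ler_sum => v _.
rewrite mulrC prQ (bigD1 v)//= indicE mem_set ?mulr1//= big1 ?addr0//.
move=> v' v'v; rewrite indicE memNset ?mulr0//= lamK => -[vv].
by rewrite vv eqxx in v'v.
Qed.

End discrete_sample.

Section icl_mean.
Context (R : realType) (dx dy : nat) (X : compact_dom R dx)
  (Y : compact_dom R dy).
Local Notation Zs := (pts X * pts Y)%type.
Context (d : measure_display) (Om : measurableType d) (Pr : probability Om R)
  (P : meta_distribution X Y) (T N : nat)
  (rho : 'I_T -> Om -> Prob R Zs) (z : 'I_T -> 'I_N -> Om -> Zs).
Hypothesis smp : icl_sample Pr P rho z.

Local Notation lawP := (P : probability (borel (Prob R Zs)) R).

Lemma icl_iid_tasks : iid_sample Pr lawP (rho : 'I_T -> Om -> borel (Prob R Zs)).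
Proof.
have [mrho mz H] := smp; split=> // A mA.
have := H A (fun _ _ => setT) mA (fun _ _ => measurableT).
rewrite (_ : [set w | (forall t, A t (rho t w)) /\ _] = [set w | forall t, A t (rho t w)]).
  move=> ->; congr EFin; apply: eq_bigr => t _.
  rewrite (eq_Rintegral _ (g := fun=> 1)) ?Rintegral_cst ?mul1r// => r _.
  by rewrite big1// => j _; rewrite probability_setT.
by apply/seteqP; split=> w /=; [case|move=> ?; split].
Qed.

Lemma measurable_weight (V : finType) (lab : borel Zs -> V) v : labelling lab ->
  measurable_fun setT (fun r : borel (Prob R Zs) =>
    weight lab (r : probability (borel Zs) R) v).
Proof.
by move=> mlab; exact: (measurable_eval (totally_bounded_zd X Y) (@nbhs_zd _ _ _ X Y)).
Qed.

Variables (t : 'I_T) (J : pred 'I_N).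
Let n := #|J|.
Hypothesis n0 : (0 < n)%N.

Lemma pr_icl_labels (V U : finType) (lab : borel Zs -> V)
    (lab' : borel (Prob R Zs) -> U) (u : {ffun 'I_n -> V}) (a : U) :
  labelling lab -> labelling lab' ->
  pr Pr [set w | lab' (rho t w) = a /\
                 forall i, lab (z t (enum_val (A := J) i) w) = u i] =
  \int[lawP]_r (\1_(lab' @^-1` [set a]) r *
     \prod_i weight lab (r : probability (borel Zs) R) (u i)).
Proof.
move=> mlab mlab'; have [_ _ H] := smp.
(* The premises [t' = t] and [enum_val i = k] make every other factor of the rectangle the whole
   space, so the product formula reduces to one integral over the task. *)
pose A t' : set (borel (Prob R Zs)) := [set r | t' = t -> lab' r = a].
pose B t' k : set (borel Zs) :=
  [set x | forall i : 'I_n, t' = t -> enum_val (A := J) i = k -> lab x = u i].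
have At : A t = lab' @^-1` [set a].
  by apply/seteqP; split=> r /= => [|ra _]; [apply|].
have An t' : t' != t -> A t' = setT.
  by move=> /eqP tt; apply/seteqP; split=> // r _ /tt.
have mA t' : measurable (A t').
  have [->|/An ->//] := eqVneq t' t; rewrite At; exact: mlab'.
have Bn t' k : t' != t -> B t' k = setT.
  by move=> /eqP tt; apply/seteqP; split=> // x _ i /tt.
have BnJ k : ~~ J k -> B t k = setT.
  move=> /negP Jk; apply/seteqP; split=> // x _ i _ ik; exfalso; apply: Jk.
  by rewrite -ik; exact: (enum_valP i).
have Bt i : B t (enum_val (A := J) i) = lab @^-1` [set u i].
  apply/seteqP; split=> x /=; first exact.
  by move=> xi j _ /enum_val_inj ->.
have mB t' k : measurable (B t' k).
  have [->|/Bn ->//] := eqVneq t' t.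
  have [Jk|/BnJ ->//] := boolP (J k).
  by rewrite -(enum_rankK_in Jk Jk) Bt; exact: mlab.
have := H A B mA mB; rewrite (bigD1 t)//= [X in (_ * X)%:E]big1 ?mulr1; last first.
  move=> t' tt; rewrite An//.
  rewrite (eq_Rintegral _ (g := fun=> 1)) ?Rintegral_cstT// => r _.
  by rewrite big1// => j _; rewrite Bn// probability_setT.
rewrite /pr => E.
rewrite (_ : [set w | _ /\ _] = [set w | (forall t', A t' (rho t' w)) /\
    (forall t' j, B t' j (z t' j w))]).
  rewrite E/= At Rintegral_mkcond; apply: eq_Rintegral => r _.
  rewrite /patch indicE; case: ifPn => _; last by rewrite mul0r.
  rewrite mul1r (bigID (mem J))/= [X in _ * X]big1 ?mulr1; last first.
    by move=> j /BnJ ->; rewrite probability_setT.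
  by rewrite big_enum_val; apply: eq_bigr => i _; rewrite Bt.
apply/seteqP; split=> w /=.
  move=> [ra zu]; split; first by move=> t' ->.
  by move=> t' k i -> <-; exact: zu.
move=> [HA HB]; split; first exact: HA.
by move=> i; apply: (HB t).
Qed.

(** The majorant depends only on the labels of the task and of its context, so its mean is a finite
    sum; [e] is the discretization error. *)
Lemma icl_task_mean (K e : R) :
  (forall mu : probability (borel Zs) R,
    empirical_bound (@zdist R dx dy X Y : borel Zs -> borel Zs -> \bar R) mu n K) -> 0 < e ->
  exists b : Om -> R, mean_le Pr b (K + e) /\
    forall w, taskd (empirical_on (fun j => z t j w) J) (rho t w) <= b w.
Proof.
move=> HK e0; have [mrho mz _] := smp.
have tbz := totally_bounded_zd X Y; have tbt := totally_bounded_taskd X Y.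
have e'0 : 0 < e / 6 by rewrite divr_gt0.
have [V [lab [c [mlab ce cK]]]] := pmetric_section tbz e'0.
have [U [lab' [c' [mlab' ce']]]] := pmetric_rep tbt e'0.
pose us w : {ffun 'I_n -> V} := [ffun i => lab (z t (enum_val (A := J) i) w)].
pose psi (i : U * {ffun 'I_n -> V}) :=
  w1 (@zd R dx dy X Y) (label_sample R c i.2) (c' i.1 : probability (borel Zs) R).
pose lam w := (lab' (rho t w), us w).
have mlam : labelling lam.
  apply: labelling_pair.
    move=> v; rewrite -[X in measurable X]setTI.
    exact: (mrho t measurableT _ (mlab' v)).
  apply: labelling_ffun => i v.
  rewrite -[X in measurable X]setTI.
  exact: (mz t (enum_val (A := J) i) measurableT _ (mlab v)).
(* Half of [e] is spent pathwise: [2 * (e / 6)] on relabelling the context and [e / 6] on the task.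
   The other half is spent in the mean, through [discrete_sample]. *)
exists (fun w => psi (lam w) + (2 * (e / 6) + e / 6)); split; last first.
  move=> w; set m := empirical_on _ _.
  have H1 : w1 (@zd R dx dy X Y) (m : probability (borel Zs) R) (label_sample R c (us w)) <= 2 * (e / 6).
    apply: (w1_same_weight tbz mlab ce) => v; rewrite /weight !pr_empirical.
      rewrite 2!size_map size_enum_ord -cardE; congr (_ * _).
      rewrite 2!big_map big_enum/= big_enum_val big_enum/=.
      apply: eq_bigr => i _; rewrite !indicE /us ffunE; congr (_ %:R).
      by congr nat_of_bool; apply/idP/idP; rewrite !inE /= cK.
    - by rewrite size_map size_enum_ord.
    - by rewrite size_map -cardE.
  have H2 : w1 (@zd R dx dy X Y) (c' (lab' (rho t w)) : probability (borel Zs) R) (rho t w) <= e / 6.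
    by rewrite (w1_sym tbz); exact: ce'.
  have T1 := w1_tri tbz (m : probability (borel Zs) R) (label_sample R c (us w)) (rho t w).
  have T2 := w1_tri tbz (label_sample R c (us w)) (c' (lab' (rho t w)) : probability (borel Zs) R) (rho t w).
  have T2' := le_trans T2 (lerD (lexx _) H2).
  by apply: (le_trans T1); apply: (le_trans (lerD H1 T2')); rewrite addrCA.
have -> : K + e = (K + 3 * (e / 6)) + (2 * (e / 6) + e / 6) by field.
apply: mean_leD; last exact: mean_le_cst.
split; first exact: integrable_labelling.
rewrite Rintegral_labelling//.
pose Q (i : U * {ffun 'I_n -> V}) (r : borel (Prob R Zs)) : R :=
  \1_(lab' @^-1` [set i.1]) r *
     \prod_k weight lab (r : probability (borel Zs) R) (i.2 k).
have prQ i : pr Pr (lam @^-1` [set i]) = \int[lawP]_r Q i r.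
  case: i => a u; rewrite /Q/= -pr_icl_labels//; congr pr.
  apply/seteqP; split=> w /=.
    by move=> [<- <-]; split=> // i; rewrite /us ffunE.
  by move=> [<- H]; congr (_, _); apply/ffunP => i; rewrite /us ffunE.
have w01 r v : 0 <= weight lab (r : probability (borel Zs) R) v <= 1.
  by rewrite weight_ge0 pr_le1.
have pw01 r (u : {ffun 'I_n -> V}) :
    0 <= \prod_k weight lab (r : probability (borel Zs) R) (u k) <= 1.
  rewrite prodr_ge0 => [/=|k _]; last exact: weight_ge0.
  by apply: prodr_ile1 => k _; exact: w01.
have iQ i : lawP.-integrable setT (EFin \o Q i).
  apply: (bounded_integrable _ (M := 1)) => [|r].
    apply: measurable_funM.
      by apply: measurable_indic; exact: mlab'.
    by apply: measurable_prod => k _; exact: measurable_weight.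
  have /andP[? ?] := pw01 r i.2.
  by rewrite /Q indicE normrM ger0_norm// [X in _ * X]ger0_norm//; case: (_ \in _);
    rewrite ?mul1r ?mul0r.
rewrite (eq_bigr (fun i => \int[lawP]_r (psi i * Q i r))); last first.
  by move=> i _; rewrite prQ; apply/esym; apply: RintegralZl => //; exact: iQ.
have ipQ i : lawP.-integrable setT (EFin \o (fun r => psi i * Q i r)).
  exact: (integrableZl measurableT (psi i) (iQ i)).
rewrite -Rintegral_sum//.
rewrite -[leRHS](Rintegral_cstT lawP).
apply: le_Rintegral => //.
- have := @integrable_sum _ _ _ lawP setT measurableT _ (index_enum _) xpredT
      (fun i => EFin \o (fun r => psi i * Q i r)) (fun i _ => ipQ i).
  by apply: eq_integrable => // r _; rewrite /= sumEFin.
- exact: integrable_cstT.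
move=> r _.
have := discrete_sample tbz mlab ce cK HK (r : probability (borel Zs) R)
  (c' (lab' r) : probability (borel Zs) R).
have : w1 (@zd R dx dy X Y) (r : probability (borel Zs) R) (c' (lab' r)) <= e / 6 by exact: ce'.
move=> H1 H2; apply: (@le_trans _ _ (K + 2 * (e / 6) + e / 6)); last first.
  by rewrite le_eqVlt; apply/orP; left; apply/eqP; ring.
apply: le_trans (lerD (lexx (K + 2 * (e / 6))) H1); apply: le_trans H2.
(* For a fixed task [r], only the task label of [r] survives in the sum, which leaves the sum
   bounded by [discrete_sample]. *)
rewrite -(pair_bigA _ (fun a u => psi (a, u) * Q (a, u) r))/= (bigD1 (lab' r))//=.
rewrite [X in _ + X]big1 ?addr0; last first.
  move=> a ar; rewrite big1// => u _; rewrite /Q/= indicE memNset ?mul0r ?mulr0//=.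
  by move=> ra; rewrite ra eqxx in ar.
apply: ler_sum => u _; rewrite /Q/= indicE mem_set// mul1r mulrC.
by [].
Qed.

End icl_mean.

(** * Risks *)

Lemma Rintegral_bounded (R : realType) (d : measure_display)
    (T : measurableType d) (mu : probability T R) (h : T -> R) (M : R) :
  measurable_fun setT h -> (forall x, `|h x| <= M) -> `|\int[mu]_x h x| <= M.
Proof.
move=> mh hM; have ih := bounded_integrable mu mh hM.
have mnh : measurable_fun setT (fun x => `|h x|) by exact: measurableT_comp.
have inh : mu.-integrable setT (EFin \o (fun x => `|h x|)).
  by apply: (bounded_integrable mu mnh (M := M)) => x; rewrite normr_id.
apply: (le_trans (le_normr_Rintegral measurableT ih)).
rewrite -[leRHS](Rintegral_cstT mu); apply: le_Rintegral => //.
exact: integrable_cstT.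
Qed.

Section risk.
Context (R : realType) (dx dy : nat) (X : compact_dom R dx)
  (Y : compact_dom R dy).
Local Notation Zs := (pts X * pts Y)%type.
Local Notation zdist' := (@zd R dx dy X Y).
Local Notation taskd' := (@taskd R dx dy X Y).
Context (l : pts Y -> pts Y -> R) (Ll Lf : R).
Hypothesis l_lip : lipschitz_loss Ll l.
Let A := `|Ll|.
Let B := `|Lf|.
Let A0 : 0 <= A. Proof. exact: normr_ge0. Qed.
Let B0 : 0 <= B. Proof. exact: normr_ge0. Qed.

Lemma loss_lip y y' v v' : `|l y v - l y' v'| <=
  A * (enorm (pval y - pval y') + enorm (pval v - pval v')).
Proof.
apply: (le_trans (l_lip _ _ _ _)); rewrite ler_wpM2r ?ler_norm//.
by rewrite addr_ge0// enorm_ge0.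
Qed.

Lemma loss_bounded : exists M, forall y v, `|l y v| <= M.
Proof.
have [K K0 HK] := pval_bounded Y.
have E (y y' : pts Y) : enorm (pval y - pval y') <= dy%:R * (2 * K).
  apply: (le_trans (enorm_le_sum _)).
  apply: (@le_trans _ _ (\sum_(i < dy) 2 * K)).
    apply: ler_sum => i _; rewrite !mxE (le_trans (ler_normB _ _))//.
    by rewrite mulrDl mul1r lerD.
  by rewrite sumr_const card_ord -[leLHS]mulr_natl.
exists (`|l point point| + A * (dy%:R * (2 * K) + dy%:R * (2 * K))) => y v.
rewrite -[l y v](subrK (l point point)) addrC (le_trans (ler_normD _ _))//.
rewrite lerD2l (le_trans (loss_lip _ _ _ _))// ler_wpM2l//.
by apply: lerD; exact: E.
Qed.

Section predictor.
Variable f : predictor X Y.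
Hypothesis f_lip : lipschitz_predictor Lf f.

Lemma predictor_lip r r' x x' : enorm (pval (f r x) - pval (f r' x')) <=
  B * (taskd' r r' + enorm (pval x - pval x')).
Proof.
have := f_lip r r' x x'; rewrite W1E -EFinD -EFinM lee_fin => /le_trans; apply.
rewrite ler_wpM2r ?ler_norm// addr_ge0 ?enorm_ge0//.
exact: (pmetric_ge0 (totally_bounded_taskd X Y)).
Qed.

Definition integrand (r : Prob R Zs) (z : borel Zs) : R := l z.2 (f r z.1).

Definition cond_risk (r : borel (Prob R Zs)) : R :=
  Rintegral (r : probability (borel Zs) R) setT (integrand r).

Lemma integrand_lip r z z' :
  `|integrand r z - integrand r z'| <= A * (1 + B) * zdist' z z'.
Proof.
apply: (le_trans (loss_lip _ _ _ _)); rewrite -mulrA ler_wpM2l//.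
rewrite mulrDl mul1r lerD ?zd_ge2//.
apply: (le_trans (predictor_lip _ _ _ _)).
rewrite /taskd (w1_refl (totally_bounded_zd X Y)) add0r ler_wpM2l//.
exact: zd_ge1.
Qed.

Lemma integrand_lip2 r r' z :
  `|integrand r z - integrand r' z| <= A * B * taskd' r r'.
Proof.
apply: (le_trans (loss_lip _ _ _ _)); rewrite -mulrA ler_wpM2l//.
rewrite subrr enorm0 add0r; apply: (le_trans (predictor_lip _ _ _ _)).
by rewrite subrr enorm0 addr0.
Qed.

Let AB0 : 0 <= A * (1 + B).
Proof. by rewrite mulr_ge0// addr_ge0. Qed.

(** The task enters twice: as the law of the example, with constant [A * (1 + B)], and as an
    argument of the predictor, with constant [A * B]. *)
Lemma cond_risk_lip r r' :
  `|cond_risk r - cond_risk r'| <= A * (1 + 2 * B) * taskd' r r'.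
Proof.
have tbz := totally_bounded_zd X Y.
rewrite -[cond_risk r](subrK (Rintegral (r' : probability (borel Zs) R) setT (integrand r))).
rewrite -addrA (le_trans (ler_normD _ _))//.
have -> : A * (1 + 2 * B) * taskd' r r' =
  A * (1 + B) * taskd' r r' + A * B * taskd' r r' by ring.
apply: lerD.
  exact: (Rintegral_lipschitz tbz _ _ AB0 (integrand_lip r)).
have ir s := lipschitz_integrable tbz (r' : probability (borel Zs) R) (integrand_lip s).
have m s := lipschitz_measurable tbz (integrand_lip s).
rewrite /cond_risk -RintegralB//; [|exact: ir|exact: ir].
apply: Rintegral_bounded; first exact: (measurable_funB (m r) (m r')).
by move=> z; exact: integrand_lip2.
Qed.

Lemma risk_bounded (P : meta_distribution X Y) M :
  (forall y v, `|l y v| <= M) -> `|risk P l f| <= M.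
Proof.
move=> lM; have tbz := totally_bounded_zd X Y.
apply: (@Rintegral_bounded _ _ _ (P : probability (borel (Prob R Zs)) R) cond_risk).
  exact: (lipschitz_measurable (totally_bounded_taskd X Y) cond_risk_lip).
move=> r; apply: Rintegral_bounded; last by move=> z; exact: lM.
exact: (lipschitz_measurable tbz (integrand_lip r)).
Qed.

Variables (T N : nat) (I : pred 'I_N) (J : 'I_N -> pred 'I_N).

(** The common form of both objectives: [I] is the set of predicted positions, and [J j] the context
    used at position [j]. *)
Definition icl_risk (z : 'I_T -> 'I_N -> Zs) : R :=
  (T%:R * #|I|%:R)^-1 * \sum_(t < T) \sum_(j < N | I j)
    l (z t j).2 (f (empirical_on (z t) (J j)) (z t j).1).

Definition task_error (z : 'I_N -> Zs) (r : Prob R Zs) : R :=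
  A * (1 + B) * taskd' (empirical_on z I) r +
  A * B * (#|I|%:R^-1 * \sum_(j < N | I j) taskd' (empirical_on z (J j)) r).

(** A pathwise bound. With the true task as context, the average of losses is an integral against
    the empirical measure on [I]; replacing that context by the one on [J j] costs the second part
    of [task_error]. *)
Lemma cond_risk_gap (z : 'I_N -> Zs) (r : Prob R Zs) : (0 < #|I|)%N ->
  `|cond_risk r - #|I|%:R^-1 * \sum_(j < N | I j)
      l (z j).2 (f (empirical_on z (J j)) (z j).1)| <= task_error z r.
Proof.
move=> I0; have tbz := totally_bounded_zd X Y.
have nI0 : 0 <= #|I|%:R^-1 :> R by rewrite invr_ge0.
pose E := empirical_on z I : probability (borel Zs) R.
have HE : Rintegral E setT (integrand r) =
    #|I|%:R^-1 * \sum_(j < N | I j) integrand r (z j).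
  have mi := lipschitz_measurable tbz (integrand_lip r).
  have [M HM] := lipschitz_bounded tbz (integrand_lip r).
  rewrite /E /empirical_on (Rintegral_empirical _ mi HM); last by rewrite size_map -cardE.
  by rewrite size_map -cardE big_map big_enum.
rewrite -[cond_risk r](subrK (Rintegral E setT (integrand r))) -addrA.
apply: (le_trans (ler_normD _ _)); apply: lerD.
  rewrite distrC; exact: (Rintegral_lipschitz tbz E _ AB0 (integrand_lip r)).
rewrite HE -mulrBr -sumrB normrM (ger0_norm nI0) mulrCA ler_wpM2l// mulr_sumr.
apply: (le_trans (ler_norm_sum _ _ _)); apply: ler_sum => j _.
apply: (le_trans (integrand_lip2 r (empirical_on z (J j)) (z j))).
by rewrite (pmetric_sym (totally_bounded_taskd X Y)).
Qed.

Lemma risk_gap (P : meta_distribution X Y) (z : 'I_T -> 'I_N -> Zs)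
    (rho : 'I_T -> Prob R Zs) : (0 < T)%N -> (0 < #|I|)%N ->
  `|risk P l f - icl_risk z| <=
  A * (1 + 2 * B) * w1 taskd'
      (empirical_measure R [seq (rho t : borel (Prob R Zs)) | t <- enum 'I_T]) P +
  T%:R^-1 * \sum_t task_error (z t) (rho t).
Proof.
move=> T0 I0; have tbt := totally_bounded_taskd X Y.
have nT0 : 0 <= T%:R^-1 :> R by rewrite invr_ge0.
have AB20 : 0 <= A * (1 + 2 * B) by rewrite mulr_ge0// addr_ge0// mulr_ge0.
set E := empirical_measure R _.
have HE : Rintegral E setT cond_risk = T%:R^-1 * \sum_t cond_risk (rho t).
  have mi := lipschitz_measurable tbt cond_risk_lip.
  have [M HM] := lipschitz_bounded tbt cond_risk_lip.
  rewrite /E (Rintegral_empirical _ mi HM) size_map size_enum_ord//.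
  by rewrite big_map big_enum.
rewrite -[risk P l f](subrK (Rintegral E setT cond_risk)) -addrA.
apply: (le_trans (ler_normD _ _)); apply: lerD.
  rewrite distrC; exact: (Rintegral_lipschitz tbt E _ AB20 cond_risk_lip).
rewrite HE /icl_risk invfM -mulrA -mulrBr normrM (ger0_norm nT0) ler_wpM2l//.
rewrite mulr_sumr -sumrB.
apply: (le_trans (ler_norm_sum _ _ _)); apply: ler_sum => t _.
exact: cond_risk_gap.
Qed.

End predictor.

End risk.

(** * From the gap to the excess risk *)

Lemma excess_algebra (R : realType) (r1 r2 q1 q2 u b W L : R) :
  r1 <= r2 -> q1 - r1 <= L * W + u -> - (L * W + u) <= q2 - r2 -> u <= b ->
  q1 - q2 - 2 * b <= 2 * L * W.
Proof. lra. Qed.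

Lemma excess_algebra2 (R : realType) (q1 q2 b S x y e : R) :
  q1 - q2 - 2 * b <= x -> b <= S + y -> y * 2 <= e -> q1 - q2 <= e + (x + 2 * S).
Proof. lra. Qed.

Section excess_risk.
Context (R : realType) (dx dy : nat) (X : compact_dom R dx)
  (Y : compact_dom R dy).
Local Notation Zs := (pts X * pts Y)%type.
Context (l : pts Y -> pts Y -> R) (Ll Lf : R) (F : set (predictor X Y))
  (P : meta_distribution X Y) (fstar : predictor X Y) (s cT cN : R).
Hypothesis l_lip : lipschitz_loss Ll l.
Hypothesis F_lip : forall f, F f -> lipschitz_predictor Lf f.
Hypothesis Fstar : F fstar.
Hypothesis rateT : task_rate P s cT.
Hypothesis rateN : sample_rate X Y cN.
Context (T N : nat) (d : measure_display) (Om : measurableType d)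
  (Pr : probability Om R) (rho : 'I_T -> Om -> Prob R Zs)
  (z : 'I_T -> 'I_N -> Om -> Zs) (fTN : Om -> predictor X Y)
  (I : pred 'I_N) (J : 'I_N -> pred 'I_N).
Hypothesis T0 : (0 < T)%N.
Hypothesis I0 : (0 < #|I|)%N.
Hypothesis J0 : forall j, I j -> (0 < #|J j|)%N.
Hypothesis smp : icl_sample Pr P rho z.
Hypothesis mrisk : measurable_fun setT (fun w => risk P l (fTN w)).
Hypothesis argmin_fTN : forall w,
  is_argmin F (fun f => icl_risk l f I J (fun t j => z t j w)) (fTN w).
Let A := `|Ll|.
Let B := `|Lf|.
Let A0 : 0 <= A. Proof. exact: normr_ge0. Qed.
Let B0 : 0 <= B. Proof. exact: normr_ge0. Qed.
Let rate (n : nat) : R := n%:R `^ (- ((dx + dy)%:R)^-1).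

Lemma mean_task_error e : 0 < e -> exists b : Om -> R,
  mean_le Pr b (A * (1 + B) * (`|cN| * rate #|I|) +
    A * B * (#|I|%:R^-1 * \sum_(j < N | I j) `|cN| * rate #|J j|) +
    A * (1 + 2 * B) * e) /\
  forall w, T%:R^-1 * \sum_t task_error Ll Lf I J (fun j => z t j w) (rho t w) <= b w.
Proof.
move=> e0.
have HK n (n0 : (0 < n)%N) (mu : probability (borel Zs) R) : empirical_bound
    (@zdist R dx dy X Y : borel Zs -> borel Zs -> \bar R) mu n (`|cN| * rate n).
  move=> d' Om' Pr' X' iid; apply: le_trans (rateN n0 iid) _.
  by rewrite lee_fin ler_wpM2r ?powR_ge0 ?ler_norm.
have [bI HI] := choice (fun t => icl_task_mean smp t I0 (HK _ I0) e0).
(* A position outside [I] may have an empty context; it gets the dummy majorant 0. *)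
have exJ (tj : 'I_T * 'I_N) : exists b : Om -> R, I tj.2 ->
    mean_le Pr b (`|cN| * rate #|J tj.2| + e) /\
    forall w, taskd (empirical_on (fun j => z tj.1 j w) (J tj.2)) (rho tj.1 w) <= b w.
  have [Ij|_] := boolP (I tj.2); last by exists (fun=> 0).
  by have [b Hb] := icl_task_mean smp tj.1 (J0 Ij) (HK _ (J0 Ij)) e0; exists b.
have [bJ HJ] := choice exJ.
have nI0 : 0 <= #|I|%:R^-1 :> R by rewrite invr_ge0.
have nIn : #|I|%:R != 0 :> R by rewrite pnatr_eq0 -lt0n.
have nT0 : 0 <= T%:R^-1 :> R by rewrite invr_ge0.
have nTn : T%:R != 0 :> R by rewrite pnatr_eq0 -lt0n.
have AB : 0 <= A * (1 + B) by rewrite mulr_ge0// addr_ge0.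
have AB' : 0 <= A * B by rewrite mulr_ge0.
exists (fun w => T%:R^-1 * \sum_t (A * (1 + B) * bI t w +
  A * B * (#|I|%:R^-1 * \sum_(j < N | I j) bJ (t, j) w))); split; last first.
  move=> w; rewrite ler_wpM2l//; apply: ler_sum => t _; apply: lerD.
    by rewrite ler_wpM2l//; exact: (HI t).2.
  rewrite ler_wpM2l// ler_wpM2l//; apply: ler_sum => j Ij.
  exact: (HJ (t, j) Ij).2.
set S := \sum_(j < N | I j) `|cN| * rate #|J j|.
have card : \sum_(j < N | I j) e = #|I|%:R * e.
  by rewrite sumr_const mulr_natl.
have -> : A * (1 + B) * (`|cN| * rate #|I|) + A * B * (#|I|%:R^-1 * S) +
    A * (1 + 2 * B) * e = T%:R^-1 * \sum_(t < T) (A * (1 + B) * (`|cN| * rate #|I| + e) +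
      A * B * (#|I|%:R^-1 * \sum_(j < N | I j) (`|cN| * rate #|J j| + e))).
  have -> : \sum_(j < N | I j) (`|cN| * rate #|J j| + e) = S + #|I|%:R * e.
    by rewrite big_split/= card.
  have SC (x : R) : \sum_(t < T) x = T%:R * x by rewrite sumr_const card_ord mulr_natl.
  rewrite SC mulKf//.
  by rewrite [#|I|%:R^-1 * (S + _)]mulrDr mulKf//; ring.
apply: mean_leZ => //; apply: mean_le_sum => t _; apply: mean_leD.
  by apply: mean_leZ => //; exact: (HI t).1.
apply: mean_leZ => //; apply: mean_leZ => //; apply: mean_le_sum => j Ij.
exact: (HJ (t, j) Ij).1.
Qed.

(** The rate for tasks bounds the integral of [W], which is not split from a sum. Instead, the
    excess risk minus the majorant of twice the context errors, divided by [2 * L + 1], is an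
    integrable minorant [u] of [W]. The 1 keeps the divisor positive when [L] vanishes. *)
Lemma excess_risk :
  ('E_Pr[fun w => risk P l (fTN w)] - (risk P l fstar)%:E <=
   ((2 * (A * (1 + 2 * B)) + 1) * (`|cT| * T%:R `^ (- s^-1)) +
    2 * (A * (1 + B) * (`|cN| * rate #|I|) +
      A * B * (#|I|%:R^-1 * \sum_(j < N | I j) `|cN| * rate #|J j|)))%:E)%E.
Proof.
set L := A * (1 + 2 * B); set S := A * (1 + B) * _ + _.
have L0 : 0 <= L by rewrite mulr_ge0// addr_ge0// mulr_ge0.
have k0 : 0 < 2 * L + 1 by rewrite ltr_wpDl// mulr_ge0.
have [M HM] := loss_bounded l_lip.
have FM w : F (fTN w) by have [] := argmin_fTN w.
have irisk : Pr.-integrable setT (EFin \o (fun w => risk P l (fTN w))).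
  apply: (bounded_integrable Pr mrisk (M := M)) => w.
  exact: (risk_bounded l_lip (F_lip (FM w))).
have -> : ('E_Pr[fun w => risk P l (fTN w)])%E = (\int[Pr]_w risk P l (fTN w))%:E.
  by rewrite unlock /Rintegral fineK//; exact: integrable_fin_num irisk.
rewrite -EFinB lee_fin; apply/ler_addgt0Pl => e e0.
have e'0 : 0 < e / (2 * L + 1) by rewrite divr_gt0.
have [b [[ib mb] Hb]] := mean_task_error e'0.
rewrite -/L -/S in mb.
pose W w := w1 (@taskd R dx dy X Y)
  (empirical_measure R [seq (rho t w : borel (Prob R Zs)) | t <- enum 'I_T]) P.
have W0 w : 0 <= W w by exact: (w1_ge0 (totally_bounded_taskd X Y)).
pose u w := (2 * L + 1)^-1 * ((risk P l (fTN w) - risk P l fstar) - 2 * b w).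
have uW w : u w <= W w.
  rewrite /u ler_pdivrMl//; apply: (@le_trans _ _ (2 * L * W w)); last first.
    by rewrite ler_wpM2r// lerDl.
  have g1 := risk_gap l_lip (F_lip (FM w)) J P (fun t j => z t j w) (rho ^~ w) T0 I0.
  have g2 := risk_gap l_lip (F_lip Fstar) J P (fun t j => z t j w) (rho ^~ w) T0 I0.
  have [_ /(_ _ Fstar) opt] := argmin_fTN w.
  move: g1 g2 (Hb w); rewrite -/A -/B -/L -/(W w) !ler_norml.
  (* The gap is used from above at the estimator and from below at [fstar]; optimality compares the
     two objectives. *)
  move=> /andP[_ h1] /andP[h2 _] h3; exact: excess_algebra opt h1 h2 h3.
have i1 : Pr.-integrable setT
    (EFin \o (fun w => risk P l (fTN w) - risk P l fstar)).
  exact: (integrableB measurableT irisk (integrable_cstT Pr (risk P l fstar))).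
have i2 : Pr.-integrable setT (EFin \o (fun w => 2 * b w)).
  exact: (integrableZl measurableT 2 ib).
have i3 : Pr.-integrable setT
    (EFin \o (fun w => (risk P l (fTN w) - risk P l fstar) - 2 * b w)).
  exact: (integrableB measurableT i1 i2).
have iu : Pr.-integrable setT (EFin \o u).
  exact: (integrableZl measurableT (2 * L + 1)^-1 i3).
have Iu : \int[Pr]_w u w <= `|cT| * T%:R `^ (- s^-1).
  apply: (@le_trans _ _ (cT * T%:R `^ (- s^-1))); last first.
    by rewrite ler_wpM2r ?powR_ge0 ?ler_norm.
  rewrite -lee_fin; apply: le_trans (rateT T0 (icl_iid_tasks smp)).
  apply: Rintegral_le_integral => // w.
    by rewrite wass1_W1E lee_fin W0.
  by rewrite wass1_W1E lee_fin uW.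
have Eu : \int[Pr]_w u w = (2 * L + 1)^-1 *
    (\int[Pr]_w risk P l (fTN w) - risk P l fstar - 2 * \int[Pr]_w b w).
  rewrite /u RintegralZl// RintegralB// (RintegralB measurableT irisk) ?RintegralZl//.
    by rewrite Rintegral_cstT.
  exact: integrable_cstT.
rewrite Eu ler_pdivrMl// in Iu.
have Le : L * (e / (2 * L + 1)) * 2 <= e.
  have -> : L * (e / (2 * L + 1)) * 2 = e * (2 * L) / (2 * L + 1) by ring.
  by rewrite ler_pdivrMr// ler_wpM2l ?(ltW e0)// lerDl.
exact: excess_algebra2 Iu mb Le.
Qed.

End excess_risk.

(** * Averages of the sample rate over context lengths *)

Lemma sum_inv_sqrt_le (R : realType) n :
  \sum_(j < n) (Num.sqrt j.+1%:R)^-1 <= 2 * Num.sqrt n%:R :> R.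
Proof.
elim: n => [|n IH]; first by rewrite big_ord0 mulr_ge0// sqrtr_ge0.
rewrite big_ord_recr/=; apply: (le_trans (lerD IH (lexx _))).
set a := Num.sqrt n.+1%:R; set b := Num.sqrt n%:R.
have a0 : 0 < a by rewrite sqrtr_gt0.
have ab : a ^+ 2 = b ^+ 2 + 1 by rewrite !sqr_sqrtr// natr1.
(* Telescoping: the inverse of [a] is at most [2 * (a - b)], because [a ^+ 2 - b ^+ 2 = 1] and
   [b <= a]. *)
have H : 1 <= (2 * a - 2 * b) * a.
  by have := sqr_ge0 (a - b); rewrite sqrrB; nra.
by rewrite addrC -lerBrDr -[a^-1]mul1r ler_pdivrMr.
Qed.

Section sample_rate_arithmetic.
Context (R : realType) (be : R).
Hypothesis be0 : 0 < be.
Hypothesis be2 : be <= 2^-1.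

(** Relative to its value at [n], the rate at [j.+1] is larger by the power [be] of [n / j.+1], at
    most its square root. This makes the constant 2 independent of [be]. *)
Lemma rate_avg_le n : (0 < n)%N ->
  n%:R^-1 * \sum_(j < n) j.+1%:R `^ (- be) <= 2 * n%:R `^ (- be).
Proof.
move=> n0; have nR : 0 < n%:R :> R by rewrite ltr0n.
have H (j : 'I_n) : j.+1%:R `^ (- be) <=
    n%:R `^ (- be) * Num.sqrt n%:R * (Num.sqrt j.+1%:R)^-1.
  have -> : j.+1%:R `^ (- be) = n%:R `^ (- be) * (n%:R / j.+1%:R) `^ be.
    rewrite powRM ?ler0n ?invr_ge0 ?ler0n// mulrA -powRD ?addNr ?powRr0 ?mul1r; last first.
      by apply/implyP => _; exact: lt0r_neq0.
    by rewrite -[j.+1%:R^-1]powR_inv1 ?ler0n// -powRrM mulN1r.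
  rewrite -mulrA ler_wpM2l ?powR_ge0//.
  rewrite -sqrtrV ?ler0n// -sqrtrM ?ler0n// -powR12_sqrt ?divr_ge0 ?ler0n//.
  by apply: ler_powR => //; rewrite ler_pdivlMr ?ltr0n// mul1r ler_nat.
rewrite ler_pdivrMl//; apply: (le_trans (ler_sum _ (fun j _ => H j))).
rewrite -mulr_sumr; apply: (@le_trans _ _ (n%:R `^ (- be) * Num.sqrt n%:R * (2 * Num.sqrt n%:R))).
  by rewrite ler_wpM2l ?sum_inv_sqrt_le// mulr_ge0 ?powR_ge0 ?sqrtr_ge0.
rewrite le_eqVlt; apply/orP; left; apply/eqP.
transitivity (2 * n%:R `^ (- be) * Num.sqrt n%:R ^+ 2); first by ring.
by rewrite sqr_sqrtr ?ler0n//; ring.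
Qed.

(** [N <= 2 * N.-1], and the power [be] of 2 is at most 2. *)
Lemma rate_pred_le N : (1 < N)%N -> N.-1%:R `^ (- be) <= 2 * N%:R `^ (- be).
Proof.
case: N => [//|[//|n]] _ /=.
have h : 0 < n.+2%:R / 2 :> R by rewrite divr_gt0.
rewrite !powRN ler_pdivlMr ?powR_gt0// mulrC ler_pdivrMr ?powR_gt0//.
apply: (@le_trans _ _ (2 `^ be * n.+1%:R `^ be)).
  rewrite -powRM ?ler0n//; apply: ge0_ler_powR; rewrite ?nnegrE ?(ltW be0) ?mulr_ge0//.
  by rewrite -natrM ler_nat mul2n -addnn -addSnnS leq_addr.
rewrite ler_wpM2r ?powR_ge0//; apply: ler1_powR; first by rewrite ler1n.
by apply: (le_trans be2); rewrite invf_le1 ?ler1n.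
Qed.

End sample_rate_arithmetic.

(** * The masked and autoregressive objectives *)

Lemma card_ord_lt (N : nat) (j : 'I_N) : #|[pred k : 'I_N | (k < j)%N]| = j.
Proof.
rewrite -sum1_card -[RHS]card_ord -sum1_card.
by rewrite (big_ord_widen N (fun=> 1%N)) 1?ltnW.
Qed.

Lemma sum_ord_gt0 (R : nmodType) (N : nat) (F : nat -> R) : (0 < N)%N ->
  \sum_(j < N | (0 < j)%N) F j = \sum_(j < N.-1) F j.+1.
Proof. by case: N => // N _; rewrite big_mkcond big_ord_recl/= add0r. Qed.

Lemma card_ord_gt0 (N : nat) : (0 < N)%N -> #|[pred j : 'I_N | (0 < j)%N]| = N.-1.
Proof.
move=> N0; rewrite -sum1_card -[RHS]card_ord -sum1_card.
exact: (@sum_ord_gt0 nat N (fun=> 1%N) N0).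
Qed.

Lemma masked_riskE (R : realType) (dx dy : nat) (X : compact_dom R dx)
    (Y : compact_dom R dy) (l : pts Y -> pts Y -> R) (T N : nat)
    (z : 'I_T -> 'I_N -> pts X * pts Y) :
  masked_risk l z =
  fun f => icl_risk l f xpredT (fun j => [pred k : 'I_N | k != j]) z.
Proof. by apply/funext => f; rewrite /masked_risk /icl_risk card_ord natrM. Qed.

Lemma autoregressive_riskE (R : realType) (dx dy : nat) (X : compact_dom R dx)
    (Y : compact_dom R dy) (l : pts Y -> pts Y -> R) (T N : nat)
    (z : 'I_T -> 'I_N -> pts X * pts Y) : (0 < N)%N ->
  autoregressive_risk l z =
  fun f => icl_risk l f [pred j : 'I_N | (0 < j)%N] (fun j => [pred k : 'I_N | (k < j)%N]) z.
Proof.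
move=> N0; apply/funext => f.
by rewrite /autoregressive_risk /icl_risk card_ord_gt0// natrM.
Qed.

Theorem corollary7 (R : realType) :
  exists C : R -> R -> R -> R -> R -> R -> R -> R,
  forall (dx dy : nat) (X : compact_dom R dx) (Y : compact_dom R dy)
    (l : pts Y -> pts Y -> R) (Ll Lf : R) (F : set (predictor X Y))
    (P : meta_distribution X Y) (fstar : predictor X Y) (q s : R),
  (0 < dx)%N -> (0 < dy)%N ->
  lipschitz_loss Ll l ->
  (forall f, F f -> measurable_predictor f) ->
  (forall f, F f -> lipschitz_predictor Lf f) ->
  is_argmin F (risk P l) fstar ->
  1 < q -> 2 < s ->
  (meta_dstar 1 q P <= s%:E)%E ->
  [/\ (meta_dstar 1 q P < s%:E)%E ->
        exists cT : R, task_rate P s cT,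
      (3 <= dx + dy)%N -> exists cN : R, sample_rate X Y cN &
      forall cT cN : R, task_rate P s cT -> sample_rate X Y cN ->
      forall (T N : nat) (d : measure_display) (Om : measurableType d)
        (Pr : probability Om R) (rho : 'I_T -> Om -> Prob R (pts X * pts Y)%type)
        (z : 'I_T -> 'I_N -> Om -> (pts X * pts Y)%type)
        (fTN : Om -> predictor X Y),
      (1 <= T)%N -> (2 <= N)%N ->
      icl_sample Pr P rho z ->
      measurable_fun setT (fun w => risk P l (fTN w)) ->
      (forall w, is_argmin F (masked_risk l (fun t j => z t j w)) (fTN w)) \/
      (forall w, is_argmin F (autoregressive_risk l (fun t j => z t j w))
                   (fTN w)) ->
      ('E_Pr[fun w => risk P l (fTN w)] - (risk P l fstar)%:E <=
        (C Ll Lf (loss_bound l) (diam (dom_set X)) (diam (dom_set Y)) cT cN *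
          (T%:R `^ (- s^-1) + N%:R `^ (- ((dx + dy)%:R)^-1) + N%:R^-1))%:E)%E].
Proof.
(* With [A] and [B] the absolute values of [Ll] and [Lf], the sample terms add up to
   [2 * (2 * A * (1 + B) + 4 * A * B)] times [|cN|], and [8 * A * (1 + 2 * B)] dominates this
   factor. *)
exists (fun Ll Lf _ _ _ cT cN => (2 * (`|Ll| * (1 + 2 * `|Lf|)) + 1) * `|cT| +
  8 * (`|Ll| * (1 + 2 * `|Lf|)) * `|cN|).
move=> dx dy X Y l Ll Lf F P fstar q s dx0 dy0 l_lip _ F_lip [Fstar _] q1 s2 _.
split; [exact: dstar_task_rate|exact: sample_rate_exists|].
move=> cT cN rateT rateN T N d Om Pr rho z fTN T0 N2 smp mrisk fTN_min.
set A := `|Ll|; set B := `|Lf|; set be := ((dx + dy)%:R)^-1.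
have A0 : 0 <= A by exact: normr_ge0.
have B0 : 0 <= B by exact: normr_ge0.
have N0 : (0 < N)%N by exact: ltnW.
have be0 : 0 < be by rewrite invr_gt0 ltr0n addn_gt0 dx0.
have be2 : be <= 2^-1.
  rewrite lef_pV2 ?posrE ?ltr0n ?addn_gt0 ?dx0// ler_nat.
  exact: (leq_add dx0 dy0).
pose rt (n : nat) : R := n%:R `^ (- be).
have rt0 n : 0 <= rt n by exact: powR_ge0.
have rtp := rate_pred_le be0 be2 N2.
have Np0 : (0 < N.-1)%N by rewrite -ltnS prednK.
(* [KI] is the rate at the number of predicted positions and [KJ] the average rate of the contexts.
   The autoregressive case fixes both constants: 2 for passing from [N.-1] to [N], and another 2 for
   averaging over context lengths. *)
suff H : exists KI KJ : R, [/\ KI <= 2 * rt N, KJ <= 4 * rt N &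
    ('E_Pr[fun w => risk P l (fTN w)] - (risk P l fstar)%:E <=
   ((2 * (A * (1 + 2 * B)) + 1) * (`|cT| * T%:R `^ (- s^-1)) +
    2 * (A * (1 + B) * (`|cN| * KI) + A * B * (`|cN| * KJ)))%:E)%E].
  have [KI [KJ [hI hJ]]] := H; move=> /le_trans; apply; rewrite lee_fin -/be.
  set t := T%:R `^ _; rewrite -/(rt N).
  have t0 : 0 <= t by exact: powR_ge0.
  have h1 : A * (1 + B) * (`|cN| * KI) <= A * (1 + B) * (`|cN| * (2 * rt N)).
    by rewrite ler_wpM2l ?mulr_ge0 ?addr_ge0// ler_wpM2l.
  have h2 : A * B * (`|cN| * KJ) <= A * B * (`|cN| * (4 * rt N)).
    by rewrite ler_wpM2l ?mulr_ge0// ler_wpM2l.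
  set c1 := (2 * (A * (1 + 2 * B)) + 1) * `|cT|.
  set c2 := 8 * (A * (1 + 2 * B)) * `|cN|.
  have c10 : 0 <= c1 by rewrite mulr_ge0// addr_ge0// !mulr_ge0// addr_ge0// mulr_ge0.
  have c20 : 0 <= c2 by rewrite !mulr_ge0// addr_ge0// mulr_ge0.
  apply: (@le_trans _ _ (c1 * t + c2 * rt N)).
    rewrite mulrA lerD2l; apply: (le_trans (ler_wpM2l _ (lerD h1 h2))) => //.
    rewrite -subr_ge0 (_ : _ - _ = 4 * A * `|cN| * rt N + 4 * A * B * `|cN| * rt N).
      by rewrite addr_ge0// !mulr_ge0.
    by rewrite /c2; ring.
  rewrite -subr_ge0 (_ : _ - _ = c1 * rt N + c2 * t + (c1 + c2) * N%:R^-1).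
    by rewrite !addr_ge0// mulr_ge0// ?addr_ge0// invr_ge0.
  by ring.
case: fTN_min => fTN_min.
  exists (rt N), (N%:R^-1 * \sum_(j < N) rt N.-1); split.
  - by rewrite ler_peMl// ler1n.
  - have -> : \sum_(j < N) rt N.-1 = N%:R * rt N.-1.
      by rewrite sumr_const card_ord mulr_natl.
    rewrite mulKf ?pnatr_eq0 -?lt0n//; apply: (le_trans rtp).
    by rewrite ler_wpM2r// ler_nat.
  - have J0 (j : 'I_N) : xpredT j -> (0 < #|[pred k : 'I_N | k != j]|)%N.
      by move=> _; rewrite cardC1 card_ord.
    have I0 : (0 < #|xpredT : pred 'I_N|)%N by rewrite card_ord.
    have opt w : is_argmin F (fun f => icl_risk l f xpredT (fun j => [pred k : 'I_N | k != j])
        (fun t j => z t j w)) (fTN w).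
      by rewrite -masked_riskE.
    have := excess_risk l_lip F_lip Fstar rateT rateN T0 I0 J0 smp mrisk opt.
    rewrite card_ord -mulr_sumr [_^-1 * (`|cN| * _)]mulrCA.
    by under eq_bigr do rewrite cardC1 card_ord.
exists (rt N.-1), (N.-1%:R^-1 * \sum_(j < N.-1) rt j.+1); split.
- exact: rtp.
- have avg : N.-1%:R^-1 * \sum_(j < N.-1) rt j.+1 <= 2 * rt N.-1.
    exact: (rate_avg_le be2 Np0).
  apply: (le_trans avg).
  by have := ler_wpM2l (ler0n R 2) rtp; rewrite mulrA -natrM.
- pose I := [pred j : 'I_N | (0 < j)%N].
  pose J (j : 'I_N) := [pred k : 'I_N | (k < j)%N].
  have J0 j : I j -> (0 < #|J j|)%N by rewrite card_ord_lt.
  have I0 : (0 < #|I|)%N by rewrite card_ord_gt0.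
  have opt w : is_argmin F (fun f => icl_risk l f I J (fun t j => z t j w)) (fTN w).
    by rewrite -autoregressive_riskE.
  have := excess_risk l_lip F_lip Fstar rateT rateN T0 I0 J0 smp mrisk opt.
  rewrite card_ord_gt0// -mulr_sumr [_^-1 * (`|cN| * _)]mulrCA.
  under eq_bigr do rewrite card_ord_lt.
  by rewrite (sum_ord_gt0 rt N0).
Qed.
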